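(* Suppose that there exists a quadratic polynomial over $k$ which has no roots in $k$. Let $G_v$ be the stabilizer in $G=GL_2(\mathcal{C})$ of a vertex $v$ of the tree $\mathcal{T}$. (a) Suppose that the eigenvalues of every matrix in $G_v$ lie in $k$ and that at least one such matrix has distinct eigenvalues. Then there is a normal subgroup $N$ of $G_v$ with $$G_v/N\cong k^*\times k^*,$$ where $N\cong V^+$, the additive group of a finite-dimensional vector space $V$ over $k$. (b) Suppose that every matrix in $G_v$ has repeated eigenvalues in $k$. Then $G_v=Z\times N$ (internal direct product), where $N\cong V^+$ is isomorphic to the additive group of a finite-dimensional vector space $V$ over $k$ and $Z\cong k^*$ is the group of scalar matrices in $G$. (c) Suppose that $G_v$ contains a matrix whose eigenvalues are distinct and do not lie in $k$. Then $G_v$ is isomorphic to one of the following: (i) $L^*$, where $L$ is a separable quadratic extension of $k$; (ii) $GL_2(k)$; (iii) $Q^*$, the group of units of a quaternion division algebra $Q$ over $k$. (d) Suppose that every matrix of $G_v$ has repeated eigenvalues and that one such matrix has eigenvalues not in $k$. Then $\mathrm{char}(k)=2$ and $G_v\cong F^*$, where $F$ is a totally (i.e. purely) inseparable finite extension of $k$ of degree $2^m$, where $m\geq 1$. Moreover $2^{m-1}$ divides the degree of every place of $K$.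
   Context: Setting: $k$ is a field and $K$ is an algebraic function field of one variable with constant field $k$, where $k$ is algebraically closed in $K$. $\infty$ is a fixed place of $K$ of degree $\delta$, $\mathcal{C}$ is the ring of all elements of $K$ that are integral outside $\infty$ (a Dedekind domain with unit group $k^*$), and $G=GL_2(\mathcal{C})$. $K_\infty$ is the completion of $K$ at $\infty$, $\mathcal{O}_\infty$ its valuation ring, $\pi\in K$ a local parameter at $\infty$, $k_\infty$ the residue field (of degree $\delta$ over $k$). $\mathcal{T}$ is the Bruhat-Tits tree of $GL_2(K_\infty)$: its vertices are the left cosets of $Z_\infty GL_2(\mathcal{O}_\infty)$ in $GL_2(K_\infty)$, where $Z_\infty$ is the group of scalar matrices in $GL_2(K_\infty)$ (equivalently, homothety classes of rank $2$ $\mathcal{O}_\infty$-lattices in $K_\infty^2$); the vertices given by $g_1,g_2$ are adjacent iff $g_2^{-1}g_1$ lies in the same left coset of $Z_\infty GL_2(\mathcal{O}_\infty)$ as $\begin{pmatrix}\pi & z\\0&1\end{pmatrix}$, for some $z$ in a set of representatives of $k_\infty$, or as $\begin{pmatrix}\pi^{-1}&0\\0&1\end{pmatrix}$. $G$ acts on $\mathcal{T}$ by left multiplication, without inversion. $G_w$ denotes the stabilizer in $G$ of a vertex or edge $w$. Eigenvalues of matrices are taken in an algebraic closure; a $2\times 2$ matrix has repeated eigenvalues if its two eigenvalues coincide. *)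

(* Defs.v *)
From HB Require Import structures.
From mathcomp Require Import all_boot all_order all_algebra all_field.
From mathcomp Require Import boolp classical_sets functions.

Set Implicit Arguments.
Unset Strict Implicit.
Unset Printing Implicit Defensive.

Import Order.TTheory GRing.Theory Num.Theory.
Local Open Scope classical_set_scope.
Local Open Scope ring_scope.

(* The groups below may be infinite.  A group is a set A together with an     *)
(* operation op on the ambient type; only the values of op on A matter.       *)

Definition group_iso (T U : Type) (opT : T -> T -> T) (A : set T)
    (opU : U -> U -> U) (B : set U) : Prop :=
  exists f : T -> U, set_bij A B f /\
    forall x y, A x -> A y -> f (opT x y) = opU (f x) (f y).

Section UnitGroups.
Variable R : unitRingType.
Implicit Types G H N : set R.

Definition units : set R := [set x : R | x \is a GRing.unit].

Definition mulset (A B : set R) : set R := [set x * y | x in A & y in B].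

Definition subgroup H G : Prop :=
  [/\ G `<=` units, H `<=` G, H 1,
      forall x y, H x -> H y -> H (x * y)
    & forall x, H x -> H x^-1].

Definition normal_subgroup N G : Prop :=
  subgroup N G /\ forall g n, G g -> N n -> N (g * n * g^-1).

(* The set of left cosets of N; when N is normal, G / N is this set with      *)
(* the operation mulset.                                                      *)
Definition quotient_set G N : set (set R) :=
  [set [set g * n | n in N] | g in G].

Definition internal_direct_product G H N : Prop :=
  [/\ subgroup H G, subgroup N G,
      forall h n, H h -> N n -> h * n = n * h,
      H `&` N = [set 1]
    & G = mulset H N].

End UnitGroups.

Arguments units : clear implicits.

(* GL_2 of a subring A of F, inside the 2 x 2 matrices over F. *)
Definition GL2 (F : fieldType) (A : set F) : set 'M[F]_2 :=
  [set g : 'M[F]_2 | [/\ g \in unitmx, forall i j, A (g i j)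
                       & forall i j, A (invmx g i j)]].

(* A normalized discrete valuation.  The value of v at 0 should be infinite;  *)
(* it is set to 0, so that v is determined by its restriction to F^*, and v   *)
(* is compared with integers only through val_ge, for which v(0) is infinite. *)
Record discrete_valuation (F : fieldType) (v : F -> int) : Prop :=
  DiscreteValuation {
  dval0 : v 0 = 0;
  dvalM : forall x y, x != 0 -> y != 0 -> v (x * y) = v x + v y;
  dvalD : forall x y, x != 0 -> y != 0 -> x + y != 0 ->
            Order.min (v x) (v y) <= v (x + y);
  dval_uniformizer : exists2 t, t != 0 & v t = 1 }.

Definition val_ge (F : fieldType) (v : F -> int) (n : int) (x : F) : Prop :=
  x = 0 \/ n <= v x.

Definition valuation_ring (F : fieldType) (v : F -> int) : set F :=
  [set x | val_ge v 0 x].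

Section FunctionField.
Variables (k K : fieldType) (iota : {rmorphism k -> K}).

Definition in_simple_extension (x y : K) : Prop :=
  exists p q : {poly k}, (map_poly iota q).[x] != 0 /\
    y = (map_poly iota p).[x] / (map_poly iota q).[x].

Definition function_field : Prop :=
  exists2 x : K, ~ algebraicOver iota x &
    exists (n : nat) (e : 'I_n -> K), forall y : K,
      exists2 c : 'I_n -> K, (forall i, in_simple_extension x (c i))
        & y = \sum_(i < n) c i * e i.

Definition algebraically_closed_in : Prop :=
  forall y : K, algebraicOver iota y -> exists c : k, y = iota c.

(* Two places are the same when their valuations agree pointwise. *)
Record place := Place {
  place_val :> K -> int;
  place_dval : discrete_valuation place_val;
  place_const : forall c : k, place_val (iota c) = 0 }.

(* d is the dimension over k of the residue field of P. *)
Definition place_degree (P : place) (d : nat) : Prop :=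
  exists e : 'I_d -> K, (forall i, val_ge P 0 (e i)) /\
    forall y, val_ge P 0 y ->
      exists! c : 'rV[k]_d, val_ge P 1 (y - \sum_(i < d) iota (c 0 i) * e i).

Definition integral_outside (oo : place) : set K :=
  [set y | forall P : place, ~ (P =1 oo) -> val_ge P 0 y].

End FunctionField.

(* (Khat, vhat), with the embedding i, is a completion of (F, v); completions *)
(* are unique up to unique isomorphism.                                       *)
Record is_completion (F : fieldType) (v : F -> int) (Khat : fieldType)
    (vhat : Khat -> int) (i : {rmorphism F -> Khat}) : Prop := IsCompletion {
  compl_dval : discrete_valuation vhat;
  compl_ext : forall x, vhat (i x) = v x;
  compl_dense : forall (y : Khat) (n : int), exists x, val_ge vhat n (y - i x);
  compl_complete : forall u : nat -> Khat,
    (forall n : int, exists N : nat, forall a b : nat,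
       (N <= a)%N -> (N <= b)%N -> val_ge vhat n (u a - u b)) ->
    exists l, forall n : int, exists N : nat, forall a : nat,
       (N <= a)%N -> val_ge vhat n (u a - l) }.

Section Tree.
Variables (Khat : fieldType) (vhat : Khat -> int).

(* Z_oo GL_2(O_oo) *)
Definition ZGL2 : set 'M[Khat]_2 :=
  mulset [set a%:M | a in [set a : Khat | a != 0]] (GL2 (valuation_ring vhat)).

Definition tree_vertex (V : set 'M[Khat]_2) : Prop :=
  exists2 g, g \in unitmx & V = [set g * h | h in ZGL2].

Definition vertex_stabilizer (F : fieldType) (i : {rmorphism F -> Khat})
    (G : set 'M[F]_2) (V : set 'M[Khat]_2) : set 'M[F]_2 :=
  [set g | G g /\ [set map_mx i g * x | x in V] = V].

End Tree.

Section Eigenvalues.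
Variables (k K : fieldType) (iota : {rmorphism k -> K}).
Variables (Kbar : closedFieldType) (j : {rmorphism K -> Kbar}).

Definition is_algebraic_closure : Prop := forall z : Kbar, algebraicOver j z.

Definition eigenvalue_of (g : 'M[K]_2) (a : Kbar) : Prop :=
  eigenvalue (map_mx j g) a.

Definition in_constants (a : Kbar) : Prop := exists c : k, a = j (iota c).

Definition eigenvalues_in_k (g : 'M[K]_2) : Prop :=
  forall a, eigenvalue_of g a -> in_constants a.

Definition eigenvalues_not_in_k (g : 'M[K]_2) : Prop :=
  forall a, eigenvalue_of g a -> ~ in_constants a.

Definition distinct_eigenvalues (g : 'M[K]_2) : Prop :=
  exists a b, [/\ eigenvalue_of g a, eigenvalue_of g b & a != b].

(* Over an algebraically closed field at least one eigenvalue exists. *)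
Definition repeated_eigenvalues (g : 'M[K]_2) : Prop :=
  forall a b, eigenvalue_of g a -> eigenvalue_of g b -> a = b.

End Eigenvalues.

Definition quaternion_division_algebra (k : fieldType) (Q : falgType k) : Prop :=
  [/\ \dim {:Q} = 4%N, ('Z({:Q}) = 1)%VS
    & forall x : Q, x != 0 -> x \is a GRing.unit].

Definition separable_quadratic (k : fieldType) (L : fieldExtType k) : Prop :=
  \dim {:L} = 2%N /\ separable 1 {:L}.

(* Main.v *)
Require Import Defs.
From HB Require Import structures.
From mathcomp Require Import all_boot all_order all_algebra all_field.
From mathcomp Require Import boolp classical_sets functions.
From mathcomp Require Import ring.

Set Implicit Arguments.
Unset Strict Implicit.
Unset Printing Implicit Defensive.

Import Order.TTheory GRing.Theory Num.Theory.
Local Open Scope classical_set_scope.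
Local Open Scope ring_scope.

(** The stabilizer of a vertex is the unit group of a small algebra, and the
    theorem is the list of such algebras.

    Let v be the vertex of g.  If h in G fixes v, then g^-1 h g is a scalar
    times an element of GL_2(O_oo); as det h is in C^* = k^*, that scalar is a
    unit, so g^-1 h g is in M_2(O_oo).  Hence G_v is the unit group of the ring
    A of all h in M_2(C) with g^-1 h g in M_2(O_oo) [vertex_stabilizerE].
    Traces and determinants on A lie in C and in O_oo.  A function without
    poles is constant, so they lie in k: every x in A satisfies the equation
    x^2 - tr(x) x + det(x) = 0 with coefficients in k.  The entries of the
    elements of A have no poles outside oo and bounded poles at oo; expanding
    them at oo, where each digit ranges over a space of finite dimension, shows
    that A is finite-dimensional over k.  These are the axioms of
    [constant_order], and from there on only A and M_2(K) matter.

    That a function y transcendental over k has a pole [pole_exists] requires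
    the construction of a place with t = 1/y in its maximal ideal.  A
    subring of K containing k and t, maximal among those in which t is not
    invertible, is a valuation ring [valuation_ring_exists].  Since K is finite
    over k(t), there is one n > 0 such that every z^n is a unit times a power
    t^w(z) [isval_exists]; this w has integer values, and divided by the
    positive generator of its image it is a normalized valuation.

    Write e for an idempotent of A of rank one and f = 1 - e.

    (a) A matrix in G_v with two distinct eigenvalues in k provides e.  If the
    corners e A f and f A e had a nonzero product, A would contain a copy of
    M_2(k), and the companion matrix of the quadratic polynomial without roots
    would be a unit of A with eigenvalues outside k.  So g |-> (tr(g e), tr(g f))
    is multiplicative, and its kernel is 1 + J with J^2 = 0 [order_borel].

    (b) Nilpotent elements x, y of A satisfy tr(x y) = 0, because both
    (1 + x)(1 + y) and (1 + 2x)(1 + y) have repeated eigenvalues.  They therefore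
    form a subspace J with J^2 = 0, and each g is an eigenvalue times an element
    of 1 + J [order_split_unipotent].

    (c) Let g be the given matrix and L = k[g].  If A contains a nonzero
    singular element, it contains some e; both corners of g at e are nonzero
    because g has no eigenvector over K, and they are part of a system of matrix
    units, so A is M_2(k) [split_order_iso].  Otherwise A is the orthogonal sum,
    for the trace form, of L and a complement on which conjugation by g acts as
    the conjugation of L; either the complement is 0 and A = L, or it is L y and
    A is a quaternion algebra [order_nonsplit].

    (d) Now char k = 2 and every trace on A is 0.  Polarizing x^2 = - det x shows
    that A is commutative; it is a field F with F^2 inside k, so its degree is
    2^m.  Moreover F lies in the field K[g], quadratic over K.  Above a place of
    degree d the residue field of K[g] has degree d or 2d over k, and it is a
    vector space over F, so 2^m divides 2d [order_inseparable]. *)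

(** * Linear relations over rings of polynomials *)

(** A common denominator for finitely many fractions: P i d reads as: d clears
    the denominator of the i-th one. *)
Lemma common_multiple (R : idomainType) (I : finType) (P : I -> R -> Prop) :
  (forall i d e, P i d -> P i (d * e)) ->
  (forall i, exists2 d, d != 0 & P i d) ->
  exists2 d, d != 0 & forall i, P i d.
Proof.
move=> PM /(_ _)/cid2-/all_sig2[f f0 Pf].
exists (\prod_i f i); first by apply/prodf_neq0 => i _.
by move=> i; rewrite (bigD1 i) //=; apply: PM.
Qed.

Lemma fraction_num_den (R : idomainType) (x : {fraction R}) :
  exists2 d : R, d != 0 & exists n : R, tofrac d * x = tofrac n.
Proof.
elim/quotW: x => r; exists r.2; first exact: denom_ratioP.
exists r.1; unlock tofrac; rewrite -[LHS]FracField.pi_mul.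
apply/eqmodP => /=; rewrite FracField.equivfE /FracField.mulf.
by rewrite !numden_Ratio ?mulf_neq0 ?oner_neq0 ?denom_ratioP // !mul1r mulr1.
Qed.

(** Working with coefficients in a ring such as k[t], rather than in its field of
    fractions, makes it possible to evaluate the relation afterwards. *)
Lemma overdetermined_relation (R : idomainType) (J : finType) (m : nat)
    (c : 'I_m -> J -> R) : (#|J| < m)%N ->
  exists2 u : 'I_m -> R, exists i, u i != 0 &
    forall j, \sum_i u i * c i j = 0.
Proof.
move=> ltJm; pose C := \matrix_(i < m, l < #|J|) tofrac (c i (enum_val l)).
have nzC : kermx C != 0.
  rewrite -mxrank_eq0 mxrank_ker subn_eq0 -ltnNge.
  exact: leq_ltn_trans (rank_leq_col _) ltJm.
have [v vC nzv] : exists2 v : 'rV_m, v *m C = 0 & v != 0.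
  exists (nz_row (kermx C)); last by rewrite nz_row_eq0.
  by apply/sub_kermxP; apply: nz_row_sub.
have [i d e [n En]|i|d nzd] := @common_multiple R 'I_m
  (fun i d => exists n, tofrac d * v 0 i = tofrac n).
- by exists (n * e); rewrite tofracM mulrAC En tofracM.
- exact: fraction_num_den.
move=> /choice[u uE]; exists u.
  have [i nzvi] : exists i, v 0 i != 0.
    apply: contrapT => /forallNP v0; move/eqP: nzv; apply; apply/rowP => i.
    by rewrite mxE; apply/eqP; apply: contrapT => /negP; apply: v0.
  by exists i; rewrite -tofrac_eq0 -uE mulf_neq0 ?tofrac_eq0.
move=> j; apply/eqP; rewrite -tofrac_eq0 rmorph_sum /=; apply/eqP.
have /matrixP/(_ 0 (enum_rank j)) := vC; rewrite !mxE => vC0.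
transitivity (tofrac d * \sum_i v 0 i * C i (enum_rank j)); last first.
  by rewrite vC0 mulr0.
rewrite mulr_sumr; apply: eq_bigr => i _.
by rewrite tofracM -uE mxE enum_rankK mulrA.
Qed.

Section Ev.
Variables (k K : fieldType) (iota : {rmorphism k -> K}).

Definition ev (x : K) := horner_morph (fun a => mulrC x (iota a)).
HB.instance Definition _ x := GRing.RMorphism.on (ev x).

Definition transcendental x := forall p, ev x p = 0 -> p = 0.

Lemma transcendentalP x : ~ algebraicOver iota x -> transcendental x.
Proof.
move=> nalg p px0; apply/eqP/negP => /negP nzp; apply: nalg.
by exists p; rewrite // /root; apply/eqP.
Qed.

Lemma ev_neq0 x p : transcendental x -> p != 0 -> ev x p != 0.
Proof. by move=> tx nzp; apply: contraNneq nzp => /tx->. Qed.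

Hypothesis hK : function_field iota.

(** Finiteness of K over k(x), with all denominators cleared. *)
Lemma function_field_generators : exists2 x : K, transcendental x &
  exists (n : nat) (e : 'I_n -> K), forall m (z : 'I_m -> K),
    exists2 q, q != 0 & exists p : 'I_m -> 'I_n -> {poly k},
      forall i, ev x q * z i = \sum_j ev x (p i j) * e j.
Proof.
have [x /transcendentalP tx [n [e gen]]] := hK; exists x => //.
exists n, e => m z.
have [i d d' [p pE]|i|q nzq /choice[p pE]] := @common_multiple _ 'I_m
    (fun i q => exists p : 'I_n -> {poly k},
       ev x q * z i = \sum_j ev x (p j) * e j).
- exists (fun j => p j * d'); rewrite rmorphM /= mulrAC pE mulr_suml.
  by apply: eq_bigr => j _; rewrite rmorphM mulrAC.
- have [c cP ->] := gen (z i).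
  have [j d d' [p pE]|j|q nzq /choice[p pE]] := @common_multiple _ 'I_n
    (fun j d => exists p, ev x d * c j = ev x p).
  + by exists (p * d'); rewrite !rmorphM /= mulrAC pE.
  + have [p [q [nzq ->]]] := cP j; exists q.
      by apply: contraNneq nzq => ->; rewrite rmorph0 horner0.
    by exists p; rewrite mulrC divfK.
  exists q => //; exists p.
  by rewrite mulr_sumr; apply: eq_bigr => j _; rewrite mulrA pE.
by exists q => //; exists p.
Qed.

(** This exchanges the roles of x and t in an algebraic relation between them. *)
Lemma ev_swapXY (S : {poly {poly k}}) x t :
  (map_poly (ev t) (swapXY S)).[x] = (map_poly (ev x) S).[t].
Proof.
have ev2 (y z : K) (P : {poly {poly k}}) :
    (map_poly (ev y) P).[z] = (map_poly (map_poly iota) P).[z, y].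
  rewrite (horner_coef_wide _ (size_poly _ _)).
  rewrite [in RHS](horner_coef_wide _ (size_poly _ _)) horner_sum.
  by apply: eq_bigr => i _; rewrite !coef_map hornerM -rmorphXn hornerC.
rewrite !ev2 -horner2_swapXY; congr _.[_, _].
by rewrite -swapXY_map swapXYK.
Qed.

(** K is finite over k(t) for every transcendental t, by the exchange property;
    B is a bound on the degree, uniform in the elements z. *)
Lemma uniform_algebraic_relation t : transcendental t ->
  exists B, forall z : 'I_B.+1 -> K,
    exists2 u : 'I_B.+1 -> {poly k}, exists i, u i != 0 &
      \sum_i ev t (u i) * z i = 0.
Proof.
move=> tt; have [x tx [n [e gen]]] := function_field_generators.
(* x is algebraic over k(t): a relation over k[x] between powers of t is,
   read the other way, one over k[t] between powers of x. *)
have [Q nzQ Qx] : exists2 Q : {poly {poly k}}, Q != 0 &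
    (map_poly (ev t) Q).[x] = 0.
  have [q nzq [p pE]] := gen n.+1 (fun i => t ^+ i).
  have [|u [i0 nzu] u0] := @overdetermined_relation {poly k} 'I_n n.+1 p.
    by rewrite card_ord.
  pose S := \poly_(i < n.+1) (q * u (inord i)).
  exists (swapXY S).
    rewrite swapXY_eq0; apply: contraNneq nzu => /(congr1 (fun s : {poly {poly k}} => s`_i0)).
    rewrite coef_poly ltn_ord inord_val coef0 => /eqP.
    by rewrite mulf_eq0 (negPf nzq).
  rewrite ev_swapXY (horner_coef_wide (n := n.+1)); last first.
    by rewrite (leq_trans (size_poly _ _)) ?size_poly.
  transitivity (\sum_i \sum_j ev x (u i * p i j) * e j); last first.
    rewrite exchange_big big1 //= => j _.
    by rewrite -mulr_suml -rmorph_sum u0 rmorph0 mul0r.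
  apply: eq_bigr => i _; rewrite coef_map coef_poly ltn_ord inord_val.
  rewrite /= rmorphM mulrAC pE mulr_suml.
  by apply: eq_bigr => j _; rewrite rmorphM mulrC mulrA.
pose l := lead_coef Q.
have nzl : l != 0 by rewrite lead_coef_eq0.
have divQ m J (p : 'I_m -> 'I_J -> {poly k}) : exists2 s, s != 0 &
   exists r : 'I_m -> 'I_J * 'I_(size Q) -> {poly k},
   forall i j, ev t s * ev x (p i j) = \sum_a ev t (r i (j, a)) * x ^+ a.
  have [ij d d' [r rE]|[i j]|s nzs /choice[r rE]] :=
    @common_multiple {poly k} ('I_m * 'I_J)%type (fun ij s =>
      exists r : 'I_(size Q) -> {poly k},
        ev t s * ev x (p ij.1 ij.2) = \sum_a ev t (r a) * x ^+ a).
  - exists (fun a => r a * d'); rewrite rmorphM /= mulrAC rE mulr_suml.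
    by apply: eq_bigr => a _; rewrite rmorphM mulrAC.
  - pose P : {poly {poly k}} := map_poly polyC (p i j).
    exists (l ^+ scalp P Q); first exact: expf_neq0.
    exists (fun a => (P %% Q)%R`_a) => /=.
    have <- : (map_poly (ev t) P).[x] = ev x (p i j).
      rewrite /P -map_poly_comp; congr horner.
      by apply: eq_map_poly => c; rewrite /= /ev horner_morphC.
    have /(congr1 (fun W => (map_poly (ev t) W).[x])) := Pdiv.Idomain.divp_eq P Q.
    rewrite /= rmorphD rmorphM hornerD hornerM Qx mulr0 add0r map_polyZ hornerZ => ->.
    rewrite (horner_coef_wide (n := size Q)); last first.
      by rewrite (leq_trans (size_poly _ _)) // ltnW // Pdiv.Idomain.ltn_modp.
    by apply: eq_bigr => a _; rewrite coef_map.
  by exists s => //; exists (fun i ja => r (i, ja.1) ja.2) => i j; apply: (rE (i, j)).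
exists (n * size Q)%N => z.
have [q nzq [p pE]] := gen _ z.
have [s nzs [r rE]] := divQ _ _ p.
have [|u nzu u0] := @overdetermined_relation {poly k} _ _ r.
  by rewrite card_prod !card_ord.
exists u => //; apply: (mulfI (ev_neq0 tt nzs)); apply: (mulfI (ev_neq0 tx nzq)).
rewrite !mulr0 !mulr_sumr.
transitivity (\sum_i \sum_j \sum_a ev t (u i * r i (j, a)) * (x ^+ a * e j)).
  apply: eq_bigr => i _.
  transitivity (ev t (u i) * (ev t s * (ev x q * z i))); first by ring.
  rewrite pE !mulr_sumr; apply: eq_bigr => j _.
  rewrite [ev t s * _]mulrA rE mulr_suml mulr_sumr.
  by apply: eq_bigr => a _; rewrite rmorphM -!mulrA.
rewrite exchange_big big1 //= => j _; rewrite exchange_big big1 //= => a _.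
by rewrite -mulr_suml -rmorph_sum u0 rmorph0 mul0r.
Qed.
End Ev.

(** * Valuation rings from maximal subrings *)

Definition is_subring (R : nzRingType) (A : set R) :=
  [/\ A 1, forall x y, A x -> A y -> A (x - y)
    & forall x y, A x -> A y -> A (x * y)].

Section Closure.
Variables (R : nzRingType) (A : set R) (rA : is_subring A).
Lemma subring1 : A 1. Proof. by case: rA. Qed.
Lemma subringB x y : A x -> A y -> A (x - y). Proof. by case: rA => _ + _; apply. Qed.
Lemma subringM x y : A x -> A y -> A (x * y). Proof. by case: rA => _ _; apply. Qed.
Lemma subring0 : A 0. Proof. by rewrite -(subrr 1); apply/subringB; exact: subring1. Qed.
Lemma subringN x : A x -> A (- x).
Proof. by move=> Ax; rewrite -sub0r; apply: subringB => //; exact: subring0. Qed.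
Lemma subringD x y : A x -> A y -> A (x + y).
Proof. by move=> Ax Ay; rewrite -[y]opprK; apply: subringB => //; apply: subringN. Qed.
Lemma subring_sum I (r : seq I) (F : I -> R) :
  (forall i, A (F i)) -> A (\sum_(i <- r) F i).
Proof.
by move=> AF; apply: (big_ind A) => //; [exact: subring0 | exact: subringD].
Qed.
Lemma subringX x n : A x -> A (x ^+ n).
Proof.
move=> Ax; elim: n => [|n IH]; first by rewrite expr0; exact: subring1.
by rewrite exprS; apply: subringM.
Qed.
End Closure.

Section ValuationRing.
Variable K : fieldType.
Implicit Types A B : set K.

Definition avoids B (t : K) A := [/\ is_subring A, B `<=` A, A t & ~ A t^-1].

Lemma maximal_avoiding B t A0 : avoids B t A0 ->
  exists A, avoids B t A /\ forall A', avoids B t A' -> A `<=` A' -> A' `<=` A.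
Proof.
move=> gA0; pose P A := A = set0 \/ avoids B t A.
have [F FP totF|A [PA maxA]] := @Zorn_bigcup K P; last first.
  have gA : avoids B t A.
    case: PA => // A0E; case: (maxA A0); last by right.
    rewrite A0E; split; first by move=> x /=.
    by case: gA0 => [[A01 _ _] _ _ _] /(_ 1 A01).
  exists A; split => // A' gA' AA'; apply: contrapT => nA'A.
  by apply: (maxA A'); [split | right].
have [[X FX gX]|noX] := pselect (exists2 X, F X & avoids B t X); last first.
  left; rewrite -subset0 => x [X FX Xx].
  have [X0|gX] := FP _ FX; first by rewrite X0 in Xx.
  by apply: noX; exists X.
right; have [[X1 XB XM] BX Xt nXt] := gX.
have pair x y : (\bigcup_(X in F) X) x -> (\bigcup_(X in F) X) y ->
    exists2 Y, F Y /\ avoids B t Y & Y x /\ Y y.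
  move=> [Y FY Yx] [Y' FY' Yy].
  have gY : avoids B t Y by case: (FP _ FY) Yx => [->|].
  have gY' : avoids B t Y' by case: (FP _ FY') Yy => [->|].
  have [s|s] := totF _ _ FY FY'; first by exists Y' => //; split => //; exact: s.
  by exists Y => //; split => //; exact: s.
split.
- split; first by exists X.
    by move=> x y /pair H /H[Y [FY [[_ YB _] _ _ _]] [Yx Yy]]; exists Y => //; apply: YB.
  by move=> x y /pair H /H[Y [FY [[_ _ YM] _ _ _]] [Yx Yy]]; exists Y => //; apply: YM.
- by move=> x /BX; exists X.
- by exists X.
- move=> [Y FY]; have [->|[_ _ _ nY]] := FP _ FY; first by [].
  exact: nY.
Qed.

Section Maximal.
Variables (B A : set K) (t : K).
Hypotheses (gA : avoids B t A)
  (maxA : forall A', avoids B t A' -> A `<=` A' -> A' `<=` A).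
Let rA : is_subring A. Proof. by case: gA. Qed.
Let BA : B `<=` A. Proof. by case: gA. Qed.
Let At : A t. Proof. by case: gA. Qed.
Let nAt : ~ A t^-1. Proof. by case: gA. Qed.
Let t0 : t != 0.
Proof. by apply/eqP => t0; apply: nAt; rewrite t0 invr0; exact: subring0. Qed.

Let tn1 s : A s -> 1 + t * s != 0.
Proof.
move=> As; apply/eqP => /(canRL (addrK _)); rewrite sub0r => e1.
apply: nAt; suff -> : t^-1 = - s by apply: subringN.
by apply: (mulfI t0); rewrite divff // e1 mulrN.
Qed.

(** The localization of A at 1 + t A still avoids t^-1, so it is A itself. *)
Lemma maximal_unit s : A s -> A (1 + t * s)^-1.
Proof.
move=> As.
pose L := [set a / (1 + t * s') | a in A & s' in A].
suff /maxA LA : avoids B t L.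
  apply: LA; last by exists 1; [exact: subring1 | exists s => //; rewrite mul1r].
  by move=> x Ax; exists x => //; exists 0; [exact: subring0 | rewrite mulr0 addr0 divr1].
have AL : A `<=` L.
  by move=> x Ax; exists x => //; exists 0; [exact: subring0 | rewrite mulr0 addr0 divr1].
have AD s1 s2 : A s1 -> A s2 -> A (s1 + s2 + t * s1 * s2).
  by move=> A1 A2; do ![apply: subringD => //|apply: subringM => //].
have A1 s1 : A s1 -> A (1 + t * s1).
  by move=> A1; apply: subringD => //; [exact: subring1 | exact: subringM].
split; [split|exact: (subset_trans BA AL)|exact: (AL _ At)|].
- exact: (AL _ (subring1 rA)).
- move=> _ _ [a Aa [s1 As1 <-]] [b Ab [s2 As2 <-]].
  exists (a * (1 + t * s2) - b * (1 + t * s1)).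
    by apply: subringB => //; apply: subringM => //; apply: A1.
  exists (s1 + s2 + t * s1 * s2); first exact: AD.
  have -> : 1 + t * (s1 + s2 + t * s1 * s2) = (1 + t * s1) * (1 + t * s2) by ring.
  by field; rewrite !tn1.
- move=> _ _ [a Aa [s1 As1 <-]] [b Ab [s2 As2 <-]].
  exists (a * b); first exact: subringM.
  exists (s1 + s2 + t * s1 * s2); first exact: AD.
  have -> : 1 + t * (s1 + s2 + t * s1 * s2) = (1 + t * s1) * (1 + t * s2) by ring.
  by rewrite invfM mulrACA.
- move=> [a Aa [s1 As1 E]]; apply: nAt.
  suff -> : t^-1 = a - s1 by apply: subringB.
  have := canRL (divfK (tn1 As1)) E.
  by rewrite mulrDr mulr1 mulKf // => ->; rewrite addrK.
Qed.

Let coefs (p : {poly K}) := forall i, A p`_i.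

Let coefsD p q : coefs p -> coefs q -> coefs (p + q).
Proof. by move=> Ap Aq i; rewrite coefD; apply: subringD. Qed.
Let coefsM p q : coefs p -> coefs q -> coefs (p * q).
Proof.
by move=> Ap Aq i; rewrite coefM; apply: subring_sum => // j; apply: subringM.
Qed.
Let coefsZ c p : A c -> coefs p -> coefs (c *: p).
Proof. by move=> Ac Ap i; rewrite coefZ; apply: subringM. Qed.
Let coefsXn n : coefs 'X^n.
Proof.
by move=> i; rewrite coefXn; case: eqP => _; [exact: subring1 | exact: subring0].
Qed.
Let coefs_poly n (F : nat -> K) : (forall i, (i < n)%N -> A (F i)) -> coefs (\poly_(i < n) F i).
Proof.
by move=> AF i; rewrite coef_poly; case: ifP => [/AF //|_]; exact: subring0.
Qed.

(* The relation t q(1/x) = 1 expresses x^m, for m = deg q, by lower powers of x,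
   since 1 - t q_0 is invertible; substituting it in the leading term of p
   lowers the degree. *)
Let reduce (x : K) (p q : {poly K}) : x != 0 -> (size q <= size p)%N -> coefs p -> coefs q ->
    t * p.[x] = 1 -> t * q.[x^-1] = 1 ->
  exists2 p' : {poly K}, (size p' < size p)%N & coefs p' /\ t * p'.[x] = 1.
Proof.
move=> x0 leqp Ap Aq px qx.
have nzq : q != 0.
  by apply: contraPneq qx => ->; rewrite horner0 mulr0 => /esym/eqP; rewrite oner_eq0.
have nzp : p != 0.
  by apply: contraPneq px => ->; rewrite horner0 mulr0 => /esym/eqP; rewrite oner_eq0.
pose m := (size q).-1; pose n := (size p).-1.
have sq : size q = m.+1 by rewrite prednK // lt0n size_poly_eq0.
have sp : size p = n.+1 by rewrite prednK // lt0n size_poly_eq0.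
have lemn : (m <= n)%N by rewrite -ltnS -sq -sp.
pose c := (1 + t * (- q`_0))^-1.
have Ac : A c by apply: maximal_unit; apply: subringN.
pose r := c *: \poly_(i < m) q`_(m - i).
have Ar : coefs r by apply: coefsZ => //; apply: coefs_poly => i _.
have xm : x ^+ m = t * r.[x].
  have E : x ^+ m = t * \sum_(j < m.+1) q`_(m - j) * x ^+ j.
    rewrite -[LHS]mul1r -qx -mulrA; congr (_ * _).
    rewrite horner_coef sq mulr_suml (reindex_inj rev_ord_inj) /=.
    apply: eq_bigr => j _; rewrite subSS -mulrA; congr (_ * _).
    have ljm : (j <= m)%N by rewrite -ltnS.
    by rewrite -[in x ^+ m](subnK ljm) exprD mulrA -exprMn mulVf // expr1n mul1r.
  rewrite big_ord_recr /= subnn mulrDr mulrA in E.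
  rewrite hornerZ horner_poly mulrCA.
  apply: (mulfI (tn1 (subringN rA (Aq 0%N)))).
  rewrite mulVKf ?tn1 //; last exact: subringN.
  by rewrite mulrDl mul1r mulrN mulNr; apply/eqP; rewrite subr_eq -E.
exists (\poly_(i < n) p`_i + (p`_n * t) *: ('X^(n - m) * r)); last split.
- rewrite sp ltnS (leq_trans (size_polyD _ _)) // geq_max size_poly /=.
  rewrite (leq_trans (size_scale_leq _ _)) // mulrC.
  have [->|nzr] := eqVneq r 0; first by rewrite mul0r size_poly0.
  rewrite size_mulXn // -{2}(subnK lemn) leq_add2l.
  by rewrite (leq_trans (size_scale_leq _ _)) ?size_poly.
- apply: coefsD; first by apply: coefs_poly => i _.
  by apply: coefsZ; [apply: subringM | apply: coefsM].
- rewrite -px hornerD hornerZ hornerM hornerXn horner_poly [p.[x]]horner_coef sp.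
  rewrite big_ord_recr /=; congr (_ * (_ + _)).
  by rewrite -[in x ^+ n](subnK lemn) exprD xm; ring.
Qed.

(** If neither x nor 1/x is in A, both A[x] and A[1/x] contain t^-1 by maximality.
    Descending on the degrees of the two expressions gives a contradiction. *)
Lemma maximal_valuation x : x != 0 -> A x \/ A x^-1.
Proof.
move=> x0; apply: contrapT => /not_orP[nx nxV].
have adjoin z : ~ A z -> exists2 p, coefs p & t * p.[z] = 1.
  move=> nz; pose L := [set p.[z] | p in coefs].
  have AL : A `<=` L.
    move=> a Aa; exists a%:P; last by rewrite hornerC.
    by move=> i; rewrite coefC; case: eqP => // _; exact: subring0.
  have nL : ~ avoids B t L.
    move=> /maxA/(_ AL) LA; apply: nz; apply: LA; exists 'X; last by rewrite hornerX.
    by rewrite -['X]expr1; exact: coefsXn.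
  have rL : is_subring L.
    split; first exact: (AL _ (subring1 rA)).
      move=> _ _ [p Ap <-] [q Aq <-]; exists (p - q); last by rewrite hornerD hornerN.
      by rewrite -scaleN1r; apply: coefsD => //; apply: coefsZ => //; apply: (subringN rA); exact: subring1.
    move=> _ _ [p Ap <-] [q Aq <-]; exists (p * q); last by rewrite hornerM.
    exact: coefsM.
  have [[p Ap pz]|nLt] := pselect (L t^-1); first by exists p; rewrite // pz divff.
  by case: nL; split => //; [exact: (subset_trans BA AL) | exact: (AL _ At)].
have [p Ap px] := adjoin _ nx; have [q Aq qx] := adjoin _ nxV.
move: {2}(size p + size q)%N (leqnn (size p + size q)) => N leN.
elim: N => [|N IH] in x p q x0 Ap px Aq qx leN {nx nxV} *.
  move: leN; rewrite leqn0 addn_eq0 size_poly_eq0 => /andP[/eqP p0 _].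
  by move/eqP: px; rewrite p0 horner0 mulr0 eq_sym oner_eq0.
wlog leqp : x p q x0 Ap px Aq qx leN / (size q <= size p)%N => [wh|].
  have [|/ltnW lepq] := leqP (size q) (size p); first exact: wh px Aq qx leN.
  by apply: (wh x^-1 q p); rewrite ?invr_eq0 ?invrK // addnC.
have [p' ltp [Ap' p'x]] := reduce x0 leqp Ap Aq px qx.
apply: (IH x p' q) => //; rewrite -ltnS (leq_trans _ leN) //.
by rewrite ltn_add2r.
Qed.
End Maximal.

(** Chevalley's extension theorem, for a single element t. *)
Lemma valuation_ring_exists B t A0 : avoids B t A0 -> exists A,
  avoids B t A /\ forall x, x != 0 -> A x \/ A x^-1.
Proof.
move=> /maximal_avoiding[A [gA mA]]; exists A; split => //.
exact: maximal_valuation gA mA.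
Qed.
End ValuationRing.

(** * Places of a function field and existence of poles *)

Section UnitClasses.
Variables (K : fieldType) (A : set K).
Hypotheses (rA : is_subring A) (vA : forall x, x != 0 -> A x \/ A x^-1).

Definition vunit (x : K) := [/\ x != 0, A x & A x^-1].

Lemma vunit1 : vunit 1.
Proof. by split; rewrite ?invr1 ?oner_neq0 //; exact: subring1. Qed.
Lemma vunitM x y : vunit x -> vunit y -> vunit (x * y).
Proof.
move=> [x0 Ax AVx] [y0 Ay AVy]; split; rewrite ?mulf_neq0 ?invfM //; exact: subringM.
Qed.
Lemma vunitV x : vunit x -> vunit x^-1.
Proof. by move=> [x0 Ax AVx]; split; rewrite ?invr_eq0 ?invrK. Qed.

Lemma vunitX x n : vunit x -> vunit (x ^+ n).
Proof.
move=> ux; elim: n => [|n IH]; first by rewrite expr0; exact: vunit1.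
by rewrite exprS; apply: vunitM.
Qed.

Lemma vunit_add1 x : A x -> ~ A x^-1 -> vunit (1 + x).
Proof.
move=> Ax nx.
have x0 : x != 0 by apply/eqP => x0; apply: nx; rewrite x0 invr0 -x0.
have x1 : 1 + x != 0.
  apply/eqP => /(canRL (addrK _)) e1; apply: nx.
  have -> : x = - 1 by rewrite e1 sub0r opprK.
  by rewrite invrN1; apply: subringN => //; exact: subring1.
have A1x : A (1 + x) by apply: subringD => //; exact: subring1.
split=> //; have [|A1|A1] := @vA ((1 + x) / x).
- by rewrite mulf_neq0 ?invr_eq0.
- case: nx; have -> : x^-1 = (1 + x) / x - 1 by field.
  by apply: subringB => //; exact: subring1.
have -> : (1 + x)^-1 = 1 - ((1 + x) / x)^-1 by field; rewrite x1 x0.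
by apply: subringB => //; exact: subring1.
Qed.

(** In a sum of terms with pairwise distinct valuations the term of least
    valuation dominates; in particular the sum is not zero. *)
Lemma vunit_sum (I : eqType) (s : seq I) (f : I -> K) : uniq s ->
  {in s, forall i, f i != 0} ->
  {in s &, forall i j, i != j -> ~ vunit (f i / f j)} ->
  s != [::] -> exists2 i, i \in s & vunit ((\sum_(j <- s) f j) / f i).
Proof.
elim: s => // i [|i' s] IH /andP[nis us] f0 nf _.
  exists i; rewrite ?mem_head // big_seq1 mulfV ?f0 ?mem_head //; exact: vunit1.
have [||//|j js] := IH us.
- by move=> j js; rewrite f0 // in_cons js orbT.
- by move=> a b a_s b_s; apply: nf; rewrite in_cons ?a_s ?b_s orbT.
set S := \sum_(j <- _) f j => uS; rewrite big_cons -/S.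
have fi0 : f i != 0 by rewrite f0 ?mem_head.
have fj0 : f j != 0 by rewrite f0 // in_cons js orbT.
have S0 : S != 0 by case: uS; rewrite mulf_eq0 => /norP[].
have nij : ~ vunit (f i / S).
  move=> u; apply: (nf i j); rewrite ?mem_head //; first by rewrite in_cons js orbT.
    by apply: contraNneq nis => ->.
  by have := vunitM u uS; rewrite mulrA divfK.
have [|AiS|ASi] := @vA (f i / S); first by rewrite mulf_neq0 ?invr_eq0.
  exists j; first by rewrite in_cons js orbT.
  have -> : (f i + S) / f j = (S / f j) * (1 + f i / S).
    by field; rewrite S0 fj0.
  apply: vunitM => //; apply: vunit_add1 => // AV.
  by apply: nij; split=> //; rewrite mulf_neq0 ?invr_eq0.
exists i; first exact: mem_head.
rewrite invf_div in ASi.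
have -> : (f i + S) / f i = 1 + S / f i by rewrite mulrDl mulfV.
apply: vunit_add1 => //; rewrite invf_div => AV; apply: nij; split=> //.
  by rewrite mulf_neq0 ?invr_eq0.
by rewrite invf_div.
Qed.
End UnitClasses.

Section Pole.
Variables (k K : fieldType) (iota : {rmorphism k -> K}).
Hypothesis hK : function_field iota.

Lemma avoids_eval t : transcendental iota t ->
  avoids (range iota) t [set ev iota t p | p in [set: {poly k}]].
Proof.
move=> tt; split.
- split; first by exists 1; rewrite ?rmorph1.
    by move=> _ _ [p _ <-] [q _ <-]; exists (p - q); rewrite ?rmorphB.
  by move=> _ _ [p _ <-] [q _ <-]; exists (p * q); rewrite ?rmorphM.
- by move=> _ [c _ <-]; exists c%:P; rewrite // /ev horner_morphC.
- by exists 'X; rewrite // /ev horner_morphX.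
move=> [p _ pE].
have t0 : t != 0.
  have := @ev_neq0 _ _ iota t 'X tt; rewrite polyX_eq0 /ev horner_morphX.
  by apply.
have /tt/eqP : ev iota t ('X * p - 1) = 0.
  by rewrite rmorphB rmorphM rmorph1 /= pE {1}/ev horner_morphX mulfV ?subrr.
rewrite subr_eq0 => /eqP/(congr1 (fun q : {poly k} => q.[0])) /eqP.
by rewrite hornerM hornerX mul0r hornerC eq_sym oner_eq0.
Qed.

Variables (t : K) (A : set K).
Hypotheses (tt : transcendental iota t) (gA : avoids (range iota) t A).
Hypothesis vA : forall x, x != 0 -> A x \/ A x^-1.
Let rA : is_subring A. Proof. by case: gA. Qed.
Let Ac c : A (iota c). Proof. by case: gA => _ + _ _; apply; exists c. Qed.
Let At : A t. Proof. by case: gA. Qed.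
Let nAt : ~ A t^-1. Proof. by case: gA. Qed.
Let t0 : t != 0.
Proof. by apply/eqP => t0; apply: nAt; rewrite t0 invr0; exact: subring0. Qed.
Local Notation U := (vunit A).

Lemma vunit_const c : c != 0 -> U (iota c).
Proof. by move=> c0; split; rewrite ?fmorph_eq0 // -fmorphV. Qed.

(** The valuation of k(t) determined by t: split off the powers of t, what
    remains has a nonzero constant term. *)
Lemma vunit_eval p : p != 0 -> exists e, U (ev iota t p / t ^+ e).
Proof.
move=> p0; have [e [q + pE]] := multiplicity_XsubC p 0.
rewrite p0 /= => q0; exists e.
rewrite pE subr0 rmorphM rmorphXn /= {2}/ev horner_morphX mulfK ?expf_neq0 //.
have [r [c qE]] : exists r c, q = r * 'X + c%:P.
  by elim/poly_ind: (q) => [|r c _]; [exists 0, 0; rewrite mul0r addr0 | exists r, c].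
have c0 : c != 0 by move: q0; rewrite qE /root hornerMXaddC mulr0 add0r.
have -> : ev iota t q = iota c * (1 + t * (ev iota t r / iota c)).
  rewrite qE rmorphD rmorphM /= {2 3}/ev horner_morphX horner_morphC.
  by field; rewrite fmorph_eq0.
have Ar : A (ev iota t r / iota c).
  apply: subringM => //; last by rewrite -fmorphV.
  elim/poly_ind: (r) => [|s d IH]; first by rewrite rmorph0; exact: subring0.
  rewrite rmorphD rmorphM /= {2 3}/ev horner_morphX horner_morphC.
  by apply: subringD => //; apply: subringM.
apply: vunitM => //; first exact: vunit_const.
set s := _ / iota c in Ar *; have [->|s0] := eqVneq s 0.
  by rewrite mulr0 addr0; apply: vunit1.
apply: vunit_add1 => //; first exact: subringM.
rewrite invfM => AV; apply: nAt.
have -> : t^-1 = t^-1 * s^-1 * s by rewrite -mulrA mulVf ?mulr1.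
by apply: subringM.
Qed.

Local Notation isval n z m := (U (z ^+ n / t ^ m)).

Lemma vunit_exp (m : int) : A (t ^ m) -> 0 <= m.
Proof.
case: m => // m Am; case: nAt.
have -> : t^-1 = t ^ (Negz m) * t ^+ m by rewrite NegzE -exprnN exprS invfM mulfVK ?expf_neq0.
by apply: subringM => //; apply: subringX.
Qed.

Lemma isval_ge0 n z m : (0 < n)%N -> isval n z m -> A z <-> 0 <= m.
Proof.
move=> n0 [nz u uV].
have tm0 : t ^ m != 0 by rewrite expfz_neq0.
have z0 : z != 0 by apply: contraNneq nz => ->; rewrite expr0n eqn0Ngt n0 mul0r.
split=> [Az|m0].
  apply: vunit_exp; have -> : t ^ m = (z ^+ n / t ^ m)^-1 * z ^+ n.
    by rewrite invf_div divfK ?expf_neq0.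
  by apply: subringM => //; apply: subringX.
have Azn : A (z ^+ n).
  rewrite -(divfK tm0 (z ^+ n)); apply: subringM => //.
  by case: m m0 {nz u uV tm0} => // m _; apply: subringX.
have [//|AzV] := vA z0.
have -> : z = z ^+ n * z^-1 ^+ n.-1.
  by rewrite -{1}(prednK n0) exprSr exprVn mulrAC mulfV ?mul1r ?expf_neq0.
by apply: subringM => //; apply: subringX.
Qed.

Lemma isvalM n z z' m m' : isval n z m -> isval n z' m' -> isval n (z * z') (m + m').
Proof.
move=> u u'; have -> : (z * z') ^+ n / t ^ (m + m') = (z ^+ n / t ^ m) * (z' ^+ n / t ^ m').
  by rewrite exprMn expfzDr // invfM mulrACA.
exact: vunitM.
Qed.

Lemma isval_inj n z m m' : isval n z m -> isval n z m' -> m = m'.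
Proof.
have le a b : isval n z a -> isval n z b -> b <= a.
  move=> ua ub; have [_ + _] := vunitM rA (vunitV ua) ub.
  have z0 : z ^+ n != 0 by case: ua; rewrite mulf_eq0 => /norP[].
  rewrite invf_div mulrA divfK // invr_expz -expfzDr // => /vunit_exp.
  by rewrite subr_ge0.
by move=> ua ub; apply/eqP; rewrite eq_le !le.
Qed.

(** A relation over k[t] between 1, z, ..., z^B has two terms of equal valuation,
    so z^d is a unit times a power of t for some d between 1 and B; the factorial
    of B is a multiple of all such d. *)
Lemma isval_exists : exists2 n, (0 < n)%N & forall z, z != 0 -> exists m, isval n z m.
Proof.
have [B rel] := uniform_algebraic_relation hK tt.
exists (B`!); first exact: fact_gt0.
move=> z z0; have [u [i0 ui0] u0] := rel (fun i => z ^+ i).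
pose f (i : 'I_B.+1) := ev iota t (u i) * z ^+ i.
have f_neq0 i : u i != 0 -> f i != 0 by move=> ui; rewrite mulf_neq0 ?expf_neq0 ?ev_neq0.
have [[[i j] /= [ui uj ltij uf]]|noij] := pselect (exists ij, [/\ u ij.1 != 0, u ij.2 != 0,
    (ij.1 < ij.2)%N & U (f ij.1 / f ij.2)]).
  have [a ua] := vunit_eval ui; have [b ub] := vunit_eval uj.
  pose d := (j - i)%N; have d0 : (0 < d)%N by rewrite subn_gt0.
  have /dvdnP[q qE] : (d %| B`!)%N.
    by rewrite dvdn_fact // d0 (leq_trans (leq_subr _ _)) // -ltnS.
  exists ((a%:Z - b%:Z) * q%:Z).
  rewrite qE mulnC exprM -exprz_exp -exprnP -exprVn -exprMn.
  apply: vunitX => //.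
  have -> : z ^+ d / t ^ (a%:Z - b%:Z) =
      (f i / f j)^-1 * ((ev iota t (u i) / t ^+ a) / (ev iota t (u j) / t ^+ b)).
    rewrite expfzDr // -invr_expz -!exprnP /f -[in z ^+ j](subnK (ltnW ltij)) -/d exprD.
    by field; rewrite !expf_neq0 ?ev_neq0.
  by apply: vunitM => //; [|apply: vunitM => //]; apply: vunitV.
have [||||i] := @vunit_sum _ _ rA vA _ (filter (fun i => u i != 0) (enum 'I_B.+1)) f.
- by rewrite filter_uniq ?enum_uniq.
- by move=> i; rewrite mem_filter => /andP[/f_neq0].
- move=> i j; rewrite !mem_filter => /andP[ui _] /andP[uj _] nij Uij.
  have [lt|lt|/val_inj eqij] := ltngtP i j; last by rewrite eqij eqxx in nij.
    by apply: noij; exists (i, j).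
  by apply: noij; exists (j, i); split=> //=; rewrite -invf_div; apply: vunitV.
- have : i0 \in filter (fun i => u i != 0) (enum 'I_B.+1) by rewrite mem_filter ui0 mem_enum.
  by case: filter.
- move=> _ []; rewrite big_filter big_enum_cond /=.
  rewrite big_mkcond /= (eq_bigr (fun i => f i)) ?u0 ?mul0r ?eqxx // => j _.
  by have [uj0|//] := eqVneq (u j) 0; rewrite /f uj0 rmorph0 mul0r.
Qed.

(** The common exponent n turns the value group into a subgroup of the integers;
    dividing by its positive generator normalizes the valuation. *)
Lemma dominating_place : exists P : place iota, 0 < P t.
Proof.
have [n n0 ex] := isval_exists.
have /choice[w wP] : forall z, exists m, z != 0 -> isval n z m.
  by move=> z; have [->|/ex[m mP]] := eqVneq z 0; [exists 0 | exists m].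
have wM z z' : z != 0 -> z' != 0 -> w (z * z') = w z + w z'.
  move=> z0 z0'; apply: isval_inj (wP _ _) _; first by rewrite mulf_neq0.
  by apply: isvalM; apply: wP.
have wA z : z != 0 -> A z <-> 0 <= w z by move=> z0; apply: isval_ge0 (wP _ z0).
have wD x y : x != 0 -> y != 0 -> x + y != 0 -> Order.min (w x) (w y) <= w (x + y).
  wlog Axy : x y / A (x / y) => [wh x0 y0 xy0|x0 y0 xy0].
    have [|Axy|] := @vA (x / y); first by rewrite mulf_neq0 ?invr_eq0.
      exact: wh.
    by rewrite invf_div minC addrC => Ayx; apply: wh => //; rewrite addrC.
  have xyE : x + y = y * (1 + x / y) by rewrite mulrDr mulr1 mulrC divfK // addrC.
  have [y1 z1] : y != 0 /\ 1 + x / y != 0.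
    by move: xy0; rewrite xyE mulf_eq0 => /norP[].
  rewrite xyE wM // ge_min; apply/orP; right; rewrite lerDl; apply/wA => //.
  by apply: subringD => //; exact: subring1.
have wt : w t = n.
  apply: isval_inj (wP _ t0) _; rewrite -exprnP divff ?expf_neq0 //; exact: vunit1.
have w1 : w 1 = 0 by apply: (addrI (w 1)); rewrite -wM ?oner_neq0 // mulr1 addr0.
have wV z : z != 0 -> w z^-1 = - w z.
  by move=> z0; apply/eqP; rewrite -addr_eq0 -wM ?invr_eq0 // mulVf // w1.
have wX z m : z != 0 -> w (z ^ m) = w z * m.
  have wXn (a : nat) : z != 0 -> w (z ^+ a) = w z * a%:Z.
    move=> z0; elim: a => [|a IH]; first by rewrite mulr0 expr0.
    by rewrite exprS wM ?expf_neq0 // IH -[in RHS]add1n PoszD mulrDr mulr1.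
  case: m => m z0; first by rewrite -wXn.
  by rewrite NegzE -invr_expz wV ?expfz_neq0 // -exprnP wXn // mulrN.
pose good (m : nat) := `[< (0 < m)%N /\ exists2 z, z != 0 & w z = m >].
have [|e /asboolP[e0 [s s0 ws]] min_e] := @ex_minnP good.
  by exists n; apply/asboolP; split => //; exists t.
have e_neq0 : e%:Z != 0 by rewrite gt_eqF.
have we z : z != 0 -> w z = (w z %/ e)%Z * e.
  move=> z0; rewrite {1}(divz_eq (w z) e); set q := (_ %/ _)%Z.
  suff -> : (w z %% e)%Z = 0 by rewrite addr0.
  have r_ge0 := modz_ge0 (w z) e_neq0.
  have r_lt : (w z %% e)%Z < e by rewrite ltz_pmod.
  have rE : w (z / s ^ q) = (w z %% e)%Z.
    rewrite wM ?invr_eq0 ?expfz_neq0 // wV ?expfz_neq0 // wX // ws.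
    by rewrite {1}(divz_eq (w z) e) -/q mulrC addrAC subrr add0r.
  case E : (w z %% e)%Z r_ge0 r_lt rE => [[|r]|//] _ ltr rE //.
  have : (e <= r.+1)%N; last by rewrite leqNgt -ltz_nat ltr.
  apply: min_e; apply/asboolP; split=> //; exists (z / s ^ q) => //.
  by rewrite mulf_neq0 ?invr_eq0 ?expfz_neq0.
pose v z := if z == 0 then 0 else (w z %/ e)%Z.
have dv : discrete_valuation v.
  split.
  - by rewrite /v eqxx.
  - move=> x y x0 y0; rewrite /v mulf_eq0 (negPf x0) (negPf y0) /=.
    by apply: (mulIf e_neq0); rewrite mulrDl -!we ?mulf_neq0 // wM.
  - move=> x y x0 y0 xy0; rewrite /v (negPf x0) (negPf y0) (negPf xy0).
    have e_gt0 : 0 < e%:Z by [].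
    have := wD _ _ x0 y0 xy0; rewrite !ge_min (we x) // (we y) // (we (x + y)) //.
    by rewrite !mulzK // !ler_pM2r.
  - by exists s => //; rewrite /v (negPf s0) ws divzz (negPf e_neq0).
have cv c : v (iota c) = 0.
  rewrite /v fmorph_eq0; case: eqVneq => // c0.
  suff -> : w (iota c) = 0 by rewrite div0z.
  apply/eqP; rewrite eq_le; apply/andP; split; last by apply/wA; rewrite ?fmorph_eq0.
  by rewrite -oppr_ge0 -wV ?fmorph_eq0 // -fmorphV; apply/wA; rewrite ?fmorph_eq0 ?invr_eq0.
exists (Place dv cv); rewrite /= /v (negPf t0) wt.
have := we _ t0; rewrite wt => nE.
have : 0 < n%:Z by [].
by rewrite {1}nE pmulr_lgt0.
Qed.
End Pole.

Section Constants.
Variables (k K : fieldType) (iota : {rmorphism k -> K}).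
Hypothesis hK : function_field iota.

(** A zero of 1/y is a pole of y. *)
Theorem pole_exists y : ~ algebraicOver iota y -> exists P : place iota, P y < 0.
Proof.
move=> ny; have y0 : y != 0.
  by apply/eqP => y0; apply: ny; rewrite y0; exact: algebraic0.
have tt : transcendental iota y^-1.
  by apply: transcendentalP => /algebraic_inv; rewrite invrK.
have [A [gA vA]] := valuation_ring_exists (avoids_eval tt).
have [P] := dominating_place hK tt gA vA; exists P.
case: P p => v [_ vM _ _] vc /= vt; have := vM _ _ y0 (invr_neq0 y0).
rewrite mulfV // -(rmorph1 iota) vc => /esym/eqP; rewrite addr_eq0 => /eqP ->.
by rewrite oppr_lt0.
Qed.
End Constants.

(** * Functions with bounded poles *)

Section Valuations.
Variables (F : fieldType) (v : F -> int) (dv : discrete_valuation v).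
Implicit Types (x y : F) (n m : int).

Lemma dval1 : v 1 = 0.
Proof.
by apply: (addrI (v 1)); rewrite -(dvalM dv) ?oner_neq0 // mulr1 addr0.
Qed.

Lemma dvalV x : x != 0 -> v x^-1 = - v x.
Proof.
by move=> x0; apply/eqP; rewrite -addr_eq0 -(dvalM dv) ?invr_eq0 // mulVf // dval1.
Qed.

Lemma dvalX x (n : nat) : x != 0 -> v (x ^+ n) = v x *+ n.
Proof.
move=> x0; elim: n => [|n IH]; first by rewrite expr0 dval1.
by rewrite exprS (dvalM dv) ?expf_neq0 // IH mulrS.
Qed.

Lemma dvalN x : v (- x) = v x.
Proof.
have [->|x0] := eqVneq x 0; first by rewrite oppr0.
have vN1 : v (-1) = 0.
  apply/eqP; have /eqP : v (-1) *+ 2 = 0.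
    by rewrite -dvalX ?oppr_eq0 ?oner_neq0 // sqrrN expr1n dval1.
  by rewrite mulrn_eq0.
by rewrite -mulN1r (dvalM dv) ?oppr_eq0 ?oner_neq0 // vN1 add0r.
Qed.

Lemma val_geE x n : x != 0 -> val_ge v n x <-> n <= v x.
Proof. by move=> x0; split=> [[/eqP|//]|]; [rewrite (negPf x0) | right]. Qed.

Lemma val_ge_trans n m x : m <= n -> val_ge v n x -> val_ge v m x.
Proof. by move=> le [->|ge]; [left | right; apply: le_trans ge]. Qed.

Lemma val_geN n x : val_ge v n x -> val_ge v n (- x).
Proof. by case=> [->|ge]; [left; rewrite oppr0 | right; rewrite dvalN]. Qed.

Lemma val_geD n x y : val_ge v n x -> val_ge v n y -> val_ge v n (x + y).
Proof.
have [->|x0] := eqVneq x 0; first by rewrite add0r.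
have [->|y0] := eqVneq y 0; first by rewrite addr0.
have [->|xy0] := eqVneq (x + y) 0; first by left.
move=> /(val_geE _ x0) gx /(val_geE _ y0) gy; right.
by apply: le_trans (dvalD dv x0 y0 xy0); rewrite le_min gx.
Qed.

Lemma val_geM n m x y : val_ge v n x -> val_ge v m y -> val_ge v (n + m) (x * y).
Proof.
have [->|x0] := eqVneq x 0; first by rewrite mul0r; left.
have [->|y0] := eqVneq y 0; first by rewrite mulr0; left.
move=> /(val_geE _ x0) gx /(val_geE _ y0) gy; right.
by rewrite (dvalM dv) // lerD.
Qed.

Lemma val_ge_sum n (I : Type) (r : seq I) (f : I -> F) :
  (forall i, val_ge v n (f i)) -> val_ge v n (\sum_(i <- r) f i).
Proof. by move=> gf; apply: big_ind => //; [left | exact: val_geD]. Qed.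

Lemma valuation_subring : is_subring (valuation_ring v).
Proof.
split; first by right; rewrite dval1.
  by move=> x y gx gy; apply: val_geD gx (val_geN gy).
by move=> x y gx gy; have := val_geM gx gy; rewrite addr0.
Qed.
End Valuations.

Section Constants.
Variables (k K : fieldType) (iota : {rmorphism k -> K}).
Hypotheses (hK : function_field iota) (hk : algebraically_closed_in iota).
Variable oo : place iota.
Local Notation C := (integral_outside oo).

Lemma integral_outside_subring : is_subring C.
Proof.
split; first by move=> P _; apply: (subring1 (valuation_subring (place_dval P))).
  by move=> x y Cx Cy P nP; apply: (subringB (valuation_subring (place_dval P)));
    [exact: Cx | exact: Cy].
by move=> x y Cx Cy P nP; apply: (subringM (valuation_subring (place_dval P)));
  [exact: Cx | exact: Cy].
Qed.

Lemma constant_val_ge (P : place iota) c : val_ge P 0 (iota c).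
Proof. by right; rewrite (place_const P). Qed.

Lemma constant_integral c : C (iota c).
Proof. by move=> P _; apply: constant_val_ge. Qed.

(** A function regular everywhere is algebraic over k, since otherwise it would
    have a pole. *)
Lemma no_pole_constant y : C y -> val_ge oo 0 y -> exists c, y = iota c.
Proof.
move=> Cy gy; apply: hk; apply: contrapT => /(pole_exists hK)[P Py].
have [] : val_ge P 0 y; last 1 first.
- by rewrite leNgt Py.
- have [PE|/Cy//] := pselect (P =1 oo).
  by case: gy => [->|gy]; [left | right; rewrite PE].
by move=> y0; move: Py; rewrite y0 (dval0 (place_dval P)) ltxx.
Qed.

(** The poles of y and of 1/y could only be at oo, and not both are there. *)
Lemma integral_unit_constant y : y != 0 -> C y -> C y^-1 -> exists c, y = iota c.
Proof.
move=> y0 Cy CVy; have [ge|lt] := leP 0 (oo y); first by apply: no_pole_constant => //; right.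
have [|c yE] := no_pole_constant CVy.
  by right; rewrite (dvalV (place_dval oo)) // oppr_ge0 ltW.
by exists c^-1; rewrite fmorphV -yE invrK.
Qed.

End Constants.

(** Linearity on a set S only: the maps below are built by choice, and their
    values outside S are arbitrary. *)
Definition klinear (k K : fieldType) (iota : k -> K) (M : lmodType K)
    (V : lmodType k) (f : M -> V) (S : set M) :=
  forall c x y, S x -> S y -> f (iota c *: x + y) = c *: f x + f y.

Section Digits.
Variables (k K : fieldType) (iota : {rmorphism k -> K}).
Variables (P : place iota) (d : nat).
Hypothesis hd : place_degree P d.
Let dv := place_dval P.

(** Coordinates in the residue field, as a linear map on the valuation ring; by
    the last two clauses its kernel is the maximal ideal. *)
Lemma residue_coordinates : exists (e : 'I_d -> K) (r : K^o -> 'rV[k]_d),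
  [/\ forall i, val_ge P 0 (e i),
      klinear iota r (val_ge P 0),
      forall y, val_ge P 0 y -> val_ge P 1 (y - \sum_i iota (r y 0 i) * e i)
    & forall y (c : 'rV[k]_d), val_ge P 0 y -> val_ge P 1 (y - \sum_i iota (c 0 i) * e i) -> r y = c].
Proof.
have [e [ge ex]] := hd.
have /choice[r rP] : forall y, exists c : 'rV[k]_d, val_ge P 0 y ->
   val_ge P 1 (y - \sum_i iota (c 0 i) * e i) /\
   forall c' : 'rV[k]_d, val_ge P 1 (y - \sum_i iota (c' 0 i) * e i) -> c = c'.
  move=> y; have [/ex[c [c1 c2]]|ny] := pselect (val_ge P 0 y); last by exists 0.
  by exists c.
exists e, r; split=> //; last 2 first.
- by move=> y /rP[].
- by move=> y c /rP[_]; apply.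
move=> c x y gx gy.
have gxy : val_ge P 0 (iota c * x + y).
  by apply: (val_geD dv) => //; have := val_geM dv (constant_val_ge P c) gx; rewrite addr0.
apply: (rP _ gxy).2.
have [[rx _] [ry _]] := (rP _ gx, rP _ gy).
have := val_geD dv (val_geM dv (constant_val_ge P c) rx) ry.
congr val_ge; rewrite mulrBr addrACA -opprD; congr (_ - _).
rewrite mulr_sumr -big_split /=; apply: eq_bigr => i _.
by rewrite !mxE rmorphD rmorphM mulrDl mulrA.
Qed.

(** The digits of order -n, ..., 0 of the expansion of y at P.  Functions regular
    outside P have no nonzero element in the kernel, so their pole order at P
    bounds the dimension of the space that they form. *)
Lemma digits n : exists (N : nat) (f : K^o -> 'rV[k]_N),
  klinear iota f (val_ge P (- n%:Z)) /\
  forall y, val_ge P (- n%:Z) y -> f y = 0 -> val_ge P 1 y.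
Proof.
have [e [r [ge rL r1 r2]]] := residue_coordinates.
elim: n => [|n [N [f [fL f0]]]].
  exists d, r; split; first by rewrite oppr0.
  move=> y; rewrite oppr0 => gy ry0; have := r1 _ gy.
  by rewrite ry0 big1 ?subr0 // => i _; rewrite mxE rmorph0 mul0r.
have [t t0 vt] := dval_uniformizer dv.
pose T := t ^+ n.+1; have T0 : T != 0 by rewrite expf_neq0.
have vT : P T = n.+1%:Z by rewrite (dvalX dv) // vt natz.
have gT y : val_ge P (- n.+1%:Z) y -> val_ge P 0 (T * y).
  by move=> gy; rewrite -(subrr n.+1%:Z); apply: (val_geM dv) => //; right; rewrite vT.
pose s y := y - T^-1 * \sum_i iota (r (T * y) 0 i) * e i.
have gs y : val_ge P (- n.+1%:Z) y -> val_ge P (- n%:Z) (s y).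
  move=> gy; have -> : s y = T^-1 * (T * y - \sum_i iota (r (T * y) 0 i) * e i).
    by rewrite mulrBr mulKf.
  rewrite -[- n%:Z](_ : - n.+1%:Z + 1 = _); last by rewrite -addn1 PoszD opprD addrNK.
  by apply: (val_geM dv); [right; rewrite (dvalV dv) // vT | apply/r1/gT].
have sL c x y : val_ge P (- n.+1%:Z) x -> val_ge P (- n.+1%:Z) y ->
    r (T * (iota c * x + y)) = c *: r (T * x) + r (T * y).
  by move=> gx gy; rewrite mulrDr mulrCA rL //; apply: gT.
exists (d + N)%N, (fun y => row_mx (r (T * y)) (f (s y))); split.
  move=> c x y gx gy; rewrite [iota c *: x]/(iota c * x) sL // scale_row_mx add_row_mx.
  congr row_mx; rewrite -fL; [|exact: gs|exact: gs]; congr (f _).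
  rewrite /s sL // -[X in _ = X + _]/(iota c * _) mulrBr addrACA -opprD; congr (_ - _).
  rewrite mulrCA -mulrDr; congr (_ * _); rewrite mulr_sumr -big_split /=.
  by apply: eq_bigr => i _; rewrite !mxE rmorphD rmorphM mulrDl mulrA.
move=> y gy; rewrite -[0](row_mx0 k 1 d N) => /eq_row_mx[r0 fs0].
have := f0 _ (gs _ gy) fs0.
by rewrite /s r0 big1 ?mulr0 ?subr0 // => i _; rewrite mxE rmorph0 mul0r.
Qed.
End Digits.

(** * Stabilizers as unit groups of algebras *)

Section Matrix2.
Variable R : comNzRingType.
Implicit Types x y : 'M[R]_2.

Lemma mx2P x y : x 0 0 = y 0 0 -> x 0 1 = y 0 1 -> x 1 0 = y 1 0 -> x 1 1 = y 1 1 -> x = y.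
Proof.
move=> e00 e01 e10 e11; apply/matrixP => i j.
have I2 (a : 'I_2) : a = 0 \/ a = 1.
  by case: a => [[|[|[]]] // lt]; [left | right]; apply/val_inj.
by have [->|->] := I2 i; have [->|->] := I2 j.
Qed.

Lemma mulmx2E x y i j : (x * y) i j = x i 0 * y 0 j + x i 1 * y 1 j.
Proof. by rewrite mxE big_ord_recl big_ord1; congr (_ + x _ _ * y _ _); apply/val_inj. Qed.

Lemma trace2E x : \tr x = x 0 0 + x 1 1.
Proof. by rewrite /mxtrace big_ord_recl big_ord1; congr (_ + x _ _); apply/val_inj. Qed.

Lemma det2E x : \det x = x 0 0 * x 1 1 - x 0 1 * x 1 0.
Proof.
rewrite (expand_det_row _ 0) big_ord_recl big_ord1 /cofactor !det_mx11 !mxE /=.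
rewrite expr0 mul1r expr1 mulN1r mulrN.
by congr (x _ _ * x _ _ - x _ _ * x _ _); apply/val_inj.
Qed.

Definition mx2E := (mulmx2E, trace2E, det2E, mxE).

Lemma quadratic2 x : x * x = \tr x *: x - (\det x)%:M.
Proof. by apply: mx2P; rewrite ?mx2E /=; ring. Qed.
End Matrix2.

(** The properties of the algebra A with unit group G_v from which its structure
    follows.  Finiteness of the dimension is expressed by an injective linear map
    because 'M[K]_2 is not itself a vector space over k. *)
Record constant_order (k K : fieldType) (iota : {rmorphism k -> K}) (A : set 'M[K]_2) : Prop :=
  ConstantOrder {
    corder_ring : is_subring A;
    corder_scalar : forall c, A (iota c)%:M;
    corder_trace : forall x, A x -> exists c, \tr x = iota c;
    corder_det : forall x, A x -> exists c, \det x = iota c;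
    corder_fin : exists (V : vectType k) (f : 'M[K]_2 -> V),
      klinear iota f A /\ forall x, A x -> f x = 0 -> x = 0 }.

Section ConstantOrder.
Variables (k K : fieldType) (iota : {rmorphism k -> K}) (A : set 'M[K]_2).
Hypothesis oA : constant_order iota A.
Let rA := corder_ring oA.

Lemma corderZ c x : A x -> A (iota c *: x).
Proof.
by move=> Ax; rewrite -mul_scalar_mx; apply: (subringM rA) => //; exact: corder_scalar.
Qed.

(** The inverse is (tr x - x) / det x. *)
Lemma corderV x : A x -> \det x != 0 -> A x^-1.
Proof.
move=> Ax dx; have ux : x \is a GRing.unit by rewrite unitmxE unitfE.
have [[t tE] [d dE]] := (corder_trace oA Ax, corder_det oA Ax).
have -> : x^-1 = iota d^-1 *: ((iota t)%:M - x).
  apply: (mulrI ux); rewrite mulrV // -scalerAr mulrBr quadratic2 tE dE.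
  rewrite [x * _%:M]mul_mx_scalar subKr fmorphV scale_scalar_mx mulVf // -dE //.
apply: corderZ; apply: (subringB rA) => //; exact: corder_scalar.
Qed.
End ConstantOrder.

Section MatrixSubring.
Variables (F : fieldType) (S : set F) (rS : is_subring S).

Definition mxin : set 'M[F]_2 := [set x | forall i j, S (x i j)].

Lemma mxin_subring : is_subring mxin.
Proof.
split.
- move=> i j; rewrite mxE; case: eqP => _; [exact: subring1 | exact: subring0].
- by move=> x y Sx Sy i j; rewrite !mxE; apply: subringB.
- by move=> x y Sx Sy i j; rewrite mulmx2E; apply: subringD => //; apply: subringM.
Qed.

Lemma mxin_trace x : mxin x -> S (\tr x).
Proof. by move=> Sx; rewrite trace2E; apply: subringD. Qed.

Lemma mxin_det x : mxin x -> S (\det x).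
Proof. by move=> Sx; rewrite det2E; apply: subringB => //; apply: subringM. Qed.

Lemma GL2E : GL2 S = [set x | [/\ x \is a GRing.unit, mxin x & mxin x^-1]].
Proof. by []. Qed.

Lemma GL2M x y : GL2 S x -> GL2 S y -> GL2 S (x * y).
Proof.
rewrite GL2E => -[ux Sx Sx'] [uy Sy Sy']; split; first by rewrite unitrMl.
  exact: (subringM mxin_subring).
by rewrite invrM //; apply: (subringM mxin_subring).
Qed.
End MatrixSubring.

Section Stabilizer.
Variables (k K : fieldType) (iota : {rmorphism k -> K}).
Hypotheses (hK : function_field iota) (hk : algebraically_closed_in iota).
Variables (oo : place iota) (delta : nat).
Hypothesis hdelta : place_degree oo delta.
Variables (Koo : fieldType) (voo : Koo -> int) (i : {rmorphism K -> Koo}).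
Hypothesis hKoo : is_completion oo voo i.
Let C := integral_outside oo.
Let O := valuation_ring voo.
Let rC : is_subring C := integral_outside_subring oo.
Let dv : discrete_valuation voo := compl_dval hKoo.
Let rO : is_subring O := valuation_subring dv.

Lemma GL2_det g : GL2 C g -> exists2 c, c != 0 & \det g = iota c.
Proof.
rewrite GL2E => -[ug Cg Cg'].
have dg : \det g != 0 by rewrite -unitfE -unitmxE.
have [||c cE] := integral_unit_constant hK hk (oo := oo) dg; first exact: mxin_det.
  by rewrite -det_inv; exact: mxin_det.
by exists c => //; apply: contraNneq dg => c0; rewrite cE c0 rmorph0.
Qed.

(** The units of C are the nonzero constants. *)
Lemma GL2_scalar : [set g | GL2 C g /\ is_scalar_mx g] =
  [set (iota c)%:M | c in [set c | c != 0]].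
Proof.
apply/seteqP; split=> [g [Gg /is_scalar_mxP[a gE]]|_ [c c0 <-]].
  have [ug Cg Cg'] := Gg; have [d d0] := GL2_det Gg.
  rewrite gE det_scalar => aE.
  have a0 : a != 0 by apply: contraTneq d0 => a0; rewrite -(fmorph_eq0 iota) -aE a0 expr0n eqxx.
  have [||c cE] := integral_unit_constant hK hk (oo := oo) a0.
  - by have := Cg 0 0; rewrite gE mxE.
  - by have := Cg' 0 0; rewrite gE invmx_scalar mxE.
  by exists c; [rewrite /= -(fmorph_eq0 iota) -cE | rewrite cE].
split; last exact: scalar_mx_is_scalar.
have CI (c' : k) : mxin C (iota c')%:M.
  move=> a b; rewrite mxE; case: eqP => _; [exact: constant_integral | exact: subring0].
split; [|exact: CI|by rewrite invmx_scalar -fmorphV; exact: CI].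
by rewrite unitmxE det_scalar unitfE expf_neq0 // fmorph_eq0.
Qed.

Variable g : 'M[Koo]_2.
Hypothesis ug : g \is a GRing.unit.
Let phi (h : 'M[K]_2) : 'M[Koo]_2 := g^-1 * map_mx i h * g.

Let phiM h h' : phi (h * h') = phi h * phi h'.
Proof. by rewrite /phi rmorphM /= !mulrA mulrK. Qed.
Let phiB h h' : phi (h - h') = phi h - phi h'.
Proof. by rewrite /phi rmorphB /= mulrBr mulrBl. Qed.
Let phi_scalar a : phi a%:M = (i a)%:M.
Proof.
rewrite /phi map_scalar_mx /=.
by rewrite [g^-1 * _]mul_mx_scalar -scalerAl mulVr // scalemx1.
Qed.
Let phiK h : map_mx i h * g = g * phi h.
Proof. by rewrite /phi !mulrA divrr // mul1r. Qed.
Let phi_tr h : \tr (phi h) = i (\tr h).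
Proof. by rewrite /phi [LHS]mxtrace_mulC [X in \tr X](mulVKr ug) trace_map_mx. Qed.
Let phi_det h : \det (phi h) = i (\det h).
Proof.
rewrite /phi [LHS]det_mulmx [X in X * _]det_mulmx mulrAC -det_mulmx.
by rewrite [g^-1 *m g]mulVr // det1 mul1r det_map_mx.
Qed.

Definition vertex_order : set 'M[K]_2 := [set h | mxin C h /\ mxin O (phi h)].

(** If g and g^-1 have poles of order at most n and n', the entries of
    h = g phi(h) g^-1 have poles of order at most n + n' at oo, and they are
    determined by their digits of nonpositive order. *)
Lemma vertex_order_fin : exists (V : vectType k) (f : 'M[K]_2 -> V),
  klinear iota f vertex_order /\ forall x, vertex_order x -> f x = 0 -> x = 0.
Proof.
have bound (m : 'M[Koo]_2) : exists n : nat, forall a b, val_ge voo (- n%:Z) (m a b).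
  exists (\sum_a \sum_b `|voo (m a b)|)%N => a b; right.
  rewrite lerNl (le_trans (lez_abs _)) // abszN lez_nat.
  by rewrite (bigD1 a) //= (bigD1 b) //= -addnA leq_addr.
have [[n gn] [n' gn']] := (bound g, bound g^-1).
have val_mul (x y : 'M[Koo]_2) (a b : int) :
   (forall p q, val_ge voo a (x p q)) -> (forall p q, val_ge voo b (y p q)) ->
   forall p q, val_ge voo (a + b) ((x * y) p q).
  by move=> gx gy p q; rewrite mulmx2E; apply: (val_geD dv); apply: (val_geM dv).
have entries h : vertex_order h -> forall p q, val_ge oo (- (n + n')%:Z) (h p q).
  move=> [_ Oh] p q.
  have : val_ge voo (- (n + n')%:Z) (i (h p q)).
    have := val_mul _ _ _ _ (val_mul _ _ _ _ gn Oh) gn' p q.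
    by rewrite -phiK mulrK // mxE PoszD opprD addr0.
  case=> [/eqP|]; first by rewrite fmorph_eq0 => /eqP->; left.
  by rewrite (compl_ext hKoo) => ?; right.
have [N [f [fL f0]]] := digits hdelta (n + n').
exists (('rV[k]_N * 'rV[k]_N) * ('rV[k]_N * 'rV[k]_N))%type.
exists (fun h => ((f (h 0 0), f (h 0 1)), (f (h 1 0), f (h 1 1)))); split.
  by move=> c x y /entries vx /entries vy; rewrite !mxE !fL.
move=> x vx [x00 x01 x10 x11]; have [Cx _] := vx.
have zero p q : f (x p q) = 0 -> x p q = 0.
  move=> /f0 -/(_ (entries _ vx _ _)) [//|v1].
  have [|c cE] := no_pole_constant hK hk (Cx p q).
    by right; apply: le_trans v1.
  by move: v1; rewrite cE (place_const oo).
by apply: mx2P; rewrite mxE zero.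
Qed.

Lemma vertex_order_corder : constant_order iota vertex_order.
Proof.
have const y : C y -> O (i y) -> exists c, y = iota c.
  move=> Cy Oy; apply: (no_pole_constant hK hk Cy).
  case: Oy => [/eqP|]; first by rewrite fmorph_eq0 => /eqP->; left.
  by rewrite (compl_ext hKoo) => ?; right.
split; last exact: vertex_order_fin.
- split.
  + split; first exact: (subring1 (mxin_subring rC)).
    by rewrite phi_scalar rmorph1; exact: (subring1 (mxin_subring rO)).
  + move=> x y [Cx Ox] [Cy Oy]; split; first exact: (subringB (mxin_subring rC)).
    by rewrite phiB; exact: (subringB (mxin_subring rO)).
  + move=> x y [Cx Ox] [Cy Oy]; split; first exact: (subringM (mxin_subring rC)).
    by rewrite phiM; exact: (subringM (mxin_subring rO)).
- move=> c; split.
    move=> a b; rewrite mxE; case: eqP => _; [exact: constant_integral | exact: subring0].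
  rewrite phi_scalar => a b; rewrite mxE; case: eqP => _; last exact: subring0.
  by right; rewrite (compl_ext hKoo) (place_const oo).
- move=> x [Cx Ox]; apply: const; first exact: mxin_trace.
  by rewrite -phi_tr; exact: mxin_trace.
- move=> x [Cx Ox]; apply: const; first exact: mxin_det.
  by rewrite -phi_det; exact: mxin_det.
Qed.

(** As det h is constant, the scalar z with h g = g z o, o in GL_2(O_oo), has
    valuation 0. *)
Lemma vertex_stabilizerE :
  vertex_stabilizer i (GL2 C) [set g * h | h in ZGL2 voo] =
  [set h | vertex_order h /\ \det h != 0].
Proof.
have GO1 : GL2 O 1.
  rewrite GL2E; split; rewrite ?invr1 ?unitr1 //; exact: (subring1 (mxin_subring rO)).
apply/seteqP; split=> h.
  move=> [Gh hV]; have [c c0 cE] := GL2_det Gh.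
  have [_ Ch _] := Gh.
  split; last by rewrite cE fmorph_eq0.
  split=> //.
  have : [set g * h | h in ZGL2 voo] (map_mx i h * g).
    rewrite -hV; exists g => //; exists 1; rewrite ?mulr1 //.
    exists 1%:M; first by exists 1 => //=; exact: oner_neq0.
    by exists 1; rewrite ?mulr1.
  move=> [_ [_ [z z0 <-] [o Oo <-]] E].
  have phE : phi h = z *: o.
    by apply: (mulrI ug); rewrite -phiK -E; congr (_ * _); exact: mul_scalar_mx.
  have [uo Soo Soo'] := Oo.
  have do0 : \det o != 0 by rewrite -unitfE -unitmxE.
  have vdo : voo (\det o) = 0.
    apply/eqP; rewrite eq_le; apply/andP; split.
      have : O (\det o)^-1 by rewrite -det_inv; exact: mxin_det.
      by case=> [/eqP|]; [rewrite invr_eq0 (negPf do0) | rewrite (dvalV dv) // oppr_ge0].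
    have : O (\det o) by exact: mxin_det.
    by case=> // /eqP; rewrite (negPf do0).
  have vz : voo z = 0.
    have := phi_det h; rewrite phE detZ cE => /(congr1 voo).
    rewrite (compl_ext hKoo) (place_const oo) (dvalM dv) ?expf_neq0 //.
    rewrite vdo addr0 (dvalX dv) // => /eqP; rewrite mulrn_eq0 /=.
    by move/eqP.
  move=> a b; rewrite phE mxE; apply: (subringM rO); last exact: Soo.
  by right; rewrite vz.
move=> [Ah dh].
have uh : h \is a GRing.unit by rewrite unitmxE unitfE.
have AhV := corderV vertex_order_corder Ah dh.
split; first by split=> //; [case: Ah | case: AhV].
have phV x : vertex_order x -> vertex_order x^-1 -> x \is a GRing.unit -> GL2 O (phi x).
  move=> [_ Ox] [_ OxV] ux; rewrite GL2E.
  have E : phi x * phi x^-1 = 1 by rewrite -phiM divrr // phi_scalar rmorph1.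
  have E' : phi x^-1 * phi x = 1 by rewrite -phiM mulVr // phi_scalar rmorph1.
  have up : phi x \is a GRing.unit by apply/unitrP; exists (phi x^-1).
  split=> //; suff -> : (phi x)^-1 = phi x^-1 by [].
  by apply: (mulrI up); rewrite divrr.
have ZG x w : GL2 O x -> ZGL2 voo w -> ZGL2 voo (x * w).
  move=> Gx [_ [z z0 <-] [o Oo <-]]; exists z%:M; first by exists z.
  exists (x * o); first exact: GL2M.
  by rewrite [z%:M * _]mul_scalar_mx [z%:M * o]mul_scalar_mx -scalerAr.
apply/seteqP; split=> [_ [_ [w Zw <-] <-]|_ [w Zw <-]].
  exists (phi h * w); last by rewrite [LHS]mulrA -phiK -mulrA.
  exact: (ZG _ _ (phV _ Ah AhV uh) Zw).
exists (g * (phi h^-1 * w)).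
  have AhVV : vertex_order h^-1^-1 by rewrite invrK.
  have uhV : h^-1 \is a GRing.unit by rewrite unitrV.
  by exists (phi h^-1 * w) => //; exact: (ZG _ _ (phV _ AhV AhVV uhV) Zw).
by rewrite [LHS]mulrA phiK -mulrA [phi h * _]mulrA -phiM divrr // phi_scalar rmorph1 mul1r.
Qed.
End Stabilizer.

(** * Abstract algebras attached to an order *)

(** A finite-dimensional subspace of a ring that contains 1 and is closed under
    multiplication is an algebra.  It is given by an injective parametrization by
    a vector space, to which the multiplication is transported. *)
Record algebra_model (k : fieldType) (R : nzRingType) := AlgebraModel {
  model_space : vectType k;
  model_map : model_space -> R;
  model_const : k -> R;
  model_one : model_space;
  model_mul : model_space -> model_space -> model_space;
  model_inj : injective model_map;
  modelB : forall x y, model_map (x - y) = model_map x - model_map y;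
  modelZ : forall c x, model_map (c *: x) = model_const c * model_map x;
  model_central : forall c r, model_const c * r = r * model_const c;
  model1 : model_map model_one = 1;
  modelM : forall x y, model_map (model_mul x y) = model_map x * model_map y }.

(** This alias carries the data D that determine the multiplication, so that the
    algebra structure can be found from the type. *)
Definition model_alg (k : fieldType) (R : nzRingType) (D : algebra_model k R) : Type :=
  model_space D.

Section ModelAlgebra.
Variables (k : fieldType) (R : nzRingType) (D : algebra_model k R).
Local Notation T := (model_alg D).
HB.instance Definition _ := Vector.on T.

Let s : T -> R := @model_map _ _ D.
Let one : T := model_one D.
Let mul : T -> T -> T := @model_mul _ _ D.
Let sI : injective s. Proof. exact: model_inj. Qed.
Let sB x y : s (x - y) = s x - s y. Proof. exact: modelB. Qed.
Let s0 : s 0 = 0. Proof. by rewrite -(subrr 0) sB subrr. Qed.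
Let sN x : s (- x) = - s x. Proof. by rewrite -[- x]add0r sB s0 add0r. Qed.
Let sD x y : s (x + y) = s x + s y. Proof. by have := sB x (- y); rewrite opprK sN opprK. Qed.
Let sZ c x : s (c *: x) = model_const D c * s x. Proof. exact: modelZ. Qed.
Let sM x y : s (mul x y) = s x * s y. Proof. exact: modelM. Qed.
Let s1 : s one = 1. Proof. exact: model1. Qed.

Let mulA : associative mul. Proof. by move=> x y z; apply: sI; rewrite !sM mulrA. Qed.
Let mul1x : left_id one mul. Proof. by move=> x; apply: sI; rewrite !sM s1 mul1r. Qed.
Let mulx1 : right_id one mul. Proof. by move=> x; apply: sI; rewrite !sM s1 mulr1. Qed.
Let mulDl : left_distributive mul +%R.
Proof. by move=> x y z; apply: sI; rewrite sM !sD mulrDl !sM. Qed.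
Let mulDr : right_distributive mul +%R.
Proof. by move=> x y z; apply: sI; rewrite sM !sD mulrDr !sM. Qed.
Let one0 : one != 0.
Proof. by apply/eqP => /(congr1 s); rewrite s1 s0; apply/eqP/oner_neq0. Qed.
HB.instance Definition _ := GRing.Zmodule_isNzRing.Build T mulA mul1x mulx1 mulDl mulDr one0.

Let scaleAl c (x y : T) : c *: (x * y) = (c *: x) * y.
Proof. by apply: sI; rewrite sZ [s (x * y)]sM mulrA -sZ -sM. Qed.
HB.instance Definition _ := GRing.Lmodule_isLalgebra.Build k T scaleAl.

Let scaleAr c (x y : T) : c *: (x * y) = x * (c *: y).
Proof.
by apply: sI; rewrite sZ [s (x * y)]sM mulrA model_central -mulrA -sZ -sM.
Qed.
HB.instance Definition _ := GRing.Lalgebra_isAlgebra.Build k T scaleAr.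
HB.instance Definition _ := Algebra_isFalgebra.Build k T.

Let s_zmod : zmod_morphism s. Proof. exact: sB. Qed.
Let s_monoid : monoid_morphism s. Proof. by split; [exact: s1 | exact: sM]. Qed.

Lemma model_algebra : exists (Q : falgType k) (f : {rmorphism Q -> R}),
  [/\ injective f, forall c q, f (c *: q) = model_const D c * f q
    & forall r, (exists q : model_space D, model_map q = r) <-> exists q, f q = r].
Proof.
pose sz := GRing.isZmodMorphism.Build T R s s_zmod.
pose sm := GRing.isMonoidMorphism.Build T R s s_monoid.
pose f : {rmorphism T -> R} := HB.pack s sz sm.
by exists T, f; split.
Qed.
End ModelAlgebra.

(** A commutative finite-dimensional division algebra is a field extension. *)
Record field_model (k : fieldType) := FieldModel {
  fmodel_alg : falgType k;
  fmodel_comm : commutative (@GRing.mul fmodel_alg);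
  fmodel_unit : forall x : fmodel_alg, x != 0 -> x \is a GRing.unit }.

Definition model_field (k : fieldType) (D : field_model k) : Type := fmodel_alg D.

Section ModelField.
Variables (k : fieldType) (D : field_model k).
Local Notation T := (model_field D).
HB.instance Definition _ := Falgebra.on T.
HB.instance Definition _ := GRing.PzRing_hasCommutativeMul.Build T (@fmodel_comm k D).
Let T_field : GRing.field_axiom T. Proof. exact: fmodel_unit. Qed.
HB.instance Definition _ := GRing.ComUnitRing_isField.Build T T_field.

Lemma field_of_algebra :
  exists (L : fieldExtType k) (f : {lrmorphism L -> fmodel_alg D}), bijective f.
Proof.
by exists T, (idfun : {lrmorphism fmodel_alg D -> fmodel_alg D}); exists id.
Qed.
End ModelField.

(** Take a subspace inside S of the largest dimension. *)
Lemma subspace_of_set (k : fieldType) (V : vectType k) (S : set V) :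
  S 0 -> (forall c x y, S x -> S y -> S (c *: x + y)) ->
  exists U : {vspace V}, forall x, x \in U <-> S x.
Proof.
move=> S0 SL.
pose P n := `[< exists2 U : {vspace V}, \dim U = n & forall x, x \in U -> S x >].
have [||n /asboolP[U dU US] maxU] := @ex_maxnP P (\dim {:V}).
- by exists 0%N; apply/asboolP; exists 0%VS; [exact: dimv0 | move=> x; rewrite memv0 => /eqP->].
- by move=> n /asboolP[U <- _]; apply: dimvS; exact: subvf.
exists U => x; split; first exact: US.
move=> Sx; apply: contrapT => /negP nxU.
have : (\dim (U + <[x]>) <= n)%N.
  apply: maxU; apply/asboolP; exists (U + <[x]>)%VS => // y.
  case/memv_addP => u uU [w /vlineP[c ->] ->].
  by rewrite addrC; apply: SL => //; exact: US.
rewrite dimv_disjoint_sum ?dU; last first.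
  apply/eqP; rewrite -subv0; apply/subvP => y; rewrite memv_cap memv0.
  case/andP=> yU /vlineP[c yE]; move: yU; rewrite yE.
  have [->|c0] := eqVneq c 0; first by rewrite scale0r eqxx.
  by rewrite rpredZeq (negPf c0) (negPf nxU).
rewrite dim_vline; case: eqP => [x0|_]; last by rewrite addn1 ltnn.
by move: nxU; rewrite x0 mem0v.
Qed.

Section OrderAlgebra.
Variables (k K : fieldType) (iota : {rmorphism k -> K}) (A : set 'M[K]_2).
Hypothesis oA : constant_order iota A.
Let rA := corder_ring oA.

Lemma order_subspace (S : set 'M[K]_2) : S `<=` A -> S 0 ->
  (forall c x y, S x -> S y -> S (iota c *: x + y)) ->
  exists (V : vectType k) (s : V -> 'M[K]_2),
    [/\ injective s, forall c x y, s (c *: x + y) = iota c *: s x + s y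
      & forall x, S x <-> exists q, s q = x].
Proof.
move=> SA S0 SL; have [W [f [fL f0]]] := corder_fin oA.
have fB x y : A x -> A y -> f (x - y) = f x - f y.
  move=> Ax Ay; rewrite -[x - y](_ : iota (-1) *: y + x = _); last first.
    by rewrite rmorphN1 scaleN1r addrC.
  by rewrite fL // scaleN1r addrC.
have f00 : f 0 = 0 by rewrite -(subrr 0) fB ?subrr //; exact: (subring0 rA).
have finj x y : A x -> A y -> f x = f y -> x = y.
  move=> Ax Ay fxy; apply/eqP; rewrite -subr_eq0; apply/eqP/f0.
    exact: (subringB rA).
  by rewrite fB // fxy subrr.
have [||U UP] := @subspace_of_set _ W [set f x | x in S].
- by exists 0.
- move=> c _ _ [x Sx <-] [y Sy <-]; exists (iota c *: x + y); first exact: SL.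
  by rewrite fL //; exact: SA.
have /choice[s sP] : forall u : subvs_of U, exists x, S x /\ f x = vsval u.
  by move=> u; have [x Sx fx] := (UP _).1 (subvsP u); exists x.
exists (subvs_of U), s; split.
- by move=> u w suw; apply/val_inj; rewrite /= -(sP u).2 -(sP w).2 suw.
- move=> c x y; have [[Sx fx] [Sy fy]] := (sP x, sP y); have [Sz fz] := sP (c *: x + y).
  apply: finj; [exact: SA | exact/SA/SL |].
  by rewrite fL ?fx ?fy ?fz ?linearP //; exact: SA.
- move=> x; split=> [Sx|[u <-]]; last by case: (sP u).
  have fxU : f x \in U by apply/UP; exists x.
  exists (Subvs fxU); have [Sy fy] := sP (Subvs fxU).
  by apply: finj; [exact: SA | exact: SA | rewrite fy].
Qed.

Lemma order_algebra : exists (Q : falgType k) (s : {rmorphism Q -> 'M[K]_2}),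
  [/\ injective s, forall c q, s (c *: q) = iota c *: s q
    & forall x, A x <-> exists q, s q = x].
Proof.
have [|c x y Ax Ay|V [s [sI sL sA]]] := @order_subspace A (fun _ => id).
- exact: (subring0 rA).
- by apply: (subringD rA) => //; apply: corderZ.
have As q : A (s q) by apply/sA; exists q.
have sB x y : s (x - y) = s x - s y.
  by rewrite -scaleN1r addrC sL rmorphN1 scaleN1r addrC.
have s0 : s 0 = 0 by rewrite -(subrr 0) sB subrr.
have sZ c x : s (c *: x) = (iota c)%:M * s x.
  by rewrite -[c *: x]addr0 sL s0 addr0 [RHS]mul_scalar_mx.
have [one s1] := (sA 1).1 (subring1 rA).
have /choice[mul mulP] : forall xy : V * V, exists z, s z = s xy.1 * s xy.2.
  by move=> xy; apply/sA; apply: (subringM rA).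
have central c (r : 'M[K]_2) : (iota c)%:M * r = r * (iota c)%:M.
  by apply/esym; exact: scalar_mxC.
have [Q [f [fI fZ fE]]] := model_algebra (@AlgebraModel k _ V s (fun c => (iota c)%:M)
  one (fun x y => mul (x, y)) sI sB sZ central s1 (fun x y => mulP (x, y))).
exists Q, f; split=> // [c q|x]; first by rewrite fZ /= [LHS]mul_scalar_mx.
by split=> [/sA/fE //|/fE/sA].
Qed.
End OrderAlgebra.

(** * Isomorphisms between unit groups *)

Lemma group_iso_of_inverse (T U : Type) (opT : T -> T -> T) (A : set T)
    (opU : U -> U -> U) (B : set U) (s : U -> T) (u0 : U) :
  (forall u, B u -> A (s u)) ->
  (forall x, A x -> exists2 u, B u & s u = x) ->
  (forall u w, B u -> B w -> s u = s w -> u = w) ->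
  (forall u w, B u -> B w -> B (opU u w)) ->
  (forall u w, B u -> B w -> s (opU u w) = opT (s u) (s w)) ->
  group_iso opT A opU B.
Proof.
move=> BA AB sI Bop sM.
have /choice[f fP] : forall x, exists u, A x -> B u /\ s u = x.
  move=> x; have [/AB[u Bu su]|nAx] := pselect (A x); first by exists u.
  by exists u0 => /nAx.
exists f; split; first split.
- by move=> x /fP[].
- move=> x y /set_mem/fP[_ fx] /set_mem/fP[_ fy] fxy.
  by rewrite -fx -fy fxy.
- move=> u Bu; exists (s u); first exact: BA.
  by have [Bf sf] := fP _ (BA _ Bu); apply: sI.
move=> x y Ax Ay; have [[Bx fx] [By fy]] := (fP _ Ax, fP _ Ay).
have Axy : A (opT x y) by rewrite -fx -fy -sM //; apply/BA/Bop.
have [Bxy fxy] := fP _ Axy.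
by apply: sI; rewrite ?fxy ?sM ?fx ?fy //; exact: Bop.
Qed.

(** The first isomorphism theorem for a surjective homomorphism chi from G to B;
    the element chosen in a coset does not matter. *)
Lemma quotient_iso (R : unitRingType) (G N : set R) (U : Type)
    (opU : U -> U -> U) (B : set U) (chi : R -> U) :
  subgroup G G ->
  (forall g, G g -> B (chi g)) ->
  (forall u, B u -> exists2 g, G g & chi g = u) ->
  (forall g h, G g -> G h -> chi (g * h) = opU (chi g) (chi h)) ->
  N = [set g | G g /\ chi g = chi 1] ->
  normal_subgroup N G /\ group_iso (@mulset _) (quotient_set G N) opU B.
Proof.
move=> [GU _ G1 GM GV] GB BG chiM NE.
have N1 : N 1 by rewrite NE.
have chi_eq g h : G g -> G h -> chi g = chi h -> N (g^-1 * h).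
  move=> Gg Gh gh; rewrite NE; split; first by apply: GM => //; apply: GV.
  rewrite chiM //; last exact: GV.
  by rewrite -gh -chiM ?mulVr //; [exact: GU | exact: GV].
have chiN g n : G g -> N n -> chi (g * n) = chi g.
  by move=> Gg; rewrite NE => -[Gn n1]; rewrite chiM // n1 -chiM // mulr1.
have chiN' g n : G g -> N n -> chi (n * g) = chi g.
  by move=> Gg; rewrite NE => -[Gn n1]; rewrite chiM // n1 -chiM // mul1r.
have GN n : N n -> G n by rewrite NE => -[].
have NM x y : N x -> N y -> N (x * y).
  move=> Nx Ny; rewrite NE; split; first by apply: GM; exact: GN.
  by rewrite chiN //; [move: Nx; rewrite NE => -[] | exact: GN].
have NV x : N x -> N x^-1.
  move=> Nx; have Gx := GN _ Nx; rewrite -[x^-1]mulr1; apply: chi_eq => //.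
  by move: Nx; rewrite NE => -[].
have NJ g n : G g -> N n -> N (g * n * g^-1).
  move=> Gg Nn; have [Gn GVg] := (GN _ Nn, GV _ Gg).
  rewrite NE; split; first by apply: (GM) => //; exact: GM.
  rewrite chiM //; last exact: GM.
  by rewrite chiN // -chiM // divrr //; exact: GU.
split; first by split.
pose coset g := [set g * n | n in N].
have cosetP g x : G g -> G x -> coset g x <-> chi x = chi g.
  move=> Gg Gx; split=> [[n Nn <-]|gx]; first exact: chiN.
  by exists (g^-1 * x); [apply: chi_eq | rewrite mulVKr //; exact: GU].
have cosetG g x : G g -> coset g x -> G x.
  by move=> Gg [n Nn <-]; apply: GM => //; exact: GN.
pose f X := chi (xget 1 X).
have fE g : G g -> f (coset g) = chi g.
  move=> Gg; have cg : coset g g by apply/cosetP.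
  have cx := xgetI 1 cg.
  by apply/cosetP => //; exact: cosetG cx.
have cosetM g h : G g -> G h -> mulset (coset g) (coset h) = coset (g * h).
  move=> Gg Gh; apply/seteqP; split=> x.
    case=> y cy [z cz <-].
    have [Gy Gz] := (cosetG _ _ Gg cy, cosetG _ _ Gh cz).
    apply/cosetP; [exact: GM | exact: GM |].
    by rewrite !chiM // (cosetP _ _ Gg Gy).1 // (cosetP _ _ Gh Gz).1.
  case=> n Nn <-; exists g; first exact/cosetP.
  by exists (h * n); [exists n | rewrite mulrA].
exists f; split; first split.
- by move=> _ [g Gg <-]; rewrite [f _]fE //; exact: GB.
- move=> _ _ /set_mem[g Gg <-] /set_mem[h Gh <-]; rewrite [f _]fE // [f _]fE // => gh.
  apply/seteqP; split=> x cx; have := cosetG _ _ _ cx => Gx.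
    by apply/(cosetP h) => //; [exact: Gx | rewrite -gh; apply/cosetP => //; exact: Gx].
  by apply/(cosetP g) => //; [exact: Gx | rewrite gh; apply/cosetP => //; exact: Gx].
- by move=> u /BG[g Gg <-]; exists (coset g); [exists g | rewrite fE].
move=> _ _ [g Gg <-] [h Gh <-].
by rewrite [mulset _ _]cosetM // ![f _]fE // ?chiM //; exact: GM.
Qed.

Definition order_units (K : fieldType) (A : set 'M[K]_2) : set 'M[K]_2 :=
  [set x | A x /\ \det x != 0].

Section OrderUnits.
Variables (k K : fieldType) (iota : {rmorphism k -> K}) (A : set 'M[K]_2).
Hypothesis oA : constant_order iota A.
Let rA := corder_ring oA.
Local Notation G := (order_units A).

Lemma order_units_unit x : G x -> x \is a GRing.unit.
Proof. by move=> [_ dx]; rewrite unitmxE unitfE. Qed.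

Lemma order_units_subgroup : subgroup G G.
Proof.
split=> //; first exact: order_units_unit.
- by split; [exact: (subring1 rA) | rewrite det1 oner_neq0].
- move=> x y [Ax dx] [Ay dy]; split; first exact: (subringM rA).
  by rewrite det_mulmx mulf_neq0.
- by move=> x [Ax dx]; split; [exact: (corderV oA) | rewrite det_inv invr_eq0].
Qed.

Lemma det_scalar2 (c : K) : \det (c%:M : 'M_2) = c ^+ 2.
Proof. exact: det_scalar. Qed.

Lemma order_units_scalar c : c != 0 -> G (iota c)%:M.
Proof.
by move=> c0; split; [exact: (corder_scalar oA) | rewrite det_scalar expf_neq0 ?fmorph_eq0].
Qed.

Lemma scalar_group_iso :
  group_iso *%R ([set (iota c)%:M | c in [set c | c != 0]] : set 'M[K]_2) *%R (units k).
Proof.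
apply: (@group_iso_of_inverse _ _ _ _ _ _ (fun c => (iota c)%:M) 1).
- by move=> c; rewrite /units /= unitfE => c0; exists c.
- by move=> _ [c c0 <-]; exists c => //; rewrite /units /= unitfE.
- by move=> c d _ _ /matrixP/(_ 0 0); rewrite !mxE /= => /fmorph_inj.
- by move=> c d; rewrite /units /= => uc ud; rewrite unitrM uc.
- by move=> c d _ _; rewrite rmorphM scalar_mxM.
Qed.

(** (1 + x)(1 + y) = 1 + (x + y) when products in J vanish. *)
Lemma unipotent_group_iso (J : set 'M[K]_2) : J `<=` A -> J 0 ->
  (forall c x y, J x -> J y -> J (iota c *: x + y)) ->
  (forall x y, J x -> J y -> x * y = 0) ->
  exists V : vectType k, group_iso *%R [set 1 + x | x in J] +%R [set: V].
Proof.
move=> JA J0 JL JJ; have [V [s [sI sL sJ]]] := order_subspace oA JA J0 JL.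
have Js q : J (s q) by apply/sJ; exists q.
exists V; apply: (@group_iso_of_inverse _ _ _ _ _ _ (fun q => 1 + s q) 0) => //.
- by move=> q _; exists (s q).
- by move=> _ [x /sJ[q <-] <-]; exists q.
- by move=> p q _ _ /addrI/sI.
- move=> p q _ _; rewrite mulrDl mul1r mulrDr mulr1 JJ // addr0 -addrA [s q + s p]addrC.
  by rewrite -[p]scale1r sL rmorph1 !scale1r.
Qed.

(** An element of A with nonzero determinant has its inverse in A. *)
Lemma algebra_unitE (Q : falgType k) (s : {rmorphism Q -> 'M[K]_2}) :
  injective s -> (forall x, A x <-> exists q, s q = x) ->
  forall q, q \is a GRing.unit = (\det (s q) != 0).
Proof.
move=> sI sA q; have Aq : A (s q) by apply/sA; exists q.
apply/idP/idP => [uq|dq].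
  have : s q \is a GRing.unit by apply: rmorph_unit.
  by rewrite unitmxE unitfE.
have [r rE] := (sA _).1 (corderV oA Aq dq).
have us : s q \is a GRing.unit by rewrite unitmxE unitfE.
by apply/unitrP; exists r; split; apply: sI; rewrite rmorphM rE rmorph1 ?mulVr ?mulrV.
Qed.

Lemma order_units_iso (Q : falgType k) (s : {rmorphism Q -> 'M[K]_2}) :
  injective s -> (forall x, A x <-> exists q, s q = x) ->
  group_iso *%R G *%R (units Q).
Proof.
move=> sI sA; have uE := algebra_unitE sI sA.
apply: (@group_iso_of_inverse _ _ _ _ _ _ s 1).
- by move=> q; rewrite /units /= uE => dq; split=> //; apply/sA; exists q.
- by move=> x [/sA[q <-] dq]; exists q; rewrite // /units /= uE.
- by move=> p q _ _ /sI.
- by move=> p q; rewrite /units /= !uE => dp dq; rewrite rmorphM det_mulmx mulf_neq0.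
- by move=> p q _ _; rewrite rmorphM.
Qed.

(** A commutative order without nonzero singular elements is a field. *)
Lemma order_field : (forall x y, A x -> A y -> x * y = y * x) ->
  (forall x, A x -> \det x = 0 -> x = 0) ->
  exists (L : fieldExtType k) (s : {rmorphism L -> 'M[K]_2}),
  [/\ injective s, forall c q, s (c *: q) = iota c *: s q
    & forall x, A x <-> exists q, s q = x].
Proof.
move=> Acomm Adiv; have [Q [s [sI sZ sA]]] := order_algebra oA.
have As q : A (s q) by apply/sA; exists q.
have Qcomm : commutative (@GRing.mul Q).
  by move=> p q; apply: sI; rewrite !rmorphM Acomm.
have Qunit (q : Q) : q != 0 -> q \is a GRing.unit.
  move=> q0; rewrite (algebra_unitE sI sA); apply: contraNneq q0 => dq.
  by apply/eqP/sI; rewrite rmorph0 (Adiv _ (As q) dq).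
have [L [f [g fK gK]]] := field_of_algebra (FieldModel Qcomm Qunit).
exists L, (s \o f : {rmorphism L -> 'M[K]_2}); split.
- by apply: inj_comp => //; exact: can_inj fK.
- by move=> c q; rewrite /= linearZ sZ.
- move=> x; split=> [/sA[q <-]|[q <-]]; last exact: As.
  by exists (g q); rewrite /= gK.
Qed.
End OrderUnits.

(** * Traces and determinants of two by two matrices *)

Section Matrix2More.
Variable F : fieldType.
Implicit Types x y e : 'M[F]_2.

Lemma det2D x y : \det (x + y) = \det x + \det y + \tr x * \tr y - \tr (x * y).
Proof. by rewrite !mx2E; ring. Qed.

Lemma trace2_mulC x y : \tr (x * y) = \tr (y * x).
Proof. exact: mxtrace_mulC. Qed.

Lemma det2Z c x : \det (c *: x) = c ^+ 2 * \det x.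
Proof. exact: detZ. Qed.

Lemma trace2_scalar (c : F) : \tr (c%:M : 'M_2) = c + c.
Proof. by rewrite !mx2E /=. Qed.

Lemma trace2_1 : \tr (1 : 'M[F]_2) = 2.
Proof. exact: mxtrace1. Qed.

Lemma det2_1D x : \det (1 + x) = 1 + \tr x + \det x.
Proof. by rewrite det2D det1 mul1r trace2_1; ring. Qed.

Lemma det2_scalarB x (c : F) : \det (x - c%:M) = c ^+ 2 - \tr x * c + \det x.
Proof. by rewrite !mx2E /=; ring. Qed.

Lemma nilpotent2 x : \tr x = 0 -> \det x = 0 -> x * x = 0.
Proof. by move=> t0 d0; rewrite quadratic2 t0 d0 scale0r raddf0 subrr. Qed.

(** Nilpotent matrices that are orthogonal for the trace form have the same
    kernel.  In coordinates: the square of each entry of x y is a combination of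
    the three vanishing quantities. *)
Lemma nilpotent2_mul x y : \tr x = 0 -> \det x = 0 -> \tr y = 0 -> \det y = 0 ->
  \tr (x * y) = 0 -> x * y = 0.
Proof.
rewrite !mx2E; set p := x 0 0; set q := x 0 1; set r := x 1 0.
set p' := y 0 0; set q' := y 0 1; set r' := y 1 0.
move=> /eqP; rewrite addrC addr_eq0 => /eqP x11 dx /eqP.
rewrite addrC addr_eq0 => /eqP y11 dy t0.
rewrite x11 in dx t0; rewrite y11 in dy t0.
have z (a b c d T X Y : F) : T = 0 -> X = 0 -> Y = 0 ->
    a ^+ 2 = b * T + c * X + d * Y -> a = 0.
  by move=> -> -> -> /eqP; rewrite !mulr0 !addr0 expf_eq0 => /eqP.
apply: mx2P; rewrite !mx2E -/p -/q -/r -/p' -/q' -/r' ?x11 ?y11.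
- by apply: (z _ (q * r') (- p' ^+ 2) (q * r) _ _ _ t0 dx dy); ring.
- by apply: (z _ (- (q * q')) (- q' ^+ 2) (- q ^+ 2) _ _ _ t0 dx dy); ring.
- by apply: (z _ (- (r * r')) (- r' ^+ 2) (- r ^+ 2) _ _ _ t0 dx dy); ring.
- by apply: (z _ (r * q') (- p' ^+ 2) (q * r) _ _ _ t0 dx dy); ring.
Qed.

Section RankOne.
Variable e : 'M[F]_2.
Hypotheses (de : \det e = 0) (te : \tr e = 1).

Lemma rank_one_idem : e * e = e.
Proof. by rewrite quadratic2 de te scale1r raddf0 subr0. Qed.

(** With e a column u times a row r, e y e = u (r y u) r. *)
Lemma rank_one_sandwich y : e * y * e = \tr (y * e) *: e.
Proof.
have /eqP : e 0 0 * e 1 1 - e 0 1 * e 1 0 = 0 by rewrite -det2E.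
rewrite subr_eq0 => /eqP de'.
by apply: mx2P; rewrite !mx2E; ring: de'.
Qed.

Lemma rank_one_compl : \det (1 - e) = 0 /\ \tr (1 - e) = 1.
Proof.
have -> : \det (1 - e) = 1 - \tr e + \det e by rewrite !mx2E /=; ring.
have -> : \tr (1 - e) = 1 + 1 - \tr e by rewrite !mx2E /=; ring.
by rewrite de te subrr addrK addr0.
Qed.
End RankOne.
End Matrix2More.

(** * Orders with repeated eigenvalues in the constants *)

Section Unipotent.
Variables (k K : fieldType) (iota : {rmorphism k -> K}) (A : set 'M[K]_2).
Hypothesis oA : constant_order iota A.
Let rA := corder_ring oA.
Local Notation G := (order_units A).

Lemma unipotent_subgroup (J : set 'M[K]_2) : J `<=` A -> J 0 ->
  (forall c x y, J x -> J y -> J (iota c *: x + y)) ->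
  (forall x y, J x -> J y -> x * y = 0) ->
  subgroup [set 1 + x | x in J] G.
Proof.
move=> JA J0 JL JJ.
have JN x : J x -> J (- x).
  by move=> Jx; have := JL (-1) x 0 Jx J0; rewrite rmorphN1 scaleN1r addr0.
have inv x : J x -> (1 + x) * (1 - x) = 1.
  by move=> Jx; rewrite mulrDl mul1r mulrBr mulr1 JJ // subr0 subrK.
have JG x : J x -> G (1 + x).
  move=> Jx; split; first by apply: (subringD rA); [exact: (subring1 rA) | exact: JA].
  have /(congr1 determinant) := inv _ Jx; rewrite det_mulmx det1.
  by apply: contra_eqN => /eqP ->; rewrite mul0r eq_sym oner_neq0.
split.
- exact: order_units_unit.
- by move=> _ [x Jx <-]; exact: JG.
- by exists 0; rewrite ?addr0.
- move=> _ _ [x Jx <-] [y Jy <-]; exists (x + y).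
    by have := JL 1 x y Jx Jy; rewrite rmorph1 scale1r.
  by rewrite mulrDl mul1r mulrDr mulr1 JJ // addr0 -addrA [y + x]addrC.
- move=> _ [x Jx <-]; exists (- x); first exact: JN.
  apply: (mulrI (order_units_unit (JG _ Jx))).
  by rewrite inv // divrr // (order_units_unit (JG _ Jx)).
Qed.

Lemma order_linear c x y : A x -> A y -> A (iota c *: x + y).
Proof. by move=> Ax Ay; apply: (subringD rA) => //; exact: corderZ. Qed.
End Unipotent.

Section RepeatedEigenvalues.
Variables (k K : fieldType) (iota : {rmorphism k -> K}) (A : set 'M[K]_2).
Hypothesis oA : constant_order iota A.
Let rA := corder_ring oA.
Local Notation G := (order_units A).
Local Notation Z := [set (iota c)%:M | c in [set c | c != 0]].
Hypothesis hb : forall g, G g -> exists c, \tr g = iota (c + c) /\ \det g = iota (c ^+ 2).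

(** With t = tr(x y), the matrices (1 + x)(1 + y) and (1 + x)(1 + x)(1 + y) have
    determinant 1 and traces 2 + t and 2 + 2t; both traces have square 4. *)
Lemma order_nilpotent_mul x y : A x -> A y -> \tr x = 0 -> \det x = 0 ->
  \tr y = 0 -> \det y = 0 -> \tr (x * y) = 0.
Proof.
move=> Ax Ay tx dx ty dy; set t := \tr (x * y).
have A1 (z : 'M[K]_2) : A z -> A (1 + z) by move=> Az; apply: (subringD rA) => //; exact: (subring1 rA).
have d1 (z : 'M[K]_2) : \tr z = 0 -> \det z = 0 -> \det (1 + z) = 1.
  by move=> tz dz; rewrite det2_1D tz dz !addr0.
have disc g : A g -> \det g = 1 -> \tr g ^+ 2 = 4.
  move=> Ag dg; have [|c [-> dc]] := hb (g := g).
    by split; rewrite // dg oner_neq0.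
  transitivity (4 * iota (c ^+ 2)); last by rewrite -dc dg mulr1.
  by rewrite rmorphD rmorphXn; ring.
have E1 : (2 + t) ^+ 2 = 4.
  rewrite -(disc ((1 + x) * (1 + y))).
  - congr (_ ^+ 2); rewrite mulrDl mul1r mulrDr mulr1 !raddfD /= trace2_1 tx ty -/t.
    by ring.
  - by apply: (subringM rA); apply: A1.
  - by rewrite [LHS]det_mulmx !d1 // mulr1.
have E2 : (2 + (t + t)) ^+ 2 = 4.
  rewrite -(disc ((1 + x) * ((1 + x) * (1 + y)))).
  - congr (_ ^+ 2); rewrite mulrA.
    have -> : (1 + x) * (1 + x) = 1 + (x + x).
      by rewrite mulrDl mul1r mulrDr mulr1 nilpotent2 // addr0 addrA.
    rewrite mulrDl mul1r mulrDr mulr1 [(x + x) * y]mulrDl !raddfD /= trace2_1 tx ty -/t.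
    by ring.
  - by do ![apply: (subringM rA)|apply: A1].
  - by rewrite [LHS]det_mulmx [X in _ * X]det_mulmx !d1 // !mulr1.
apply/eqP; apply: contraT => t0.
have t4 : t = - 4.
  apply: (mulfI t0); apply/eqP; rewrite -subr_eq0; apply/eqP.
  by transitivity ((2 + t) ^+ 2 - 4); [ring | rewrite E1 subrr].
have two0 : (2 : K) = 0.
  have : (2 : K) ^+ 5 = 0.
    by transitivity ((2 + (t + t)) ^+ 2 - 4); [rewrite t4; ring | rewrite E2 subrr].
  by move/eqP; rewrite expf_eq0 => /eqP.
have f4 : (4 : K) = 2 * 2 by ring.
by move: t0; rewrite t4 f4 two0 mul0r oppr0 eqxx.
Qed.

Let J : set 'M[K]_2 := [set x | [/\ A x, \tr x = 0 & \det x = 0]].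

Lemma order_split_unipotent : exists N : set 'M[K]_2,
  internal_direct_product G Z N /\ exists V : vectType k, group_iso *%R N +%R [set: V].
Proof.
have JA : J `<=` A by move=> x [].
have J0 : J 0 by split; [exact: (subring0 rA) | rewrite raddf0 | rewrite det0].
have JL c x y : J x -> J y -> J (iota c *: x + y).
  move=> [Ax tx dx] [Ay ty dy]; split.
  - exact: order_linear.
  - by rewrite raddfD /= linearZ /= tx ty mulr0 addr0.
  - rewrite det2D det2Z dx dy linearZ /= tx !mulr0 mul0r -scalerAl linearZ /=.
    by rewrite order_nilpotent_mul // mulr0 !addr0 subr0.
have JJ x y : J x -> J y -> x * y = 0.
  by move=> [Ax tx dx] [Ay ty dy]; apply: nilpotent2_mul => //; exact: order_nilpotent_mul.
exists [set 1 + x | x in J]; split; last exact: (unipotent_group_iso oA).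
have ZG g : Z g -> G g by move=> [c c0 <-]; exact: order_units_scalar.
split.
- split=> //; first exact: order_units_unit.
  + by exists 1; rewrite ?rmorph1 //= oner_neq0.
  + move=> _ _ [c c0 <-] [d d0 <-]; exists (c * d); first by rewrite /= mulf_neq0.
    by rewrite rmorphM scalar_mxM.
  + move=> _ [c c0 <-]; exists c^-1; first by rewrite /= invr_eq0.
    by rewrite fmorphV -invmx_scalar.
- exact: (unipotent_subgroup oA JA J0 JL JJ).
- by move=> _ n [c c0 <-] _; apply/esym; exact: scalar_mxC.
- apply/seteqP; split=> [_ [[c c0 <-] [x [Ax tx dx] xE]]|_ ->].
    have : x = (iota (c - 1))%:M.
      by rewrite rmorphB rmorph1 raddfB /= -xE addrC addKr.
    move=> xc; move: dx; rewrite xc det_scalar => /eqP.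
    by rewrite expf_eq0 fmorph_eq0 subr_eq0 => /eqP ->; rewrite rmorph1.
  split; first by exists 1; rewrite ?rmorph1 //= oner_neq0.
  by exists 0; rewrite ?addr0.
- apply/seteqP; split=> g.
    move=> Gg; have [c [tg dg]] := hb Gg; have [Ag dg0] := Gg.
    have c0 : c != 0.
      by apply: contraNneq dg0 => c0; rewrite dg c0 expr0n rmorph0.
    have ic0 : iota c != 0 by rewrite fmorph_eq0.
    exists (iota c)%:M; first by exists c.
    pose n := (iota c)^-1 *: (g - (iota c)%:M).
    have nE : 1 + n = (iota c)^-1 *: g.
      rewrite /n scalerBr scale_scalar_mx mulVf // addrC subrK //.
    exists (1 + n); last by rewrite nE [LHS]mul_scalar_mx scalerA mulfV // scale1r.
    exists n => //; split.
    + rewrite /n -fmorphV; apply: corderZ => //; apply: (subringB rA) => //.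
      exact: (corder_scalar oA).
    + by rewrite /n linearZ /= raddfB /= tg trace2_scalar rmorphD subrr mulr0.
    + rewrite /n det2Z det2_scalarB tg dg rmorphD rmorphXn.
      by rewrite (_ : _ - _ + _ = 0) ?mulr0 //; ring.
  case=> _ [c c0 <-] [_ [x [Ax tx dx] <-] <-].
  split.
    apply: (subringM rA); first exact: (corder_scalar oA).
    by apply: (subringD rA) => //; exact: (subring1 rA).
  rewrite det_mulmx det_scalar det2_1D tx dx !addr0 mulr1 expf_neq0 //.
  by rewrite fmorph_eq0.
Qed.
End RepeatedEigenvalues.

(** * Orders split by an idempotent *)

Section SplitOrder.
Variables (k K : fieldType) (iota : {rmorphism k -> K}) (A : set 'M[K]_2).
Hypothesis oA : constant_order iota A.
Let rA := corder_ring oA.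
Local Notation G := (order_units A).
Hypothesis hquad : exists T D : k, forall c, c ^+ 2 - T * c + D != 0.
Hypothesis ha : forall g, G g ->
  exists c d, \tr g = iota (c + d) /\ \det g = iota (c * d).
Variables e f : 'M[K]_2.
Hypotheses (Ae : A e) (de : \det e = 0) (te : \tr e = 1) (fE : f = 1 - e).

Let ee : e * e = e := rank_one_idem de te.
Let df : \det f = 0. Proof. by rewrite fE; case: (rank_one_compl de te). Qed.
Let tf : \tr f = 1. Proof. by rewrite fE; case: (rank_one_compl de te). Qed.
Let ef : e * f = 0. Proof. by rewrite fE mulrBr mulr1 ee subrr. Qed.
Let fe : f * e = 0. Proof. by rewrite fE mulrBl mul1r ee subrr. Qed.
Let ff : f * f = f := rank_one_idem df tf.
Let efD : e + f = 1. Proof. by rewrite fE addrC subrK. Qed.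
Let Af : A f. Proof. by rewrite fE; apply: (subringB rA) => //; exact: (subring1 rA). Qed.

(** Otherwise, with B this trace, T f + e x f - (D / B) f y e is an element of A
    with characteristic polynomial X^2 - T X + D. *)
Lemma offdiag_trace x y : A x -> A y -> \tr (e * x * f * y) = 0.
Proof.
move=> Ax Ay; have [T [D TD]] := hquad.
pose a := e * x * f; pose b := f * y * e.
have Aa : A a by do ![apply: (subringM rA) => //].
have Ab : A b by do ![apply: (subringM rA) => //].
have tab : \tr (a * b) = \tr (e * x * f * y).
  have -> : a * b = e * x * f * y * e by rewrite /a /b !mulrA -[_ * f * f]mulrA ff.
  by rewrite trace2_mulC !mulrA ee.
rewrite -tab; have [B BE] := corder_trace oA (subringM rA Aa Ab).
rewrite BE; have [->|B0] := eqVneq B 0; first exact: rmorph0.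
pose h := iota T *: f + (a + iota (- D / B) *: b).
have Ah : A h by do ![apply: order_linear => //|apply: (subringD rA)|apply: corderZ] => //.
have ta : \tr a = 0 by rewrite trace2_mulC !mulrA fe !mul0r raddf0.
have tb : \tr b = 0 by rewrite trace2_mulC !mulrA ef !mul0r raddf0.
have da : \det a = 0 by rewrite [LHS]det_mulmx df mulr0.
have db : \det b = 0 by rewrite [LHS]det_mulmx de mulr0.
have tfa : \tr (f * a) = 0 by rewrite /a !mulrA fe !mul0r raddf0.
have tfb : \tr (f * b) = 0 by rewrite /b !mulrA ff.
have th : \tr h = iota T.
  by rewrite /h !raddfD /= !linearZ /= tf ta tb; ring.
have dh : \det h = iota D.
  have trZ c (z : 'M[K]_2) : \tr (c *: z) = c * \tr z by exact: linearZ.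
  have trD (z w : 'M[K]_2) : \tr (z + w) = \tr z + \tr w by exact: raddfD.
  have tfab : \tr (iota T *: f * (a + iota (- D / B) *: b)) = 0.
    by rewrite -scalerAl mulrDr -scalerAr !(trZ, trD) tfa tfb mulr0 addr0 mulr0.
  rewrite /h det2D tfab det2D -scalerAr !(trZ, trD) !det2Z da db df ta tb tf BE.
  have iB : iota B != 0 by rewrite fmorph_eq0.
  by rewrite rmorphM rmorphN fmorphV; field.
have [|c [d [tcd dcd]]] := ha (g := h).
  split=> //; rewrite dh fmorph_eq0; have := TD 0.
  by rewrite expr0n mulr0 subrr add0r.
have /eqP := TD c; case.
have -> : T = c + d by apply: (fmorph_inj iota); rewrite -th.
have -> : D = c * d by apply: (fmorph_inj iota); rewrite -dh.
by ring.
Qed.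

(** If the corner of x y passing through f' vanishes, the corner at e' is
    multiplicative. *)
Lemma sandwich_mul (e' f' x y : 'M[K]_2) : \det e' = 0 -> \tr e' = 1 -> e' + f' = 1 ->
  \tr (e' * x * f' * y) = 0 ->
  \tr (x * y * e') = \tr (x * e') * \tr (y * e').
Proof.
move=> de' te' ef1 off.
have -> : \tr (x * y * e') = \tr (e' * x * e' * y) + \tr (e' * x * f' * y).
  rewrite -raddfD /= -mulrDl -mulrDr ef1 mulr1.
  by rewrite trace2_mulC mulrA.
rewrite off addr0 rank_one_sandwich // -scalerAl linearZ /=.
by congr (_ * _); exact: trace2_mulC.
Qed.

Let J : set 'M[K]_2 := [set x | [/\ A x, \tr (x * e) = 0 & \tr (x * f) = 0]].

(** J, the sum of the corners e A f and f A e, has square zero by offdiag_trace;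
    1 + J is the kernel of the pair of corner characters. *)
Lemma order_borel : exists N : set 'M[K]_2,
  [/\ normal_subgroup N G,
      group_iso (@mulset _) (quotient_set G N)
        (fun p q : k * k => (p.1 * q.1, p.2 * q.2)) (units k `*` units k)
    & exists V : vectType k, group_iso *%R N +%R [set: V]].
Proof.
have offe := offdiag_trace.
have offf x y : A x -> A y -> \tr (f * x * e * y) = 0.
  move=> Ax Ay; rewrite -[_ * e * y]mulrA trace2_mulC mulrA; exact: offe.
have JA : J `<=` A by move=> x [].
have J0 : J 0 by split; rewrite ?mul0r ?raddf0 //; exact: (subring0 rA).
have JL c x y : J x -> J y -> J (iota c *: x + y).
  move=> [Ax xe xf] [Ay ye yf]; split; first exact: order_linear.
    by rewrite mulrDl -scalerAl raddfD /= linearZ /= xe ye mulr0 addr0.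
  by rewrite mulrDl -scalerAl raddfD /= linearZ /= xf yf mulr0 addr0.
have JE x : J x -> x = e * x * f + f * x * e.
  move=> [Ax xe xf].
  have E : e * x * e = 0 by rewrite rank_one_sandwich // xe scale0r.
  have F : f * x * f = 0 by rewrite rank_one_sandwich // xf scale0r.
  transitivity ((e + f) * x * (e + f)); first by rewrite efD mul1r mulr1.
  by rewrite mulrDr !mulrDl E F add0r addr0 addrC.
have JJ x y : J x -> J y -> x * y = 0.
  move=> Jx Jy; have [[Ax _ _] [Ay _ _]] := (Jx, Jy).
  rewrite (JE _ Jx) (JE _ Jy) mulrDl !mulrDr.
  have z1 : e * x * f * (e * y * f) = 0 by rewrite !mulrA -[_ * f * e]mulrA fe mulr0 !mul0r.
  have z2 : f * x * e * (f * y * e) = 0 by rewrite !mulrA -[_ * e * f]mulrA ef mulr0 !mul0r.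
  have z3 : e * x * f * (f * y * e) = 0.
    rewrite !mulrA -[_ * f * f]mulrA ff.
    have -> : e * x * f * y * e = e * (x * f * y) * e by rewrite !mulrA.
    rewrite rank_one_sandwich // [\tr _]trace2_mulC !mulrA.
    by rewrite offe // scale0r.
  have z4 : f * x * e * (e * y * f) = 0.
    rewrite !mulrA -[_ * e * e]mulrA ee.
    have -> : f * x * e * y * f = f * (x * e * y) * f by rewrite !mulrA.
    rewrite rank_one_sandwich // [\tr _]trace2_mulC !mulrA.
    by rewrite offf // scale0r.
  by rewrite z1 z2 z3 z4 !addr0.
have /choice[rho rhoP] : forall y : K, exists c, forall d, y = iota d -> c = d.
  move=> y; have [[d ->]|n] := pselect (exists d, y = iota d).
    by exists d => d' /fmorph_inj.
  by exists 0 => d yd; case: n; exists d.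
have rhoK c : rho (iota c) = c by apply: rhoP.
have trA x : A x -> iota (rho (\tr x)) = \tr x.
  by move=> /(corder_trace oA)[c ->]; rewrite rhoK.
pose chi x := (rho (\tr (x * e)), rho (\tr (x * f))).
have chiM x y : A x -> A y -> chi (x * y) = ((chi x).1 * (chi y).1, (chi x).2 * (chi y).2).
  move=> Ax Ay.
  rewrite /chi /= (sandwich_mul de te efD) ?offe //.
  rewrite (sandwich_mul df tf (f' := e)) ?offf //; last by rewrite addrC.
  have Axe := subringM rA Ax Ae; have Aye := subringM rA Ay Ae.
  have Axf := subringM rA Ax Af; have Ayf := subringM rA Ay Af.
  by rewrite -(trA _ Axe) -(trA _ Aye) -(trA _ Axf) -(trA _ Ayf) -!rmorphM !rhoK.
have chi1 : chi 1 = (1, 1) by rewrite /chi !mul1r te tf -(rmorph1 iota) rhoK.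
have sG := order_units_subgroup oA; have [GU _ G1 _ GV] := sG.
have tr_ef x : \tr x = \tr (x * e) + \tr (x * f).
  by rewrite -raddfD /= -mulrDr efD mulr1.
have [|u|g h [Ag _] [Ah _]||nN qN] := @quotient_iso _ G [set 1 + x | x in J] _
   (fun p q : k * k => (p.1 * q.1, p.2 * q.2)) (units k `*` units k) chi sG.
- move=> g Gg; have Gg' := GV _ Gg; have [[Ag _] [Ag' _]] := (Gg, Gg').
  have := chiM _ _ Ag Ag'; rewrite mulrV ?chi1; last exact: GU.
  case=> u1 u2; split; apply/unitrPr; by [exists (chi g^-1).1 | exists (chi g^-1).2].
- case: u => c d [/= uc ud]; pose g := iota c *: e + iota d *: f.
  have ge : g * e = iota c *: e.
    by rewrite mulrDl -!scalerAl ee fe scaler0 addr0.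
  have gf : g * f = iota d *: f.
    by rewrite mulrDl -!scalerAl ef ff scaler0 add0r.
  exists g; last by rewrite /chi ge gf !linearZ /= te tf !mulr1 !rhoK.
  split; first by apply: (subringD rA); apply: corderZ.
  rewrite /g det2D !det2Z de df !linearZ /= te tf -scalerAl linearZ /= -scalerAr ef.
  rewrite scaler0 raddf0 !mulr0 !mulr1 !add0r subr0 mulf_neq0 // fmorph_eq0 -unitfE //.
- exact: chiM.
- apply/seteqP; split=> [_ [x Jx <-]|g [[Ag dg]]].
    split; first by have [_ sNG _ _ _] := unipotent_subgroup oA JA J0 JL JJ; apply: sNG; exists x.
    have [Ax xe xf] := Jx.
    by rewrite chi1 /chi !mulrDl !mul1r !raddfD /= xe xf te tf !addr0 -(rmorph1 iota) rhoK.
  rewrite chi1 => -[ge gf]; exists (g - 1); last by rewrite addrC subrK.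
  have one c : A c -> rho (\tr c) = 1 -> \tr c = 1.
    by move=> Ac rc; rewrite -(trA _ Ac) rc rmorph1.
  split; first by apply: (subringB rA) => //; exact: (subring1 rA).
    by rewrite mulrBl mul1r raddfB /= te (one _ _ ge) ?subrr //; exact: (subringM rA).
  by rewrite mulrBl mul1r raddfB /= tf (one _ _ gf) ?subrr //; exact: (subringM rA).
by exists [set 1 + x | x in J]; split=> //; exact: (unipotent_group_iso oA JA J0 JL JJ).
Qed.
End SplitOrder.

(** * Orders containing a separable quadratic extension *)

Section MoreMatrix2.
Variable F : fieldType.
Implicit Types x y e g w : 'M[F]_2.

Lemma anticommutator2 x y :
  x * y + y * x = \tr x *: y + \tr y *: x + (\tr (x * y) - \tr x * \tr y)%:M.
Proof. by apply: mx2P; rewrite !mx2E /=; ring. Qed.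

Definition no_eigenvalue g := forall a : F, a ^+ 2 - \tr g * a + \det g != 0.

(** The quadratic form is the determinant of the pair (w, g w) for the column
    w = (p, r); if it vanishes for w != 0, then w is an eigenvector. *)
Lemma no_invariant_line g p r : no_eigenvalue g ->
  g 1 0 * p ^+ 2 + (g 1 1 - g 0 0) * p * r - g 0 1 * r ^+ 2 = 0 -> p = 0 /\ r = 0.
Proof.
move=> ng E; have [r0|r0] := eqVneq r 0; last first.
  have /eqP := ng (g 1 0 * (p / r) + g 1 1); case; rewrite !mx2E.
  transitivity (g 1 0 * ((g 1 0 * p ^+ 2 + (g 1 1 - g 0 0) * p * r - g 0 1 * r ^+ 2) / r ^+ 2)).
    by field.
  by rewrite E mul0r mulr0.
split=> //; move/eqP: E; rewrite r0 expr0n /= !mulr0 addr0 subr0 mulf_eq0 expf_eq0 /=.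
case/orP => [/eqP g10|/eqP //]; have /eqP := ng (g 0 0); case.
by rewrite !mx2E g10; ring.
Qed.

(** If tr(g e) vanished, the image of e, which is also its kernel, would be an
    invariant line of g. *)
Lemma nilpotent_trace_neq0 g e : no_eigenvalue g -> e != 0 ->
  \det e = 0 -> \tr e = 0 -> \tr (g * e) != 0.
Proof.
move=> ng e0 de te; apply: contraNneq e0 => tge.
have e11 : e 1 1 = - e 0 0 by apply/eqP; rewrite -addr_eq0 addrC -trace2E te.
have dE : e 0 0 ^+ 2 + e 0 1 * e 1 0 = 0.
  by apply/eqP; rewrite -oppr_eq0 -de det2E e11; apply/eqP; ring.
have tE : g 0 0 * e 0 0 + g 0 1 * e 1 0 + g 1 0 * e 0 1 - g 1 1 * e 0 0 = 0.
  by rewrite -tge !mx2E e11; ring.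
have [|e00 e10] := @no_invariant_line g (e 0 0) (e 1 0) ng.
  transitivity (g 1 0 * (e 0 0 ^+ 2 + e 0 1 * e 1 0) - e 1 0 *
    (g 0 0 * e 0 0 + g 0 1 * e 1 0 + g 1 0 * e 0 1 - g 1 1 * e 0 0)); first by ring.
  by rewrite dE tE !mulr0 subrr.
have [|e01 _] := @no_invariant_line g (e 0 1) (e 1 1) ng.
  transitivity (e 0 1 * (g 0 0 * e 0 0 + g 0 1 * e 1 0 + g 1 0 * e 0 1 - g 1 1 * e 0 0)
    - g 0 1 * (e 0 0 ^+ 2 + e 0 1 * e 1 0)).
    by rewrite e11; ring.
  by rewrite tE dE !mulr0 subrr.
by apply/eqP/mx2P; rewrite mxE // e11 e00 oppr0.
Qed.

(** In a basis adapted to e this reads g01 g10 = g00 g11 - det g, and the right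
    side is minus the characteristic polynomial of g at g00. *)
Lemma rank_one_offdiag g e : \det e = 0 -> \tr e = 1 ->
  \tr (e * g * (1 - e) * g) = \tr (g * e) * (\tr g - \tr (g * e)) - \det g.
Proof.
move=> de te; rewrite mulrBr mulr1 mulrBl -mulrA quadratic2 mulrBr -scalerAr.
have -> : e * (\det g)%:M = \det g *: e by exact: mul_mx_scalar.
rewrite !raddfB /= !linearZ /= te rank_one_sandwich // -scalerAl linearZ /=.
by rewrite [\tr (e * g)]trace2_mulC; ring.
Qed.
End MoreMatrix2.

Section MatrixUnits.
Variables (k K : fieldType) (iota : {rmorphism k -> K}) (A : set 'M[K]_2).
Hypothesis oA : constant_order iota A.
Let rA := corder_ring oA.
Variables e f a b : 'M[K]_2.
Hypotheses (Ae : A e) (Aa : A a) (Ab : A b).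
Hypotheses (de : \det e = 0) (te : \tr e = 1) (fE : f = 1 - e).
Hypotheses (ea : e * a = a) (af : a * f = a) (fb : f * b = b) (be : b * e = b).
Hypotheses (ab : a * b = e) (ba : b * a = f).

(** e, a, b, f are the matrix units E00, E01, E10, E11.  The coordinates of an
    element of A in this basis are traces of elements of A, hence constants. *)
Lemma matrix_units_iso : group_iso *%R (order_units A) *%R (units 'M[k]_2).
Proof.
have ee : e * e = e := rank_one_idem de te.
have [df tf] := rank_one_compl de te; rewrite -fE in df tf.
have ff : f * f = f := rank_one_idem df tf.
have ef : e * f = 0 by rewrite fE mulrBr mulr1 ee subrr.
have fe : f * e = 0 by rewrite fE mulrBl mul1r ee subrr.
have ae : a * e = 0 by rewrite -af -mulrA fe mulr0.
have fa : f * a = 0 by rewrite -ea mulrA fe mul0r.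
have eb : e * b = 0 by rewrite -fb mulrA ef mul0r.
have bf : b * f = 0 by rewrite -be -mulrA ef mulr0.
have aa : a * a = 0 by rewrite -{1}af -mulrA fa mulr0.
have bb : b * b = 0 by rewrite -{1}be -mulrA eb mulr0.
have Af : A f by rewrite fE; apply: (subringB rA) => //; exact: (subring1 rA).
pose s (m : 'M[k]_2) := iota (m 0 0) *: e + iota (m 0 1) *: a
  + iota (m 1 0) *: b + iota (m 1 1) *: f.
have sB : zmod_morphism s.
  by move=> m n; rewrite /s !mxE !rmorphD !rmorphN; apply: mx2P; rewrite !mxE; ring.
have sM : monoid_morphism s.
  split.
    rewrite /s !mxE /= rmorph0 rmorph1 !scale0r !scale1r !addr0 fE.
    by rewrite addrC subrK.
  move=> m n; rewrite /s !mulmx2E !rmorphD !rmorphM.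
  rewrite !mulrDl !mulrDr -!scalerAl -!scalerAr.
  rewrite ee ea eb ef ae aa ab af be ba bb bf fe fa fb ff !scaler0.
  by apply: mx2P; rewrite !mxE; ring.
pose sz := GRing.isZmodMorphism.Build 'M[k]_2 'M[K]_2 s sB.
pose sm := GRing.isMonoidMorphism.Build 'M[k]_2 'M[K]_2 s sM.
pose S : {rmorphism 'M[k]_2 -> 'M[K]_2} := HB.pack s sz sm.
have trZ c (z : 'M[K]_2) : \tr (c *: z) = c * \tr z by exact: linearZ.
have trD (z w : 'M[K]_2) : \tr (z + w) = \tr z + \tr w by exact: raddfD.
have tab : \tr (a * b) = 1 by rewrite ab.
have tba : \tr (b * a) = 1 by rewrite ba.
have coord m : [/\ \tr (s m * e) = iota (m 0 0), \tr (s m * b) = iota (m 0 1),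
     \tr (s m * a) = iota (m 1 0) & \tr (s m * f) = iota (m 1 1)].
  rewrite /s !mulrDl -!scalerAl ee ea eb ef ae aa ab af be ba bb bf fe fa fb ff.
  have ta : \tr a = 0 by rewrite -ea trace2_mulC ae raddf0.
  have tb : \tr b = 0 by rewrite -be trace2_mulC eb raddf0.
  by split; rewrite !(trD, trZ) ?raddf0 ?te ?tf ?ta ?tb; ring.
apply: (order_units_iso oA (s := S)).
  move=> m n /= smn; have [m00 m01 m10 m11] := coord m.
  have [n00 n01 n10 n11] := coord n.
  by apply: mx2P; apply: (fmorph_inj iota); rewrite -?m00 -?m01 -?m10 -?m11 smn.
move=> x; split=> [Ax|[m <-]]; last first.
  by rewrite /= /s; do ![apply: (subringD rA) | apply: corderZ].
have trA z : A z -> exists c, \tr z = iota c := corder_trace oA (x := z).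
have [c00 E00] := trA _ (subringM rA Ax Ae).
have [c01 E01] := trA _ (subringM rA Ax Ab).
have [c10 E10] := trA _ (subringM rA Ax Aa).
have [c11 E11] := trA _ (subringM rA Ax Af).
exists (\matrix_(i, j) if i == 0 then if j == 0 then c00 else c01
                       else if j == 0 then c10 else c11).
rewrite /= /s !mxE /= -E00 -E01 -E10 -E11.
have xE : x = e * x * e + e * x * f + f * x * e + f * x * f.
  rewrite -addrA -mulrDr -mulrDr -!mulrA -mulrDl.
  by rewrite [e + f](_ : _ = 1) ?mul1r ?mulr1 // fE addrC subrK.
have Exf : e * x * f = \tr (x * b) *: a.
  rewrite -ba -be !mulrA -[e * x * b * e]/(e * x * b * e).
  by rewrite -[e * x * b]mulrA rank_one_sandwich // -[x * b * e]mulrA be -scalerAl ea.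
have Fxe : f * x * e = \tr (x * a) *: b.
  rewrite -ab -{1}af !mulrA.
  by rewrite -[f * x * a]mulrA rank_one_sandwich // -[x * a * f]mulrA af -scalerAl fb.
by rewrite [RHS]xE Exf Fxe !rank_one_sandwich.
Qed.
End MatrixUnits.

Lemma dim_family (k : fieldType) (V : vectType k) n (b : 'I_n -> V) :
  (forall q, exists v : 'rV[k]_n, q = \sum_i v 0 i *: b i) ->
  (forall v : 'rV[k]_n, \sum_i v 0 i *: b i = 0 -> v = 0) -> \dim {:V} = n.
Proof.
move=> span free; pose h (v : 'rV[k]_n) := \sum_i v 0 i *: b i.
have hL : linear h.
  move=> c u v; rewrite /h scaler_sumr -big_split /=; apply: eq_bigr => i _.
  by rewrite !mxE scalerDl scalerA.
pose hl := GRing.isLinear.Build k 'rV[k]_n V _ h hL.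
pose H : {linear 'rV[k]_n -> V} := HB.pack h hl.
have HE v : linfun H v = h v by rewrite lfunE.
have -> : {:V}%VS = (linfun H @: fullv)%VS.
  apply/esym/eqP; rewrite eqEsubv subvf /=.
  apply/subvP => q _; have [v ->] := span q.
  by rewrite -[\sum_i _]/(h v) -HE memv_img ?memvf.
rewrite limg_dim_eq; last first.
  apply/eqP; rewrite -subv0; apply/subvP => v; rewrite memv_cap memv_ker HE memv0.
  by case/andP=> _ /eqP/free ->.
by rewrite dimvf /dim /= mul1n.
Qed.

Lemma quadratic_discriminant (R : comNzRingType) (x a b : R) :
  4 * (x ^+ 2 - b * x + a) + - (2 * x - b) * (2 * x - b) = 4 * a - b ^+ 2.
Proof. by ring. Qed.

Section QuadraticElement.
Variables (k K : fieldType) (iota : {rmorphism k -> K}) (A : set 'M[K]_2).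
Hypothesis hk : algebraically_closed_in iota.
Hypothesis oA : constant_order iota A.
Let rA := corder_ring oA.
Local Notation G := (order_units A).
Variables (g : 'M[K]_2) (T D : k).
Hypotheses (Ag : A g) (tg : \tr g = iota T) (dg : \det g = iota D).
Hypothesis nr : forall c : k, c ^+ 2 - T * c + D != 0.

(** An eigenvalue in K would be algebraic over k, hence in k. *)
Lemma irreducible_no_eigenvalue : no_eigenvalue g.
Proof.
move=> a; apply/eqP => aE.
have [|c cE] := hk (y := a).
  exists ('X^2 - T *: 'X + D%:P).
    apply/eqP => /(congr1 (fun p : {poly k} => p`_2))/eqP.
    by rewrite coefD coefB coefXn coefZ coefX coefC coef0 /= mulr0 subr0 addr0 oner_eq0.
  rewrite /root rmorphD rmorphB /= map_polyXn map_polyZ map_polyX map_polyC /=.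
  by rewrite !hornerE -tg -dg aE.
move: aE; rewrite cE tg dg => /eqP; rewrite -rmorphXn -rmorphM -rmorphB -rmorphD.
by rewrite fmorph_eq0 (negPf (nr c)).
Qed.
Let ng := irreducible_no_eigenvalue.

(** If w is nilpotent, g w is not; so w or g w, divided by its trace, is an
    idempotent e.  The corners of g at e are then matrix units up to a factor. *)
Lemma split_order_iso w : A w -> w != 0 -> \det w = 0 ->
  group_iso *%R G *%R (units 'M[k]_2).
Proof.
move=> Aw w0 dw.
have [e [Ae de te]] : exists e, [/\ A e, \det e = 0 & \tr e = 1].
  have scale z : A z -> \det z = 0 -> \tr z != 0 ->
      exists e, [/\ A e, \det e = 0 & \tr e = 1].
    move=> Az dz tz; have [c cE] := corder_trace oA Az.
    exists (iota c^-1 *: z); split; first exact: corderZ.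
      by rewrite det2Z dz mulr0.
    by rewrite linearZ /= fmorphV -cE mulVf.
  have [tw|tw] := eqVneq (\tr w) 0; last exact: scale tw.
  apply: (scale (g * w)); first exact: (subringM rA).
    by rewrite [LHS]det_mulmx dw mulr0.
  exact: nilpotent_trace_neq0.
have [f fE] : exists f, f = 1 - e by exists (1 - e).
have Af : A f by rewrite fE; apply: (subringB rA) => //; exact: (subring1 rA).
have [df tf] := rank_one_compl de te; rewrite -fE in df tf.
have ee : e * e = e := rank_one_idem de te.
have ff : f * f = f := rank_one_idem df tf.
have tefE := rank_one_offdiag g de te; rewrite -fE in tefE.
have [b bE] : exists b, \tr (e * g * f * g) = iota b.
  by apply: (corder_trace oA); do ![apply: (subringM rA) => //].
have b0 : iota b != 0.
  rewrite -bE tefE -oppr_eq0; apply: contraNneq (ng (\tr (g * e))) => E.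
  by rewrite -[X in _ == X]E; apply/eqP; ring.
have Aa : A (e * g * f) by do ![apply: (subringM rA) => //].
have Ab : A (iota b^-1 *: (f * g * e)).
  by apply: corderZ => //; do ![apply: (subringM rA) => //].
apply: (matrix_units_iso oA Ae Aa Ab de te fE).
- by rewrite !mulrA ee.
- by rewrite -mulrA ff.
- by rewrite -scalerAr !mulrA ff.
- by rewrite -scalerAl -[_ * e * e]mulrA ee.
- rewrite -scalerAr !mulrA -[_ * f * f]mulrA ff.
  have -> : e * g * f * g * e = e * (g * f * g) * e by rewrite !mulrA.
  rewrite rank_one_sandwich // [\tr _]trace2_mulC !mulrA bE scalerA fmorphV.
  by rewrite mulVf // scale1r.
- rewrite -scalerAl !mulrA -[_ * e * e]mulrA ee.
  have -> : f * g * e * g * f = f * (g * e * g) * f by rewrite !mulrA.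
  rewrite (rank_one_sandwich df) -!mulrA [\tr _]trace2_mulC.
  rewrite [\tr _](_ : _ = iota b) ?scalerA ?fmorphV ?mulVf ?scale1r //.
  by rewrite -bE !mulrA.
Qed.

Hypothesis disc : T ^+ 2 - 4 * D != 0.
Hypothesis Adiv : forall w, A w -> \det w = 0 -> w = 0.

Let discK : (iota T) ^+ 2 - 4 * iota D != 0.
Proof.
suff -> : iota T ^+ 2 - 4 * iota D = iota (T ^+ 2 - 4 * D) by rewrite fmorph_eq0.
by rewrite rmorphB rmorphXn rmorphM rmorph_nat.
Qed.

Let unitA x : A x -> x != 0 -> x \is a GRing.unit.
Proof.
by move=> Ax; apply: contraR; rewrite unitmxE unitfE negbK => /eqP/(Adiv Ax) ->.
Qed.

Let gg : g * g = iota T *: g - (iota D)%:M. Proof. by rewrite quadratic2 tg dg. Qed.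
Let tgg : \tr (g * g) = iota T ^+ 2 - (iota D + iota D).
Proof. by rewrite gg raddfB /= linearZ /= tg trace2_scalar. Qed.

(** The trace form is nondegenerate on K[g], its discriminant being T^2 - 4 D. *)
Lemma quadratic_subfield_free (u v : K) (x := u%:M + v *: g) :
  \tr x = 0 -> \tr (x * g) = 0 -> u = 0 /\ v = 0.
Proof.
rewrite /x mulrDl -scalerAl [_%:M * g]mul_scalar_mx !raddfD /= !linearZ /= tgg tg.
rewrite trace2_scalar => E1 E2.
split; apply: (mulfI discK); rewrite mulr0.
  transitivity ((iota T ^+ 2 - (iota D + iota D)) * (u + u + v * iota T) -
    iota T * (u * iota T + v * (iota T ^+ 2 - (iota D + iota D)))); first by ring.
  by rewrite E1 E2 !mulr0 subrr.
transitivity (2 * (u * iota T + v * (iota T ^+ 2 - (iota D + iota D))) -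
  iota T * (u + u + v * iota T)); first by ring.
by rewrite E1 E2 !mulr0 subrr.
Qed.

(** The orthogonal complement of k[g] in A, for the trace form. *)
Definition orthogonal y := [/\ A y, \tr y = 0 & \tr (y * g) = 0].

Lemma order_decomposition x : A x -> exists (c d : k) (y : 'M[K]_2),
  x = (iota c)%:M + iota d *: g + y /\ orthogonal y.
Proof.
move=> Ax; have [s sE] := corder_trace oA Ax.
have [t tE] := corder_trace oA (subringM rA Ax Ag).
have [c [d [E1 E2]]] : exists c d, s = c + c + d * T /\
    t = c * T + d * (T ^+ 2 - (D + D)).
  exists (((T ^+ 2 - 2 * D) * s - T * t) / (T ^+ 2 - 4 * D)).
  by exists ((2 * t - T * s) / (T ^+ 2 - 4 * D)); split; field.
exists c, d, (x - ((iota c)%:M + iota d *: g)); split; first by rewrite addrC subrK.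
split.
- apply: (subringB rA) => //; apply: (subringD rA); first exact: (corder_scalar oA).
  exact: corderZ.
- rewrite raddfB raddfD /= linearZ /= trace2_scalar tg sE.
  by rewrite E1 !rmorphD rmorphM subrr.
- rewrite mulrBl mulrDl -scalerAl [_%:M * g]mul_scalar_mx raddfB raddfD /= !linearZ /=.
  by rewrite tgg tg tE E2 !(rmorphB, rmorphD, rmorphM, rmorphXn) subrr.
Qed.

(** Conjugation by y exchanges the roots g and T - g of X^2 - T X + D. *)
Lemma orthogonal_anticomm y : orthogonal y -> y * g = (iota T)%:M * y - g * y.
Proof.
move=> [_ ty tyg]; have := anticommutator2 y g.
rewrite ty tyg tg scale0r mul0r !(subr0, add0r) oppr0 raddf0 addr0 [_%:M * y]mul_scalar_mx.
by move=> <-; rewrite addrK.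
Qed.

Lemma scalarC (c : K) (x : 'M[K]_2) : x * c%:M = c%:M * x.
Proof. exact: scalar_mxC. Qed.

(** y would satisfy (2 g - T) y = 0, and 2 g - T is invertible. *)
Lemma centralizer_orthogonal y : orthogonal y -> y * g = g * y -> y = 0.
Proof.
move=> oy; rewrite (orthogonal_anticomm oy) => E.
have u : (g + g - (iota T)%:M) \is a GRing.unit.
  rewrite unitmxE unitfE det2_scalarB raddfD /= tg.
  have -> : \det (g + g) = 4 * \det g by rewrite !mx2E; ring.
  rewrite dg -oppr_eq0.
  by rewrite [X in X != 0](_ : _ = iota T ^+ 2 - 4 * iota D) //; ring.
move/eqP: E; rewrite subr_eq => /eqP E.
by apply: (mulrI u); rewrite mulr0 mulrBl mulrDl E subrr.
Qed.

Lemma order_quadratic_field : (forall y, orthogonal y -> y = 0) ->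
  exists L : fieldExtType k, separable_quadratic L /\ group_iso *%R G *%R (units L).
Proof.
move=> no_orth.
have AE x : A x -> exists c d : k, x = (iota c)%:M + iota d *: g.
  move=> /order_decomposition[c [d [y [-> /no_orth->]]]].
  by exists c, d; rewrite addr0.
have Acomm x y : A x -> A y -> x * y = y * x.
  move=> /AE[c [d ->]] /AE[c' [d' ->]].
  by apply: mx2P; rewrite !mx2E /=; ring.
have [L [s [sI sZ sA]]] := order_field oA Acomm Adiv.
exists L; split; last exact: (order_units_iso oA sI sA).
have [q sq] := (sA _).1 Ag.
have s1 c : s c%:A = (iota c)%:M by rewrite sZ rmorph1 scalemx1.
have LE x : exists c d : k, x = c%:A + d *: q.
  have [|c [d xE]] := AE (s x); first by apply/sA; exists x.
  by exists c, d; apply: sI; rewrite rmorphD s1 sZ sq.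
split.
  apply: (dim_family (b := fun i : 'I_2 => if i == 0 then 1 else q)).
    move=> x; have [c [d ->]] := LE x.
    exists (\row_i if i == 0 then c else d).
    by rewrite big_ord_recl big_ord1 !mxE /=.
  move=> v; rewrite big_ord_recl big_ord1 /= => /(congr1 s).
  rewrite rmorphD !sZ rmorph1 rmorph0 sq => E.
  have [||v0 v1] := @quadratic_subfield_free (iota (v 0 ord0)) (iota (v 0 (lift ord0 ord0))).
  - by rewrite -scalemx1 E raddf0.
  - by rewrite -scalemx1 E mul0r raddf0.
  apply/rowP => i; rewrite mxE; apply: (fmorph_inj iota); rewrite rmorph0.
  by case: (unliftP ord0 i) => [j ->|->//]; rewrite ord1.
have -> : {:L}%VS = <<1; q>>%VS.
  apply/esym/eqP; rewrite eqEsubv subvf /=; apply/subvP => x _.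
  have [c [d ->]] := LE x; rewrite memvD // memvZ //.
    by apply: subvP_adjoin; exact: mem1v.
  exact: memv_adjoin.
rewrite -adjoin_separable_eq /separable_element.
pose P : {poly L} := 'X^2 - (T%:A)%:P * 'X + (D%:A)%:P.
have qq : q ^+ 2 - T%:A * q + D%:A = 0.
  apply: sI; rewrite rmorphD rmorphB rmorphXn rmorphM !s1 sq rmorph0 expr2 gg.
  by rewrite [_%:M * g]mul_scalar_mx addrAC subrK addrN.
apply: (@dvdp_separable _ P).
  apply: minPoly_dvdp; last by rewrite /root !hornerE qq.
  rewrite rpredD ?rpredB ?rpredX ?rpredM ?polyOverX ?polyOverC //.
    by rewrite rpredZ // mem1v.
  by rewrite rpredZ // mem1v.
(* 4 P - P'^2 is the discriminant, up to sign *)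
rewrite unlock; apply/Bezout_coprimepP; exists (4, - P^`()); rewrite /=.
have dP : P^`() = 2 * 'X - (T%:A)%:P by rewrite /P !derivE /=; ring.
have -> : 4 * P + - P^`() * P^`() = (4 * D%:A - T%:A ^+ 2)%:P.
  rewrite polyCB polyCM polyC_exp polyCMn polyC1 dP /P.
  exact: quadratic_discriminant.
have -> : 4 * D%:A - T%:A ^+ 2 = (4 * D - T ^+ 2)%:A :> L.
  by rewrite scalerBl !mulr_natl -scalerMnl exprZn expr1n.
by rewrite polyC_eqp1 scaler_eq0 oner_eq0 orbF -oppr_eq0 opprB.
Qed.

(** For z orthogonal to k[g], the product z y commutes with g, hence lies in k[g];
    as y^2 is a nonzero constant, z lies in k[g] y.  So 1, g, y, g y is a
    basis. *)
Lemma order_quaternion y : orthogonal y -> y != 0 ->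
  exists Q : falgType k, quaternion_division_algebra Q /\ group_iso *%R G *%R (units Q).
Proof.
move=> oy y0; have [Ay ty tyg] := oy.
have [Q [s [sI sZ sA]]] := order_algebra oA.
exists Q; split; last exact: (order_units_iso oA sI sA).
have [q sq] := (sA _).1 Ag; have [r sr] := (sA _).1 Ay.
have s1 c : s c%:A = (iota c)%:M by rewrite sZ rmorph1 scalemx1.
have As x : A (s x) by apply/sA; exists x.
have uy : y \is a GRing.unit by exact: unitA.
have orth_g x : orthogonal x -> orthogonal (g * x).
  move=> ox; have [Ax tx txg] := ox; split; first exact: (subringM rA).
    by rewrite trace2_mulC.
  rewrite trace2_mulC mulrA gg mulrBl -scalerAl [_%:M * x]mul_scalar_mx.
  by rewrite raddfB /= !linearZ /= tx mulr0 subr0 trace2_mulC txg mulr0.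
have orthD x z : orthogonal x -> orthogonal z -> orthogonal (x + z).
  move=> [Ax tx txg] [Az tz tzg]; split; first exact: (subringD rA).
    by rewrite raddfD /= tx tz addr0.
  by rewrite mulrDl raddfD /= txg tzg addr0.
have orthZ c x : orthogonal x -> orthogonal (iota c *: x).
  move=> [Ax tx txg]; split; first exact: corderZ.
    by rewrite linearZ /= tx mulr0.
  by rewrite -scalerAl linearZ /= txg mulr0.
have freeA c d c' d' : (iota c)%:M + iota d *: g + (iota c' *: y + iota d' *: (g * y)) = 0 ->
    [/\ c = 0, d = 0, c' = 0 & d' = 0].
  move=> E; have oz : orthogonal (iota c' *: y + iota d' *: (g * y)).
    by apply: orthD; apply: orthZ => //; exact: orth_g.
  have xE : (iota c)%:M + iota d *: g = - (iota c' *: y + iota d' *: (g * y)).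
    by apply/eqP; rewrite -addr_eq0 E.
  have [_ tz tzg] := oz.
  have [||c0 d0] := @quadratic_subfield_free (iota c) (iota d).
  - by rewrite xE raddfN /= tz oppr0.
  - by rewrite xE mulNr raddfN /= tzg oppr0.
  have x0 : (iota c')%:M + iota d' *: g = 0.
    apply: (mulIr uy); rewrite mul0r mulrDl [_%:M * y]mul_scalar_mx -scalerAl.
    by move: E; rewrite c0 d0 raddf0 scale0r !add0r.
  have [||c0' d0'] := @quadratic_subfield_free (iota c') (iota d').
  - by rewrite x0 raddf0.
  - by rewrite x0 mul0r raddf0.
  have z a : iota a = 0 -> a = 0 by move/eqP; rewrite fmorph_eq0 => /eqP.
  by split; apply: z.
have spanA x : A x -> exists c d c' d' : k,
    x = (iota c)%:M + iota d *: g + (iota c' *: y + iota d' *: (g * y)).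
  move=> /order_decomposition[c [d [z [-> oz]]]]; exists c, d.
  have [Az tz tzg] := oz.
  have zyg : z * y * g = g * (z * y).
    rewrite -mulrA (orthogonal_anticomm oy) mulrBr [z * (_%:M * y)]mulrA scalarC -mulrA.
    rewrite [z * (g * y)]mulrA (orthogonal_anticomm oz) mulrBl -!mulrA.
    by rewrite opprB addrC subrK.
  have [c' [d' [w [zyE ow]]]] := order_decomposition (subringM rA Az Ay).
  have w0 : w = 0.
    apply: centralizer_orthogonal => //.
    move: zyg; rewrite zyE mulrDl mulrDr mulrDl mulrDr scalarC -scalerAl -scalerAr.
    by move/addrI.
  have yy : y * y = (- \det y)%:M.
    by rewrite quadratic2 ty scale0r add0r raddfN.
  have [e eE] := corder_det oA Ay.
  have e0 : iota e != 0 by rewrite -eE -unitfE -unitmxE.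
  exists (- c' / e), (- d' / e); congr (_ + _).
  apply: (mulIr uy); rewrite zyE w0 addr0 mulrDl -!scalerAl -[g * y * y]mulrA yy eE.
  rewrite scalarC [_%:M * g]mul_scalar_mx scalerA scale_scalar_mx.
  by congr (_%:M + _ *: _); rewrite rmorphM rmorphN fmorphV; field.
have As4 c d c' d' : s (c%:A + d *: q + (c' *: r + d' *: (q * r))) =
    (iota c)%:M + iota d *: g + (iota c' *: y + iota d' *: (g * y)).
  by rewrite !rmorphD s1 !sZ rmorphM sq sr.
split.
- pose b (i : 'I_4) : Q := nth 0 [:: 1; q; r; q * r] i.
  pose o1 : 'I_4 := lift ord0 ord0; pose o2 : 'I_4 := lift ord0 (lift ord0 ord0).
  pose o3 : 'I_4 := lift ord0 (lift ord0 (lift ord0 ord0)).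
  have bE (v : 'rV[k]_4) : \sum_i v 0 i *: b i = (v 0 ord0)%:A + v 0 o1 *: q
      + (v 0 o2 *: r + v 0 o3 *: (q * r)).
    by rewrite !big_ord_recl big_ord0 addr0 !addrA.
  apply: (dim_family (b := b)) => [x|v].
    have [c [d [c' [d' xE]]]] := spanA _ (As x).
    exists (\row_i nth 0 [:: c; d; c'; d'] i); rewrite bE !mxE /=.
    by apply: sI; rewrite As4.
  rewrite bE => /(congr1 s); rewrite As4 rmorph0 => /freeA[v0 v1 v2 v3].
  apply/rowP => i; rewrite mxE.
  case: (unliftP ord0 i) => [i1 ->|-> //]; case: (unliftP ord0 i1) => [i2 ->|-> //].
  by case: (unliftP ord0 i2) => [i3 ->|-> //]; rewrite ord1.
- apply/eqP; rewrite eqEsubv; apply/andP; split; last first.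
    by rewrite -memvE memv_cap memvf; apply/centvP => x _; rewrite mulr1 mul1r.
  apply/subvP => x; rewrite memv_cap => /andP[_ /centvP xC].
  have xg : s x * g = g * s x by rewrite -sq -!rmorphM xC ?memvf.
  have xy : s x * y = y * s x by rewrite -sr -!rmorphM xC ?memvf.
  have [c [d [z [xE oz]]]] := order_decomposition (As x).
  have z0 : z = 0.
    apply: centralizer_orthogonal => //; move: xg.
    rewrite xE mulrDl mulrDr mulrDl mulrDr scalarC -scalerAl -scalerAr.
    by move/addrI.
  suff d0 : d = 0.
    apply/vlineP; exists c; apply: sI.
    by rewrite xE z0 d0 rmorph0 scale0r !addr0 s1.
  apply/eqP/negPn/negP => d0; case/eqP: y0; apply: centralizer_orthogonal => //.
  have id0 : iota d != 0 by rewrite fmorph_eq0.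
  apply: (scalerI id0); move: xy; rewrite xE z0 addr0 mulrDl mulrDr scalarC.
  by move/addrI; rewrite -scalerAl -scalerAr.
- move=> x x0; rewrite (algebra_unitE oA sI sA); apply: contraNneq x0 => dx.
  by apply/eqP; apply: sI; rewrite rmorph0 (Adiv (As x) dx).
Qed.

End QuadraticElement.

Lemma order_nonsplit (k K : fieldType) (iota : {rmorphism k -> K})
    (A : set 'M[K]_2) (g : 'M[K]_2) (T D : k) :
  algebraically_closed_in iota -> constant_order iota A ->
  A g -> \tr g = iota T -> \det g = iota D ->
  (forall c : k, c ^+ 2 - T * c + D != 0) -> T ^+ 2 - 4 * D != 0 ->
  [\/ exists L : fieldExtType k,
         separable_quadratic L /\ group_iso *%R (order_units A) *%R (units L),
       group_iso *%R (order_units A) *%R (units 'M[k]_2)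
     | exists Q : falgType k,
         quaternion_division_algebra Q /\
         group_iso *%R (order_units A) *%R (units Q)].
Proof.
move=> hk oA Ag tg dg nr disc.
have [[w [Aw w0 dw]]|nosplit] := pselect (exists w, [/\ A w, w != 0 & \det w = 0]).
  by constructor 2; exact: (split_order_iso hk oA Ag tg dg nr Aw w0 dw).
have Adiv w : A w -> \det w = 0 -> w = 0.
  move=> Aw dw; apply/eqP; apply: contraPT nosplit => w0; apply.
  by exists w.
have [[y [oy y0]]|no_orth] := pselect (exists y, orthogonal A g y /\ y != 0).
  by constructor 3; exact: (order_quaternion oA Ag tg dg disc Adiv oy y0).
constructor 1; apply: (order_quadratic_field oA Ag tg dg disc Adiv) => y oy.
by apply/eqP; apply: contraPT no_orth => y0; apply; exists y.
Qed.

(** * Inseparable orders *)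

(** A subspace stable under L, of the largest dimension divisible by the degree of
    L, is everything: the orbit L v of a vector outside it meets it only in 0. *)
Lemma dim_extension_dvd (k : fieldType) (L : fieldExtType k) (V : vectType k)
    (act : L -> V -> V) :
  (forall c q q' v, act (c *: q + q') v = c *: act q v + act q' v) ->
  (forall c q v v', act q (c *: v + v') = c *: act q v + act q v') ->
  (forall q q' v, act (q * q') v = act q (act q' v)) ->
  (forall v, act 1 v = v) -> (\dim {:L} %| \dim {:V})%N.
Proof.
move=> actL actR actM act1.
pose stable (U : {vspace V}) := forall q u, u \in U -> act q u \in U.
pose P n := `[< exists2 U : {vspace V}, \dim U = n & stable U /\ (\dim {:L} %| n)%N >].
have [||n /asboolP[U dU [sU dvdU]] maxU] := @ex_maxnP P (\dim {:V}).
- exists 0%N; apply/asboolP; exists 0%VS; first exact: dimv0.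
  split=> // q u; rewrite !memv0 => /eqP ->.
  by have := actR (-1) q 0 0; rewrite !scaleN1r !addNr => ->.
- by move=> n /asboolP[U <- _]; apply: dimvS; exact: subvf.
suff UV : U = {:V}%VS by rewrite -UV dU.
apply/eqP; rewrite eqEsubv subvf /=; apply/subvP => v _; apply: contrapT => /negP nvU.
pose h q := act q v.
have hlin : linear h by move=> c q q'; exact: actL.
pose hb := GRing.isLinear.Build k L V _ h hlin.
pose H : {linear L -> V} := HB.pack h hb.
have HE q : linfun H q = act q v by rewrite lfunE.
have dis q : act q v \in U -> q = 0.
  move=> qU; apply/eqP; apply: contraNT nvU => q0.
  by rewrite -[v]act1 -(mulVf q0) actM sU.
pose U' := (U + limg (linfun H))%VS.
have dU' : \dim U' = (n + \dim {:L})%N.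
  rewrite /U' dimv_disjoint_sum ?dU; last first.
    apply/eqP; rewrite -subv0; apply/subvP => y; rewrite memv_cap memv0.
    case/andP=> yU /memv_imgP[q _ yE]; move: yU; rewrite yE HE => /dis ->.
    by have := actL (-1) 0 0 v; rewrite !scaleN1r !addNr => ->.
  congr (_ + _)%N; apply: limg_dim_eq; apply/eqP; rewrite -subv0; apply/subvP => q.
  rewrite memv_cap memv_ker HE memv0 => /andP[_ /eqP q0].
  by apply/eqP/dis; rewrite q0 mem0v.
have : (\dim U' <= n)%N.
  apply: maxU; apply/asboolP; exists U' => //; split; last first.
    by rewrite dU' dvdn_add.
  move=> q y /memv_addP[u uU [_ /memv_imgP[q' _ ->] ->]].
  rewrite -[u]scale1r actR scale1r memv_add ?sU // HE -actM -HE.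
  by rewrite memv_img ?memvf.
by rewrite dU' -[X in (_ <= X)%N]addn0 leq_add2l leqNgt adim_gt0.
Qed.

(** Adjoining an element whose square is already present multiplies the degree by
    1 or 2. *)
Lemma exponent_two_dim (k : fieldType) (L : fieldExtType k) :
  (forall q : L, q ^+ 2 \in 1%VS) -> exists m, \dim {:L} = (2 ^ m)%N.
Proof.
move=> sq.
pose P n := `[< exists2 E : {subfield L}, \dim E = n & exists m, n = (2 ^ m)%N >].
have [||n /asboolP[E dE [m nE]] maxE] := @ex_maxnP P (\dim {:L}).
- by exists 1%N; apply/asboolP; exists 1%AS; [exact: dimv1 | exists 0%N].
- by move=> n /asboolP[E <- _]; apply: dimvS; exact: subvf.
exists m; suff EL : E = {:L}%AS by rewrite -nE -dE EL.
apply/eqP; rewrite -val_eqE /= eqEsubv subvf /=; apply/subvP => q _.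
apply: contrapT => /negP nqE.
have deg2 : adjoin_degree E q = 2%N.
  have : minPoly E q %| 'X^2 - (q ^+ 2)%:P.
    apply: minPoly_dvdp; last by rewrite /root !hornerE subrr.
    rewrite rpredB ?rpredX ?polyOverX // polyOverC.
    exact: (subvP (sub1v E)) (sq q).
  have P0 : 'X^2 - (q ^+ 2)%:P != 0 by apply: monic_neq0; exact: monicXnsubC.
  move=> /(dvdp_leq P0); rewrite size_XnsubC // size_minPoly ltnS => le2.
  have n1 : adjoin_degree E q != 1%N by rewrite adjoin_deg_eq1.
  have n0 : (0 < adjoin_degree E q)%N.
    rewrite lt0n; apply/eqP => d0; have := dim_Fadjoin E q.
    by rewrite d0 mul0n => /eqP; rewrite -leqn0 leqNgt adim_gt0.
  by case: (adjoin_degree E q) le2 n1 n0 => [|[|[]]].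
have : (\dim <<E; q>> <= n)%N.
  apply: maxE; apply/asboolP; exists <<E; q>>%AS => //=.
  by exists m.+1; rewrite dim_Fadjoin deg2 dE nE expnS.
by rewrite dim_Fadjoin deg2 dE leqNgt mul2n -addnn -{1}[n]addn0 ltn_add2l -dE adim_gt0.
Qed.

Definition basis_modulo (k K : fieldType) (iota : k -> K) (M : lmodType K)
    (S T : set M) n (e : 'I_n -> M) :=
  (forall i, S (e i)) /\ forall x, S x ->
    exists! c : 'rV[k]_n, T (x - \sum_i iota (c 0 i) *: e i).

Section ResidueModule.
Variables (k K : fieldType) (iota : {rmorphism k -> K}).
Variables (S T : set 'M[K]_2).
Hypotheses (rS : is_subring S) (TB : forall x y, T x -> T y -> T (x - y))
  (SZ : forall c x, S x -> S (iota c *: x))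
  (TZ : forall c x, T x -> T (iota c *: x))
  (STM : forall x y, S x -> T y -> T (x * y)).
Variables (L : fieldExtType k) (s : {rmorphism L -> 'M[K]_2}).
Hypotheses (sZ : forall c q, s (c *: q) = iota c *: s q) (sS : forall q, S (s q)).

(** S / T is a module over S, and so a vector space over L. *)
Lemma residue_dim_dvd n (e : 'I_n -> 'M[K]_2) :
  basis_modulo iota S T e -> (\dim {:L} %| n)%N.
Proof.
move=> [Se ex].
pose sig (c : 'rV[k]_n) := \sum_i iota (c 0 i) *: e i.
have sigS c : S (sig c) by apply: (subring_sum rS) => i; exact: SZ.
have sigL a c c' : sig (a *: c + c') = iota a *: sig c + sig c'.
  rewrite /sig scaler_sumr -big_split /=; apply: eq_bigr => i _.
  by rewrite !mxE rmorphD rmorphM scalerDl scalerA.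
have T0 : T 0.
  have [c [Tc _]] := ex 1 (subring1 rS); by have := TB Tc Tc; rewrite subrr.
have TD x y : T x -> T y -> T (x + y).
  by move=> Tx Ty; rewrite -[y]opprK; apply: TB => //; rewrite -sub0r; exact: TB.
have /choice[rho rhoP] : forall x, exists c, S x ->
    T (x - sig c) /\ forall c', T (x - sig c') -> c = c'.
  move=> x; have [/ex[c [c1 c2]]|ns] := pselect (S x); last by exists 0.
  by exists c => _; split.
pose act q v := rho (s q * sig v).
have Sact q v : S (s q * sig v) by apply: (subringM rS).
have actP q v : T (s q * sig v - sig (act q v)) by case: (rhoP _ (Sact q v)).
have actU q v c : T (s q * sig v - sig c) -> act q v = c.
  by case: (rhoP _ (Sact q v)) => _; apply.
have lin a (x y x' y' : 'M[K]_2) : T (x - x') -> T (y - y') ->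
    T (iota a *: x + y - (iota a *: x' + y')).
  move=> Tx Ty; rewrite opprD addrACA -scalerBr; apply: TD => //; exact: TZ.
have dV : \dim {: 'rV[k]_n} = n by rewrite dimvf /dim /= mul1n.
rewrite -[X in (_ %| X)%N]dV; apply: (dim_extension_dvd (act := act)).
- move=> c q q' v; apply: actU; rewrite rmorphD sZ mulrDl -scalerAl sigL; exact: lin.
- move=> c q v v'; apply: actU; rewrite sigL mulrDr -scalerAr sigL; exact: lin.
- move=> q q' v; apply: actU; rewrite rmorphM.
  have := TD _ _ (STM (sS q) (actP q' v)) (actP q (act q' v)).
  by rewrite mulrBr mulrA addrA subrK.
- by move=> v; apply: actU; rewrite rmorph1 mul1r subrr.
Qed.
End ResidueModule.

(** The coefficient of g is determined by the entry (0, 1), where g is nonzero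
    since g00 is not an eigenvalue. *)
Lemma centralizer2 (F : fieldType) (g x : 'M[F]_2) : no_eigenvalue g ->
  x * g = g * x -> exists u v, x = u%:M + v *: g.
Proof.
move=> ng xg.
have g01 : g 0 1 != 0.
  apply: contraNneq (ng (g 0 0)) => g01; rewrite !mx2E g01; apply/eqP; ring.
pose v := x 0 1 / g 0 1; exists (x 0 0 - v * g 0 0), v.
have x01 : x 0 1 = v * g 0 1 by rewrite divfK.
have := congr1 (fun m : 'M[F]_2 => m 0 0) xg; rewrite !mulmx2E x01 => e00.
have := congr1 (fun m : 'M[F]_2 => m 0 1) xg; rewrite !mulmx2E x01 => e01.
apply: mx2P; rewrite !mxE /= ?mulr1n ?mulr0n ?add0r ?x01 ?subrK //.
  by apply: (mulfI g01); apply: (addrI (g 0 0 * x 0 0)); rewrite -e00; ring.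
have E : g 0 1 * x 1 1 = x 0 0 * g 0 1 + v * g 0 1 * g 1 1 - g 0 0 * (v * g 0 1).
  by rewrite e01 addrC addKr.
by apply: (mulfI g01); rewrite E; ring.
Qed.

Section CharTwoField.
Variables (k K : fieldType) (iota : {rmorphism k -> K}).
Variables (g : 'M[K]_2).
Hypotheses (two0 : (2 : K) = 0) (tg : \tr g = 0).

Let dbl (x : K) : x + x = 0. Proof. by rewrite -mulr2n -mulr_natl two0 mul0r. Qed.
Definition Kg : set 'M[K]_2 := [set x | exists u v, x = u%:M + v *: g].

Lemma Kg_scalar u : Kg u%:M.
Proof. by exists u, 0; rewrite scale0r addr0. Qed.

Lemma KgZ u x : Kg x -> Kg (u *: x).
Proof.
move=> [a [b ->]]; exists (u * a), (u * b).
by rewrite scalerDr scale_scalar_mx scalerA.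
Qed.

Lemma Kg_subring : is_subring Kg.
Proof.
split; first exact: Kg_scalar.
  move=> _ _ [a [b ->]] [c [d ->]]; exists (a - c), (b - d).
  by apply: mx2P; rewrite !mx2E /=; ring.
move=> _ _ [a [b ->]] [c [d ->]].
exists (a * c - b * d * \det g), (a * d + b * c + b * d * \tr g).
by apply: mx2P; rewrite !mx2E /=; ring.
Qed.

Lemma Kg_trace x : Kg x -> \tr x = 0.
Proof. by move=> [a [b ->]]; rewrite raddfD /= linearZ /= tg mulr0 addr0 trace2_scalar dbl. Qed.

(** On K[g] the determinant is squaring, as x^2 = - det x and char K = 2. *)
Lemma Kg_detD x y : Kg x -> Kg y -> \det (x + y) = \det x + \det y.
Proof.
move=> Ex Ey; rewrite det2D !Kg_trace //; last exact: (subringM Kg_subring).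
by rewrite mul0r addr0 subr0.
Qed.

Variables (P : place iota) (d : nat).
Hypothesis hd : place_degree P d.
Let dv := place_dval P.

Let OE : set 'M[K]_2 := [set x | Kg x /\ val_ge P 0 (\det x)].
Let mE : set 'M[K]_2 := [set x | Kg x /\ val_ge P 1 (\det x)].

Let val_sqr (n : nat) (x : K) : (n <= 1)%N -> val_ge P n%:Z (x ^+ 2) <-> val_ge P n%:Z x.
Proof.
move=> n1; have [->|x0] := eqVneq x 0; first by rewrite expr0n; split=> _; left.
rewrite !val_geE ?expf_neq0 // (dvalX dv) //.
case: n n1 => [|[|//]] _.
  by rewrite pmulrn_lge0.
by rewrite -!gtz0_ge1 pmulrn_lgt0.
Qed.

Let OE_subring : is_subring OE.
Proof.
split.
- by split; [exact: Kg_scalar | rewrite det1; exact: (subring1 (valuation_subring dv))].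
- move=> x y [Ex Ox] [Ey Oy]; split; first exact: (subringB Kg_subring).
  rewrite -scaleN1r Kg_detD //; last exact: KgZ.
  by rewrite det2Z sqrrN expr1n mul1r; exact: (val_geD dv).
- move=> x y [Ex Ox] [Ey Oy]; split; first exact: (subringM Kg_subring).
  by rewrite det_mulmx; exact: (subringM (valuation_subring dv)).
Qed.

Let mEB x y : mE x -> mE y -> mE (x - y).
Proof.
move=> [Ex Ox] [Ey Oy]; split; first exact: (subringB Kg_subring).
rewrite -scaleN1r Kg_detD //; last exact: KgZ.
by rewrite det2Z sqrrN expr1n mul1r; exact: (val_geD dv).
Qed.

Let OEmE x y : OE x -> mE y -> mE (x * y).
Proof.
move=> [Ex Ox] [Ey Oy]; split; first exact: (subringM Kg_subring).
by rewrite det_mulmx; have := val_geM dv Ox Oy; rewrite add0r.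
Qed.

Let OE_scalar a : OE a%:M <-> val_ge P 0 a.
Proof.
by rewrite -(val_sqr a (leq0n 1)) -det_scalar2; split=> [[]|Oa]; last (split=> //; exact: Kg_scalar).
Qed.

Let mE_scalar a : mE a%:M <-> val_ge P 1 a.
Proof.
by rewrite -(val_sqr a (leqnn 1)) -det_scalar2; split=> [[]|Oa]; last (split=> //; exact: Kg_scalar).
Qed.

Let OEZ a x : val_ge P 0 a -> OE x -> OE (a *: x).
Proof. by move=> /OE_scalar Oa Ox; rewrite -mul_scalar_mx; apply: (subringM OE_subring). Qed.

Let mEZ a x : val_ge P 0 a -> mE x -> mE (a *: x).
Proof. by move=> /OE_scalar Oa Ox; rewrite -mul_scalar_mx; exact: OEmE. Qed.

Let mED x y : mE x -> mE y -> mE (x + y).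
Proof.
move=> mx my; rewrite -[y]opprK; apply: mEB => //.
by rewrite -scaleN1r; apply: mEZ => //; right; rewrite (dvalN dv) (dval1 dv).
Qed.

Let mOE x : mE x -> OE x.
Proof. by move=> [Ex mx]; split=> //; apply: val_ge_trans mx. Qed.

(** The valuation of K[g] above P is the valuation of the determinant, OE is its
    ring and mE its maximal ideal.  If the residue field is larger than that of P,
    any u in OE with a new residue class satisfies OE = O + O u, for O the ring of
    P: if a + b u is in OE and b is not in O, then u + a / b lies in mE. *)
Lemma residue_basis : exists n (e : 'I_n -> 'M[K]_2),
  (n = d \/ n = d + d)%N /\ basis_modulo iota OE mE e.
Proof.
have [e [r [ge _ r1 r2]]] := residue_coordinates hd.
pose sg (c : 'rV[k]_d) := \sum_i iota (c 0 i) * e i.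
have Oc c : val_ge P 0 (iota c) := constant_val_ge P c.
have gsg c : val_ge P 0 (sg c).
  apply: (val_ge_sum dv) => i.
  exact: (subringM (valuation_subring dv) (Oc _) (ge i)).
have sgM c (x : 'M[K]_2) : sg c *: x = \sum_i iota (c 0 i) *: (e i *: x).
  by rewrite scaler_suml; apply: eq_bigr => i _; rewrite scalerA.
have [res1|nres1] := pselect (forall x, OE x -> exists2 a, val_ge P 0 a & mE (x - a%:M)).
  exists d, (fun i => (e i)%:M); split; [by left | split].
    by move=> i; apply/OE_scalar.
  move=> x /res1[a Oa xa].
  have sgE (c : 'rV[k]_d) : \sum_i iota (c 0 i) *: (e i)%:M = (sg c)%:M :> 'M[K]_2.
    by rewrite -scalemx1 sgM; apply: eq_bigr => i _; rewrite scalemx1.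
  exists (r a); split=> [|c]; rewrite sgE.
    have -> : x - (sg (r a))%:M = (x - a%:M) + (a - sg (r a))%:M.
      by rewrite raddfB /= addrA subrK.
    by apply: mED => //; apply/mE_scalar; exact: r1.
  move=> xc; apply: r2 => //; apply/mE_scalar; rewrite raddfB /=.
  have -> : a%:M - (sg c)%:M = (x - (sg c)%:M) - (x - a%:M).
    by rewrite opprB [RHS]addrC addrA subrK.
  exact: mEB.
have [u [Ou nu]] : exists u, OE u /\ forall a, val_ge P 0 a -> ~ mE (u - a%:M).
  apply: contrapT => nex; apply: nres1 => x Ox; apply: contrapT => nx.
  by apply: nex; exists x; split=> // a Oa xa; apply: nx; exists a.
(* u is not a scalar, so 1 and u span K[g] *)
have span x : Kg x -> exists a b, x = a%:M + b *: u.
  move=> [x0 [x1 ->]]; have [[u0 [u1 uE]] _] := Ou.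
  have u10 : u1 != 0.
    apply/eqP => u10; apply: (nu u0).
      by apply/OE_scalar; move: Ou; rewrite uE u10 scale0r addr0.
    by rewrite uE u10 scale0r addr0 subrr -(raddf0 (@scalar_mx K 2)); apply/mE_scalar; left.
  exists (x0 - x1 / u1 * u0), (x1 / u1); rewrite uE.
  rewrite scalerDr scale_scalar_mx scalerA divfK // addrA -raddfD /=.
  by rewrite subrK.
have unit_ratio a b : b != 0 -> OE (a%:M + b *: u) -> 
    (P b <= 0) -> ~ (mE (b^-1 *: (a%:M + b *: u))).
  move=> b0 Ox Pb mb.
  apply: (nu (- (a / b))).
    apply/OE_scalar.
    have -> : (- (a / b))%:M = u - b^-1 *: (a%:M + b *: u).
      rewrite scalerDr scalerA mulVf // scale1r scale_scalar_mx opprD addrC subrK.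
      by rewrite mulrC raddfN.
    by apply: (subringB OE_subring) => //; exact: mOE.
  have -> : u - (- (a / b))%:M = b^-1 *: (a%:M + b *: u) => //.
  rewrite scalerDr scalerA mulVf // scale1r scale_scalar_mx raddfN opprK addrC.
  by rewrite mulrC.
have Oab a b : OE (a%:M + b *: u) -> val_ge P 0 b /\ val_ge P 0 a.
  move=> Ox; have Ob : val_ge P 0 b.
    have [->|b0] := eqVneq b 0; first by left.
    right; rewrite leNgt; apply/negP => Pb.
    apply: (unit_ratio a b b0 Ox (ltW Pb)).
    have [Ex Dx] := Ox; split; first exact: KgZ.
    rewrite det2Z; apply: (val_ge_trans (n := 2 + 0)) => //.
    apply: (val_geM dv) => //; right.
    rewrite (dvalX dv) ?invr_eq0 // (dvalV dv) // mulr2n.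
    have h : 1 <= - P b by rewrite -gtz0_ge1 oppr_gt0.
    exact: (lerD h h).
  split=> //; apply/OE_scalar; rewrite -[a%:M](addrK (b *: u)).
  by apply: (subringB OE_subring) => //; exact: OEZ.
have mab a b : mE (a%:M + b *: u) -> val_ge P 1 b /\ val_ge P 1 a.
  move=> mx; have [Ob Oa] := Oab a b (mOE mx).
  have mb : val_ge P 1 b.
    have [->|b0] := eqVneq b 0; first by left.
    right; rewrite -gtz0_ge1 ltNge; apply/negP => Pb.
    apply: (unit_ratio a b b0 (mOE mx) Pb); apply: mEZ => //.
    by right; rewrite (dvalV dv) // oppr_ge0.
  split=> //; apply/mE_scalar; rewrite -[a%:M](addrK (b *: u)); apply: mEB => //.
  by rewrite -mul_mx_scalar; apply: OEmE => //; exact/mE_scalar.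
pose e2 (i : 'I_(d + d)) : 'M[K]_2 :=
  match fintype.split i with inl i1 => (e i1)%:M | inr i2 => e i2 *: u end.
exists (d + d)%N, e2; split; [by right | split].
  move=> i; rewrite /e2; case: (fintype.split i) => i'; first exact/OE_scalar.
  exact: OEZ.
have e2E (c : 'rV[k]_(d + d)) : \sum_i iota (c 0 i) *: e2 i = (sg (lsubmx c))%:M + sg (rsubmx c) *: u.
  rewrite big_split_ord /= -scalemx1 !sgM; congr (_ + _); apply: eq_bigr => i _.
    by rewrite /e2 (unsplitK (inl i)) mxE scalemx1.
  by rewrite /e2 (unsplitK (inr i)) mxE.
move=> x Ox; have [a [b xE]] := span x (let: conj Ex _ := Ox in Ex).
have [Ob Oa] : val_ge P 0 b /\ val_ge P 0 a by apply: Oab; rewrite -xE.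
have diff (c : 'rV[k]_(d + d)) : x - \sum_i iota (c 0 i) *: e2 i =
    (a - sg (lsubmx c))%:M + (b - sg (rsubmx c)) *: u.
  by rewrite xE e2E opprD addrACA raddfB scalerBl.
exists (row_mx (r a) (r b)); split=> [|c].
  rewrite diff row_mxKl row_mxKr; apply: mED; first by apply/mE_scalar; exact: r1.
  by rewrite -mul_mx_scalar; apply: OEmE => //; apply/mE_scalar; exact: r1.
rewrite diff => /mab[mb ma]; rewrite -[c]hsubmxK.
by rewrite (r2 _ _ Oa ma) (r2 _ _ Ob mb).
Qed.

(** The residue field of K[g] above P contains L. *)
Lemma residue_degree_dvd (L : fieldExtType k) (s : {rmorphism L -> 'M[K]_2}) :
  (forall c q, s (c *: q) = iota c *: s q) ->
  (forall q, Kg (s q)) -> (forall q, exists c, \det (s q) = iota c) ->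
  (\dim {:L} %| d + d)%N.
Proof.
move=> sZ sK sd; have [n [e [nE be]]] := residue_basis.
have sO q : OE (s q).
  by split=> //; have [c ->] := sd q; exact: constant_val_ge.
have := residue_dim_dvd OE_subring mEB (fun c x => OEZ (constant_val_ge P c))
  (fun c x => mEZ (constant_val_ge P c)) OEmE sZ sO be.
by case: nE => -> // dvd; exact: dvdn_add.
Qed.
End CharTwoField.

(** The identity x y + y x = tr(x) y + tr(y) x + tr(x y) - tr(x) tr(y) makes A
    commutative as soon as all traces vanish and the characteristic is 2. *)
Lemma order_inseparable (k K : fieldType) (iota : {rmorphism k -> K})
    (A : set 'M[K]_2) (g : 'M[K]_2) (T D : k) :
  algebraically_closed_in iota -> constant_order iota A ->
  A g -> \tr g = iota T -> \det g = iota D ->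
  (forall c : k, c ^+ 2 - T * c + D != 0) -> T ^+ 2 = 4 * D ->
  (forall x, order_units A x -> \tr x ^+ 2 = 4 * \det x) ->
  2%N \in [pchar k] /\
  exists m : nat,
    [/\ (1 <= m)%N,
        exists F : fieldExtType k,
          [/\ purely_inseparable 1 {:F}, \dim {:F} = (2 ^ m)%N
            & group_iso *%R (order_units A) *%R (units F)]
      & forall (P : place iota) (d : nat),
          place_degree P d -> (2 ^ m.-1 %| d)%N].
Proof.
move=> hk oA Ag tg dg nr disc hd; have rA := corder_ring oA.
have two0 : (2 : k) = 0.
  apply/eqP; apply: contraT => two0; have /eqP := nr (T / 2); case.
  apply: (mulfI two0); apply: (mulfI two0).
  transitivity (4 * D - T ^+ 2); first by field.
  by rewrite disc subrr mulr0 mulr0.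
have four0 : (4 : k) = 0 by rewrite -[4]/((2 * 2)%:R) natrM two0 mul0r.
have T0 : T = 0 by apply/eqP; rewrite -sqrf_eq0 disc four0 mul0r.
have char2 : 2%N \in [pchar k] by rewrite inE /= two0 eqxx.
have two0K : (2 : K) = 0 by rewrite -(rmorph_nat iota 2) two0 rmorph0.
have four0K : (4 : K) = 0 by rewrite -(rmorph_nat iota 4) four0 rmorph0.
have ng := irreducible_no_eigenvalue hk tg dg nr.
rewrite T0 rmorph0 in tg.
have nsq c : c ^+ 2 + D != 0 by have := nr c; rewrite T0 mul0r subr0.
have trG x : order_units A x -> \tr x = 0.
  by move=> /hd E; apply/eqP; rewrite -sqrf_eq0 E four0K mul0r.
(* D is not a square, so 0, 1 and D are distinct, and one of x, x - 1, x - D is a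
   unit; its trace is that of x because scalars have trace 0 *)
have trA x : A x -> \tr x = 0.
  move=> Ax; have sh c : \det (x - (iota c)%:M) != 0 -> \tr x = 0.
    move=> dx; have := trG (x - (iota c)%:M).
    rewrite raddfB /= trace2_scalar -mulr2n -mulr_natl two0K mul0r subr0; apply.
    by split=> //; apply: (subringB rA) => //; exact: (corder_scalar oA).
  apply: contrapT => tx.
  have z c : \det (x - (iota c)%:M) = 0.
    by apply: contrapT => /eqP dc; apply: tx; exact: sh dc.
  have := z 0; rewrite rmorph0 raddf0 subr0 => d0.
  have := z 1; rewrite det2_scalarB d0 rmorph1 expr1n mulr1 addr0 => /eqP.
  rewrite subr_eq0 => /eqP t1.
  have := z D; rewrite det2_scalarB d0 -t1 mul1r addr0 -rmorphXn -rmorphB => /eqP.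
  rewrite fmorph_eq0 -{2}[D]mul1r expr2 -mulrBl mulf_eq0 subr_eq0 => /orP[]/eqP D1.
    by have := nsq 1; rewrite D1 expr1n -mulr2n -[1 *+ 2]/(2%:R) two0 eqxx.
  by have := nsq 0; rewrite D1 expr0n addr0 eqxx.
have Acomm x y : A x -> A y -> x * y = y * x.
  move=> Ax Ay; have Axy := subringM rA Ax Ay.
  have := anticommutator2 x y; rewrite !trA // !scale0r mul0r subr0 raddf0 !addr0.
  move/eqP; rewrite addr_eq0 => /eqP ->; apply/eqP; rewrite -subr_eq0 -opprD.
  by rewrite -mulr2n -scaler_nat two0K scale0r oppr0.
have Adiv x : A x -> \det x = 0 -> x = 0.
  move=> Ax dx; apply/eqP; apply: contraT => x0.
  by have := nilpotent_trace_neq0 ng x0 dx (trA _ Ax); rewrite trA ?eqxx //; exact: (subringM rA).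
have [F [s [sI sZ sA]]] := order_field oA Acomm Adiv.
have As q : A (s q) by apply/sA; exists q.
have s1 c : s c%:A = (iota c)%:M by rewrite sZ rmorph1 scalemx1.
have sq (q : F) : q ^+ 2 \in 1%VS.
  have [c cE] := corder_det oA (As q).
  apply/vlineP; exists (- c); apply: sI.
  rewrite s1 rmorphXn expr2 quadratic2 trA // scale0r add0r cE.
  by rewrite rmorphN raddfN.
have [m dimF] := exponent_two_dim sq.
split=> //; exists m; split.
- rewrite lt0n; apply/eqP => m0.
  have F1 : {:F}%VS = 1%VS.
    apply/eqP; rewrite eq_sym eqEdim subvf dimF m0 dimv1 //.
  have [q qE] := (sA _).1 Ag.
  have /vlineP[c cE] : q \in 1%VS by rewrite -F1 memvf.
  have := ng (iota c); rewrite tg mul0r subr0 -qE cE s1 det_scalar -mulr2n -mulr_natl.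
  by rewrite two0K mul0r eqxx.
- exists F; split=> //; last exact: (order_units_iso oA sI sA).
  apply/purely_inseparableP => q _; apply/purely_inseparable_elementP_pchar.
  exists 2%N; last exact: sq.
  rewrite pnatE // inE /=; apply/eqP.
  by rewrite -[2%:R]/(2%:R : F) -(rmorph_nat (in_alg F) 2) /= two0 scale0r.
- move=> P d hP.
  have Ks q : Kg g (s q).
    by apply: (centralizer2 ng); exact: Acomm.
  have ds q : exists c, \det (s q) = iota c by exact: (corder_det oA).
  have := residue_degree_dvd two0K tg hP sZ Ks ds.
  rewrite dimF; case: m {dimF} => [|m]; first by rewrite dvd1n.
  by rewrite expnS addnn -mul2n dvdn_pmul2l.
Qed.

(** * Eigenvalues and the main theorem *)

Section Eigenvalues.
Variables (k K : fieldType) (iota : {rmorphism k -> K}).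
Variables (Kbar : closedFieldType) (j : {rmorphism K -> Kbar}).
Implicit Types (g : 'M[K]_2) (a : Kbar).

Lemma eigenvalue2E g a :
  eigenvalue_of j g a <-> a ^+ 2 - j (\tr g) * a + j (\det g) = 0.
Proof.
rewrite /eigenvalue_of /eigenvalue /eigenspace kermx_eq0 row_free_unit unitmxE unitfE negbK.
rewrite -det_map_mx -trace_map_mx -det2_scalarB.
by split=> /eqP.
Qed.

Lemma eigenvalue2_other g a : eigenvalue_of j g a -> eigenvalue_of j g (j (\tr g) - a).
Proof. by rewrite !eigenvalue2E => E; rewrite -[RHS]E; ring. Qed.

Lemma eigenvalue2_exists g : exists a, eigenvalue_of j g a.
Proof.
pose p : {poly Kbar} := 'X^2 - (j (\tr g))%:P * 'X + (j (\det g))%:P.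
have sp : size p != 1%N.
  apply/eqP => /eqP/size_poly1P[c _ /(congr1 (fun q : {poly Kbar} => q`_2))/eqP].
  by rewrite coefD coefB coefXn coefCM coefX !coefC /= mulr0 subr0 addr0 oner_eq0.
have [a /rootP] := closed_rootP p sp; rewrite !hornerE => E.
by exists a; apply/eigenvalue2E.
Qed.

Lemma distinct_discriminant g : distinct_eigenvalues j g -> \tr g ^+ 2 != 4 * \det g.
Proof.
move=> [a [b [/eigenvalue2E Ea /eigenvalue2E Eb nab]]].
have ab : a - b != 0 by rewrite subr_eq0.
have tE : j (\tr g) = a + b.
  apply/eqP; rewrite -subr_eq0; apply/eqP; apply: (mulfI ab).
  rewrite mulr0 -[RHS](subrr 0) -{1}Eb -{1}Ea; ring.
have dE : j (\det g) = a * b.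
  by move/eqP: Ea; rewrite addr_eq0 tE -eqr_oppLR => /eqP <-; ring.
apply: contraNneq ab => E; rewrite -sqrf_eq0; apply/eqP.
transitivity (j (\tr g) ^+ 2 - j 4 * j (\det g)); first by rewrite tE dE rmorph_nat; ring.
by rewrite -rmorphXn E rmorphM subrr.
Qed.

Lemma repeated_discriminant g : repeated_eigenvalues j g -> \tr g ^+ 2 = 4 * \det g.
Proof.
move=> rep; have [a Ea] := eigenvalue2_exists g.
have /eqP := rep _ _ Ea (eigenvalue2_other Ea); rewrite eq_sym subr_eq => /eqP tE.
apply: (fmorph_inj j); rewrite rmorphXn rmorphM rmorph_nat.
by move/eigenvalue2E: Ea => /eqP; rewrite addrC addr_eq0 tE => /eqP ->; ring.
Qed.

Lemma eigenvalues_in_k_split g : eigenvalues_in_k iota j g ->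
  exists c d, \tr g = iota (c + d) /\ \det g = iota (c * d).
Proof.
move=> ink; have [a Ea] := eigenvalue2_exists g.
have [c cE] := ink _ Ea; have [d dE] := ink _ (eigenvalue2_other Ea).
have tE : j (\tr g) = j (iota (c + d)).
  by rewrite !rmorphD /= -cE -dE addrC subrK.
exists c, d; split; apply: (fmorph_inj j) => //.
move/eigenvalue2E: Ea; rewrite tE cE => /eqP; rewrite addrC addr_eq0 => /eqP ->.
by rewrite !rmorphD !rmorphM /=; ring.
Qed.

Lemma eigenvalues_not_in_k_root g T D : eigenvalues_not_in_k iota j g ->
  \tr g = iota T -> \det g = iota D -> forall c : k, c ^+ 2 - T * c + D != 0.
Proof.
move=> nink tg dg c; apply/eqP => E; apply: (nink (j (iota c))); last by exists c.
apply/eigenvalue2E; rewrite tg dg -!(rmorphM, rmorphXn) -!(rmorphB, rmorphD).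
by rewrite E !rmorph0.
Qed.
End Eigenvalues.

Theorem theoremA
  (k K : fieldType) (iota : {rmorphism k -> K})
  (hK : function_field iota) (hk : algebraically_closed_in iota)
  (oo : place iota) (delta : nat) (hdelta : place_degree oo delta)
  (Koo : fieldType) (voo : Koo -> int) (i : {rmorphism K -> Koo})
  (hKoo : is_completion oo voo i)
  (Kbar : closedFieldType) (j : {rmorphism K -> Kbar})
  (hKbar : is_algebraic_closure j)
  (hquad : exists p : {poly k}, size p = 3%N /\ forall x : k, ~~ root p x)
  (v : set 'M[Koo]_2) (hv : tree_vertex voo v) :
  let G := GL2 (integral_outside oo) in
  let Gv := vertex_stabilizer i G v in
  let Z := [set g | G g /\ is_scalar_mx g] in
  (* (a) *)
  ((forall g, Gv g -> eigenvalues_in_k iota j g) ->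
   (exists2 g, Gv g & distinct_eigenvalues j g) ->
   exists N : set 'M[K]_2,
     [/\ normal_subgroup N Gv,
         group_iso (@mulset _) (quotient_set Gv N)
           (fun p q : k * k => (p.1 * q.1, p.2 * q.2)) (units k `*` units k)
       & exists V : vectType k, group_iso *%R N +%R [set: V]])
  /\
  (* (b) *)
  ((forall g, Gv g -> repeated_eigenvalues j g /\ eigenvalues_in_k iota j g) ->
   exists N : set 'M[K]_2,
     [/\ internal_direct_product Gv Z N,
         exists V : vectType k, group_iso *%R N +%R [set: V]
       & group_iso *%R Z *%R (units k)])
  /\
  (* (c) *)
  ((exists g, [/\ Gv g, distinct_eigenvalues j g
                & eigenvalues_not_in_k iota j g]) ->
   [\/ exists L : fieldExtType k,
         separable_quadratic L /\ group_iso *%R Gv *%R (units L),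
       group_iso *%R Gv *%R (units 'M[k]_2)
     | exists Q : falgType k,
         quaternion_division_algebra Q /\ group_iso *%R Gv *%R (units Q)])
  /\
  (* (d) *)
  ((forall g, Gv g -> repeated_eigenvalues j g) ->
   (exists2 g, Gv g & eigenvalues_not_in_k iota j g) ->
   2%N \in [pchar k] /\
   exists m : nat,
     [/\ (1 <= m)%N,
         exists F : fieldExtType k,
           [/\ purely_inseparable 1 {:F}, \dim {:F} = (2 ^ m)%N
             & group_iso *%R Gv *%R (units F)]
       & forall (P : place iota) (d : nat),
           place_degree P d -> (2 ^ m.-1 %| d)%N]).
Proof.
have [g0 ug ->] := hv.
have oA := vertex_order_corder hK hk hdelta hKoo ug.
set A := vertex_order oo voo i g0 in oA.
have GvE : vertex_stabilizer i (GL2 (integral_outside oo))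
    [set g0 * h | h in ZGL2 voo] = order_units A.
  exact: (vertex_stabilizerE hK hk hdelta hKoo ug).
move=> G Gv Z.
have {}GvE : Gv = order_units A by [].
have ZE : Z = [set (iota c)%:M | c in [set c | c != 0]].
  exact: (GL2_scalar hK hk oo).
rewrite {}GvE {}ZE => {Gv Z}.
split; [|split; [|split]].
- move=> ink [g Gg dist]; have [Ag _] := Gg.
  have [c [d [tg dg]]] := eigenvalues_in_k_split (ink _ Gg).
  have cd : c - d != 0.
    apply: contraNneq (distinct_discriminant dist) => /eqP.
    rewrite subr_eq0 => /eqP cd; rewrite tg dg cd rmorphD rmorphM.
    by apply/eqP; ring.
  have icd : iota c - iota d != 0 by rewrite -rmorphB fmorph_eq0.
  pose e := iota (c - d)^-1 *: (g - (iota d)%:M).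
  apply: (@order_borel _ _ _ _ oA _ _ e (1 - e)) => //.
  + have [p [sp np]] := hquad.
    exists (- p`_1 / p`_2), (p`_0 / p`_2) => a.
    have p2 : p`_2 != 0 by have := lead_coef_eq0 p; rewrite lead_coefE sp => ->; rewrite -size_poly_eq0 sp.
    apply: contraNneq (np a) => E; rewrite /root horner_coef sp !big_ord_recr big_ord0 /= add0r.
    apply/eqP; transitivity (p`_2 * (a ^+ 2 - - p`_1 / p`_2 * a + p`_0 / p`_2)); last by rewrite E mulr0.
    by field.
  + by move=> h Gh; apply: (eigenvalues_in_k_split (ink _ Gh)).
  + apply: (corderZ oA); apply: (subringB (corder_ring oA)) => //; exact: (corder_scalar oA).
  + rewrite det2Z det2_scalarB tg dg rmorphD rmorphM.
    by rewrite (_ : _ - _ + _ = 0) ?mulr0 //; ring.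
  + rewrite linearZ /= raddfB /= tg trace2_scalar fmorphV rmorphB rmorphD.
    by field.
- move=> hb; have [|N [dp VN]] := order_split_unipotent oA.
    move=> g Gg; have [rep ink] := hb g Gg.
    have [c [d [tg dg]]] := eigenvalues_in_k_split ink.
    have := repeated_discriminant rep; rewrite tg dg => E.
    have cd : d = c.
      apply/eqP; rewrite -subr_eq0 -sqrf_eq0 -(fmorph_eq0 iota); apply/eqP.
      transitivity (iota (c + d) ^+ 2 - 4 * iota (c * d)); last by rewrite E subrr.
      by rewrite rmorphXn rmorphB rmorphD rmorphM; ring.
    by exists c; rewrite cd expr2.
  by exists N; split=> //; exact: scalar_group_iso.
- move=> [g [[Ag dg0] dist nink]].
  have [[T tg] [D dg]] := (corder_trace oA Ag, corder_det oA Ag).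
  apply: (order_nonsplit hk oA Ag tg dg (eigenvalues_not_in_k_root nink tg dg)).
  rewrite subr_eq0; apply: contraNneq (distinct_discriminant dist) => E.
  by rewrite tg dg -rmorphXn E rmorphM rmorph_nat.
- move=> rep [g Gg nink]; have [Ag _] := Gg.
  have [[T tg] [D dg]] := (corder_trace oA Ag, corder_det oA Ag).
  apply: (order_inseparable hk oA Ag tg dg (eigenvalues_not_in_k_root nink tg dg)).
    apply: (fmorph_inj iota); rewrite rmorphXn rmorphM rmorph_nat -tg -dg.
    exact: repeated_discriminant (rep _ Gg).
  by move=> x Gx; exact: repeated_discriminant (rep _ Gx).
Qed.
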